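(* Let $w$ be a weight function on $[0,\infty)$, let $A:=L_0^\infty(w)^*$ be equipped with the first Arens product, let $\theta:A\to A$ be a continuous isomorphism of $A$ onto itself and let $D:A\to A$ be a $\theta$-derivation. Then: (i) For every $u\in\Lambda(A)$, the restriction $D|_{uA}$ of $D$ to $uA=\{um:m\in A\}$ is continuous. (ii) $D$ is continuous if and only if the restriction $D|_{\mathrm{ran}(A)}$ is continuous.
   Context: A weight function is a continuous function $w:[0,\infty)\to[1,\infty)$ with $w(0)=1$ and $w(x+y)\le w(x)w(y)$ for all $x,y\ge 0$. $L^1(w)$ is the Banach space of (classes of) complex Lebesgue measurable functions $\varphi$ on $[0,\infty)$ with $\|\varphi\|_w=\int_0^\infty w(x)|\varphi(x)|\,dx<\infty$. $L_0^\infty(w)$ is the Banach space of (classes of) complex Lebesgue measurable functions $f$ on $[0,\infty)$ such that $f/w$ is essentially bounded and $\lim_{x\to\infty}\operatorname{ess\,sup}_{y>x}|f(y)|/w(y)=0$, with norm $\operatorname{ess\,sup}|f|/w$. For $f\in L_0^\infty(w)$ and $\varphi\in L^1(w)$ let $(f\varphi)(x)=\int_0^\infty f(x+y)\varphi(y)\,dy$ for $x\ge 0$, which defines an element of $L_0^\infty(w)$. For $n\in L_0^\infty(w)^*$ and $f\in L_0^\infty(w)$, $nf\in L_0^\infty(w)$ is the element determined by $\int_0^\infty (nf)(x)\varphi(x)\,dx=\langle n,f\varphi\rangle$ for all $\varphi\in L^1(w)$. The dual $A=L_0^\infty(w)^*$ is a Banach algebra under the first Arens product $\langle mn,f\rangle=\langle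 m,nf\rangle$. Continuity refers to the norm topology of $A$. $\mathrm{ran}(A)=\{r\in A: ar=0\text{ for all }a\in A\}$ is the right annihilator. $\Lambda(A)$ is the set of right identities of $A$ (elements $u$ with $mu=m$ for all $m\in A$) of norm one. A homomorphism is a linear multiplicative map $A\to A$; an isomorphism on $A$ is a bijective homomorphism $A\to A$. Given a homomorphism $\theta$, a $\theta$-derivation on $A$ is a linear map $D:A\to A$ (no continuity assumed) with $D(mn)=D(m)\theta(n)+\theta(m)D(n)$ for all $m,n\in A$. *)

(* Defs.v *)
From HB Require Import structures.
From mathcomp Require Import all_boot all_order all_algebra.
From mathcomp Require Import generic_quotient ring_quotient complex.
From mathcomp Require Import all_classical all_reals all_analysis.
From mathcomp Require Import ess_sup_inf measurable_realfun.

Set Implicit Arguments.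
Unset Strict Implicit.
Unset Printing Implicit Defensive.

Import Order.TTheory GRing.Theory Num.Theory.
Import numFieldNormedType.Exports.
Import ComplexField Normc.

Local Open Scope classical_set_scope.
Local Open Scope ring_scope.
Local Open Scope complex_scope.

(* Only the values of a weight on [0, +oo[ are meaningful. *)
Record weight (R : realType) := Weight {
  weight_fun :> R -> R;
  weight_continuous : {within `[0, +oo[, continuous weight_fun};
  weight_ge1 : forall x, 0 <= x -> 1 <= weight_fun x;
  weight_at0 : weight_fun 0 = 1;
  weight_submul : forall x y, 0 <= x -> 0 <= y ->
    weight_fun (x + y) <= weight_fun x * weight_fun y
}.

Section complex_functions.
Context {R : realType}.
Implicit Types (D : set R) (f : R -> R[i]).

(* R carries the Borel sigma-algebra. Since functions are only considered up to
   equality almost everywhere, Borel representatives give the same classes as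
   Lebesgue measurable ones. A function on [0, +oo[ is represented by a function
   on R whose values on the negative reals are irrelevant. *)
Definition cmeasurable D f :=
  measurable_fun D (fun x => complex.Re (f x)) /\
  measurable_fun D (fun x => complex.Im (f x)).

Definition cintegral f : R[i] :=
  (\int[lebesgue_measure]_(x in `[0, +oo[) complex.Re (f x))%:C +
  'i * (\int[lebesgue_measure]_(x in `[0, +oo[) complex.Im (f x))%:C.

Definition L1w (w : weight R) : set (R -> R[i]) := [set phi |
  cmeasurable `[0, +oo[ phi /\
  (\int[lebesgue_measure]_(x in `[0%R, +oo[) (w x * normc (phi x))%:E < +oo)%E].

Lemma mrestr_ae D (mD : measurable D) (P : R -> Prop) :
  (\forall x \ae mrestr lebesgue_measure mD, P x) <->
  (\forall x \ae lebesgue_measure, D x -> P x).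
Proof.
split=> [[A [mA A0 PA]]|[A [mA A0 PA]]].
  exists (A `&` D); split => //; first exact: measurableI.
  by move=> x /= /not_implyP[Dx nPx]; split=> //; apply: PA.
exists (A `|` ~` D); split.
- by apply: measurableU => //; exact: measurableC.
- rewrite /mrestr setIUl setICl setU0.
  by apply: (subset_measure0 _ mA _ A0) => //; exact: measurableI.
- move=> x /= nPx; have [Dx|] := pselect (D x); last by right.
  by left; apply: PA => /= /(_ Dx).
Qed.

End complex_functions.

Section weighted_essential_supremum.
Context {R : realType} (w : weight R).
Implicit Types (D : set R) (f g : R -> R[i]).

Definition wess_sup D (mD : measurable D) f : \bar R :=
  ess_sup (mrestr lebesgue_measure mD) (fun x => (normc (f x) / w x)%:E).

Let wnorm f := wess_sup (measurable_itv `[0%R, +oo[) f.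
Let wtail f x := wess_sup (measurable_itv `]x, +oo[) f.

Lemma weight_gt0 x : 0 <= x -> 0 < w x.
Proof. by move=> x0; rewrite (lt_le_trans ltr01)// weight_ge1. Qed.

Lemma normc_ge0 (z : R[i]) : 0 <= normc z.
Proof. by case: z => a b; exact: sqrtr_ge0. Qed.

Lemma wess_sup_ge0 D (mD : measurable D) f : D `<=` `[0, +oo[ ->
  (0 < lebesgue_measure D)%E -> (0 <= wess_sup mD f)%E.
Proof.
move=> D0 Dgt0; apply: ess_sup_gee; first by rewrite /= /mrestr setTI.
apply/mrestr_ae/nearW => x /D0 /=; rewrite in_itv/= andbT => x0.
by rewrite lee_fin divr_ge0 ?normc_ge0// ltW// weight_gt0.
Qed.

Lemma wess_sup_comb D (mD : measurable D) a f g : D `<=` `[0, +oo[ ->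
  (0 < lebesgue_measure D)%E ->
  (wess_sup mD (a *: f + g)%R <=
   (normc a)%:E * wess_sup mD f + wess_sup mD g)%E.
Proof.
move=> D0 Dgt0; have Dgt0' : (0 < mrestr lebesgue_measure mD [set: R])%E.
  by rewrite /= /mrestr setTI.
rewrite /wess_sup -ess_supZl ?normc_ge0//.
apply: le_trans (ess_supD _ _ _).
apply: le_ess_sup; apply/mrestr_ae/nearW => x /D0 /=.
rewrite in_itv/= andbT => x0; rewrite -EFinM -EFinD lee_fin mulrA -mulrDl.
rewrite ler_pM2r ?invr_gt0 ?weight_gt0//.
by rewrite (le_trans (le_normcD _ _))// lerD2r normcM.
Qed.

Lemma lebesgue_measure_tail (x : R) : (0 < lebesgue_measure `]x, +oo[%classic)%E.
Proof. by rewrite lebesgue_measure_itv/= ?ltry//= ?addye// ltry. Qed.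

Lemma lebesgue_measure_half : (0 < lebesgue_measure `[0%R : R, +oo[%classic)%E.
Proof. by rewrite lebesgue_measure_itv/= ?ltry//= ?addye// ltry. Qed.

Lemma sub_tail (x : R) : 0 <= x -> `]x, +oo[%classic `<=` `[0, +oo[%classic.
Proof. by move=> x0 y /=; rewrite !in_itv/= !andbT => /ltW; exact: le_trans. Qed.

Definition L0_pred : {pred R -> R[i]} := fun f => `[<
  [/\ cmeasurable `[0, +oo[ f,
      (wess_sup (measurable_itv `[0%R, +oo[) f < +oo)%E &
      wess_sup (measurable_itv `]x, +oo[) f @[x --> +oo] --> 0%E] >].

Lemma L0_predP f : reflect [/\ cmeasurable `[0, +oo[ f, (wnorm f < +oo)%E &
      wtail f x @[x --> +oo] --> 0%E] (f \in L0_pred).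
Proof. exact: asboolP. Qed.

Lemma wess_sup0 D (mD : measurable D) : (0 < lebesgue_measure D)%E ->
  wess_sup mD (0 : R -> R[i]) = 0%E.
Proof.
move=> D0; rewrite /wess_sup -[RHS](@ess_sup_cst _ _ _ (mrestr lebesgue_measure mD))//.
  by congr ess_sup; apply/funext => x; rewrite /= expr0n/= addr0 sqrtr0 mul0r.
by rewrite /= /mrestr setTI.
Qed.

Lemma L0_submod_closed : submod_closed L0_pred.
Proof.
split.
  apply/L0_predP; split.
  - by split; exact: measurable_cst.
  - by rewrite /wnorm wess_sup0 ?ltry//; exact: lebesgue_measure_half.
  - rewrite (_ : wtail 0 = cst 0%E); first exact: cvg_cst.
    by apply/funext => x; rewrite /wtail wess_sup0//; exact: lebesgue_measure_tail.
move=> a f g /L0_predP[[mf1 mf2] ff tf] /L0_predP[[mg1 mg2] fg tg].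
apply/L0_predP; split.
- split.
  + rewrite (_ : (fun x => _) = (fun x => complex.Re a * complex.Re (f x)
      - complex.Im a * complex.Im (f x) + complex.Re (g x))).
      apply: measurable_funD => //; apply: measurable_funB; exact: measurable_funM.
    by apply/funext => x; rewrite -[(_ + _) x]/(a * f x + g x);
      case: a => ? ?; case: (f x) => ? ?; case: (g x).
  + rewrite (_ : (fun x => _) = (fun x => complex.Re a * complex.Im (f x)
      + complex.Im a * complex.Re (f x) + complex.Im (g x))).
      apply: measurable_funD => //; apply: measurable_funD; exact: measurable_funM.
    by apply/funext => x; rewrite -[(_ + _) x]/(a * f x + g x);
      case: a => ? ?; case: (f x) => ? ?; case: (g x).
- apply: le_lt_trans (wess_sup_comb _ _ _ _ _ _) _ => //.
    exact: lebesgue_measure_half.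
  rewrite lte_add_pinfty//.
  have [->|a0] := eqVneq (normc a) 0; first by rewrite mul0e ltry.
  by rewrite lte_mul_pinfty// lee_fin normc_ge0.
- have h : (fun x => (normc a)%:E * wtail f x + wtail g x)%E @ +oo --> 0%E.
    rewrite -[X in _ --> X]adde0 -[X in (X + _)%E](mule0 (normc a)%:E).
    by apply: cvgeD => //; exact: cvgeZl.
  apply: (squeeze_cvge _ (cvg_cst 0%E) h).
  near=> x; have x0 : 0 <= x by near: x; exact: nbhs_pinfty_ge.
  by rewrite wess_sup_ge0 ?wess_sup_comb//;
    [exact: sub_tail|exact: lebesgue_measure_tail
    |exact: sub_tail|exact: lebesgue_measure_tail].
Unshelve. all: by end_near. Qed.

HB.instance Definition _ :=
  GRing.isSubmodClosed.Build R[i] (R -> R[i]) L0_pred L0_submod_closed.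

End weighted_essential_supremum.

Section L0.
Context {R : realType} (w : weight R).

Record L0_fun := MkL0Fun {
  L0_val :> R -> R[i];
  L0_valP : L0_val \in L0_pred w
}.

HB.instance Definition _ := [isSub for L0_val].
HB.instance Definition _ := [Choice of L0_fun by <:].
HB.instance Definition _ := [SubChoice_isSubLmodule of L0_fun by <:].

Definition L0_null : {pred L0_fun} := fun f => `[<
  \forall x \ae lebesgue_measure, x \in `[0, +oo[ -> f x = 0 >].

Lemma L0_null_submod_closed : submod_closed L0_null.
Proof.
split; first by apply/asboolP/nearW.
move=> a f g /asboolP f0 /asboolP g0; apply/asboolP.
have F := ae_filter_ringOfSetsType (@lebesgue_measure R).
apply: (@filterS2 _ _ F _ _ _ _ f0 g0) => x fx gx x0; rewrite -[LHS]/(a * f x + g x).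
by rewrite fx// gx// mulr0 addr0.
Qed.

HB.instance Definition _ :=
  GRing.isSubmodClosed.Build R[i] L0_fun L0_null L0_null_submod_closed.

Definition L0 := Quotient.quot L0_null.

HB.instance Definition _ := Choice.on L0.
HB.instance Definition _ := GRing.Zmodule.on L0.

Definition L0_class (f : L0_fun) : L0 := \pi_(Quotient.quot L0_null)%qT f.

Definition L0_repr (f : L0) : L0_fun := repr (f : Quotient.quot L0_null).

Lemma L0_reprK f : L0_class (L0_repr f) = f.
Proof. exact: reprK. Qed.

Lemma L0_classP (f g : L0_fun) : L0_class f = L0_class g <->
  \forall x \ae lebesgue_measure, x \in `[0, +oo[ -> f x = g x.
Proof.
have aeE : (f - g \in L0_null) <->
    \forall x \ae lebesgue_measure, x \in `[0, +oo[ -> f x = g x.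
  have F := ae_filter_ringOfSetsType (@lebesgue_measure R).
  split=> [/asboolP h|h]; [move: h|apply/asboolP; move: h];
    apply: (@filterS _ _ F) => x fg /fg; rewrite -[(f - g) x]/(f x - g x).
  - exact: subr0_eq.
  - by move=> ->; rewrite subrr.
rewrite -aeE (Quotient.idealrBE (L0_null : zmodClosed L0_fun)).
exact: (rwP eqP).
Qed.

Lemma L0_classD f g : L0_class (f + g) = L0_class f + L0_class g.
Proof. exact: (Quotient.pi_add (L0_null : zmodClosed L0_fun)). Qed.

Lemma L0_class0 : L0_class 0 = 0.
Proof. by apply: (addIr (L0_class 0)); rewrite -L0_classD addr0 add0r. Qed.

Definition L0_scale (a : R[i]) (f : L0) : L0 := L0_class (a *: L0_repr f).

Lemma L0_classZ a f : L0_class (a *: f) = L0_scale a (L0_class f).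
Proof.
apply/L0_classP; have /L0_classP := L0_reprK (L0_class f).
apply: (@filterS _ _ (ae_filter_ringOfSetsType (@lebesgue_measure R))) => x h /h.
rewrite -[(a *: f) x]/(a * f x) => <-; congr (a * _).
Qed.

Lemma L0_scaleA a b f : L0_scale a (L0_scale b f) = L0_scale (a * b) f.
Proof. by rewrite /L0_scale -/(L0_scale _ _) -L0_classZ scalerA. Qed.

Lemma L0_scale1 : left_id 1 L0_scale.
Proof. by move=> f; rewrite /L0_scale scale1r L0_reprK. Qed.

Lemma L0_scaleDr : right_distributive L0_scale +%R.
Proof.
move=> a f g; rewrite -[f]L0_reprK -[g]L0_reprK -L0_classD -!L0_classZ.
by rewrite scalerDr L0_classD.
Qed.

Lemma L0_scaleDl f : {morph L0_scale^~ f : a b / a + b}.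
Proof. by move=> a b; rewrite /L0_scale scalerDl L0_classD. Qed.

HB.instance Definition _ := GRing.Zmodule_isLmodule.Build R[i] L0
  L0_scaleA L0_scale1 L0_scaleDr L0_scaleDl.

Definition L0_norm (f : L0) : R[i] :=
  (fine (wess_sup w (measurable_itv `[0%R, +oo[) (L0_repr f)))%:C.

Lemma L0_fun_wess_sup (f : L0_fun) :
  (wess_sup w (measurable_itv `[0%R, +oo[) f \is a fin_num)%E.
Proof.
have /L0_predP[_ h _] := L0_valP f.
by rewrite ge0_fin_numE// wess_sup_ge0//; exact: lebesgue_measure_half.
Qed.

Lemma L0_normE (f : L0_fun) :
  L0_norm (L0_class f) = (fine (wess_sup w (measurable_itv `[0%R, +oo[) f))%:C.
Proof.
congr (fine _)%:C; apply: eq_ess_sup; apply/mrestr_ae.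
have /L0_classP := L0_reprK (L0_class f).
apply: (@filterS _ _ (ae_filter_ringOfSetsType (@lebesgue_measure R))) => x h x0.
by rewrite h.
Qed.

Lemma L0_norm_comb a (f g : L0_fun) : L0_norm (L0_class (a *: f + g)) <=
  (normc a)%:C * L0_norm (L0_class f) + L0_norm (L0_class g).
Proof.
rewrite !L0_normE -rmorphM -rmorphD lecR -[normc a]/(fine (normc a)%:E).
rewrite -fineM ?L0_fun_wess_sup// -fineD ?fin_numM ?L0_fun_wess_sup//.
apply: fine_le; rewrite ?fin_numD ?fin_numM ?L0_fun_wess_sup//.
by apply: wess_sup_comb => //; exact: lebesgue_measure_half.
Qed.

Lemma L0_ler_normD f g : L0_norm (f + g) <= L0_norm f + L0_norm g.
Proof.
rewrite -[f]L0_reprK -[g]L0_reprK -L0_classD -[X in L0_class (X + _)]scale1r.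
by rewrite (le_trans (L0_norm_comb _ _ _))// normc1 mul1r.
Qed.

Lemma L0_norm0 : L0_norm 0 = 0.
Proof.
by rewrite -L0_class0 L0_normE wess_sup0//; exact: lebesgue_measure_half.
Qed.

Lemma L0_normZ_le a f : L0_norm (a *: f) <= `|a| * L0_norm f.
Proof.
rewrite -[f]L0_reprK -[_ *: _]L0_classZ -[X in L0_class X]addr0.
by rewrite (le_trans (L0_norm_comb _ _ _))// L0_class0 L0_norm0 addr0.
Qed.

Lemma L0_normZ a f : L0_norm (a *: f) = `|a| * L0_norm f.
Proof.
have [->|a0] := eqVneq a 0; first by rewrite scale0r L0_norm0 normr0 mul0r.
apply/eqP; rewrite eq_le L0_normZ_le/= -ler_pdivlMl ?normr_gt0//.
by rewrite -normfV (le_trans _ (L0_normZ_le _ _))// scalerA mulVf// scale1r.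
Qed.

Lemma L0_norm_eq0 f : L0_norm f = 0 -> f = 0.
Proof.
rewrite -[f]L0_reprK L0_normE -L0_class0 => -[f0]; apply/L0_classP.
have : (wess_sup w (measurable_itv `[0%R, +oo[) (L0_repr f) <= 0)%E.
  by rewrite -[X in (X <= _)%E]fineK ?L0_fun_wess_sup// f0.
move=> /ess_supP/mrestr_ae.
apply: (@filterS _ _ (ae_filter_ringOfSetsType (@lebesgue_measure R))) => x h x0.
have := h x0; rewrite lee_fin pmulr_lle0; last first.
  by move: x0; rewrite in_itv/= andbT invr_gt0; exact: weight_gt0.
by move=> fx; apply: eq0_normc; apply/eqP; rewrite eq_le fx normc_ge0.
Qed.

HB.instance Definition _ := Lmodule_isNormed.Build R[i] L0
  L0_ler_normD L0_normZ L0_norm_eq0.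

End L0.

Section dual.
Context {R : realType} (w : weight R).

Definition dual_pred : {pred L0 w -> R[i]} := fun n => `[<
  linear (n : L0 w -> R[i]^o) /\ continuous (n : L0 w -> R[i]^o) >].

Lemma dual_submod_closed : submod_closed dual_pred.
Proof.
split; first apply/asboolP.
  by split=> [a f g /=|]; [rewrite scaler0 addr0|exact: cst_continuous].
move=> a m n /asboolP[lm cm] /asboolP[ln cn]; apply/asboolP; split.
  move=> b f g; rewrite -[LHS]/(a * m (b *: f + g) + n (b *: f + g)) lm ln.
  rewrite -[RHS]/(b * (a * m f + n f) + (a * m g + n g)).
  by rewrite -![_ *: _]/(_ * _) !mulrDr [a * (b * _)]mulrCA addrACA.
by move=> f; exact: (cvgD (@cvgZl_tmp R[i] R[i]^o _ (nbhs f) _ a m _ (cm f)) (cn f)).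
Qed.

HB.instance Definition _ :=
  GRing.isSubmodClosed.Build R[i] (L0 w -> R[i]) dual_pred dual_submod_closed.

Record dualL0 := MkDualL0 {
  dual_fun :> L0 w -> R[i];
  dual_funP : dual_fun \in dual_pred
}.

HB.instance Definition _ := [isSub for dual_fun].
HB.instance Definition _ := [Choice of dualL0 by <:].
HB.instance Definition _ := [SubChoice_isSubLmodule of dualL0 by <:].

Lemma dual_eqP (m n : dualL0) : m = n <-> forall f, m f = n f.
Proof. by split=> [->//|mn]; apply/val_inj/funext. Qed.

(* The norm of a normedModType over R[i] takes its values in R[i]. *)
Definition dual_norm (n : dualL0) : R[i] :=
  (sup [set normc (n f) | f in [set f : L0 w | `|f| <= 1]])%:C.

Lemma normr_normc (z : R[i]) : `|z| = (normc z)%:C.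
Proof. by case: z. Qed.

Lemma dual_linear (n : dualL0) a f g : n (a *: f + g) = a * n f + n g.
Proof. by have /asboolP[/(_ a f g)] := dual_funP n. Qed.

Lemma dual0 (n : dualL0) : n 0 = 0.
Proof.
by have := dual_linear n (-1) 0 0; rewrite scaler0 addr0 mulN1r addNr.
Qed.

Lemma dualZ (n : dualL0) a f : n (a *: f) = a * n f.
Proof. by have := dual_linear n a f 0; rewrite dual0 !addr0. Qed.

Lemma dual_has_sup (n : dualL0) :
  has_sup [set normc (n f) | f in [set f : L0 w | `|f| <= 1]].
Proof.
split; first by exists (normc (n 0)), 0 => //=; rewrite normr0.
have /asboolP[ln cn] := dual_funP n.
have [d /= d0 nd] : exists2 d : R[i], 0 < d &
    forall f : L0 w, `|f| <= d -> `|n f| <= 1.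
  have /cvgrPdist_le/(_ 1 ltr01)/nbhs_norm0P[d /= d0 nd] := cn 0.
  exists (d / 2); first by rewrite divr_gt0.
  move=> f fd; have := nd f; rewrite dual0 sub0r normrN; apply.
  by rewrite /= (le_lt_trans fd)// ltr_pdivrMr// ltr_pMr// ltr1n.
exists (complex.Re d^-1) => _ [f /= f1 <-].
have : `|n f| <= d^-1.
  rewrite -[f](scalerK (lt0r_neq0 d0)) dualZ normrM gtr0_norm ?invr_gt0//.
  rewrite ler_piMr ?invr_ge0 ?(ltW d0)// nd// normrZ gtr0_norm//.
  by rewrite ler_piMr// (ltW d0).
by rewrite normr_normc lecE => /andP[].
Qed.

Lemma dual_norm_ub (n : dualL0) f : `|f| <= 1 -> normc (n f) <=
  sup [set normc (n f) | f in [set f : L0 w | `|f| <= 1]].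
Proof.
by move=> f1; apply: (sup_upper_bound (dual_has_sup n)); exists f.
Qed.

Lemma dual_norm_le (n : dualL0) (M : R) :
  (forall f : L0 w, `|f| <= 1 -> normc (n f) <= M) -> dual_norm n <= M%:C.
Proof.
move=> nM; rewrite lecR; apply: sup_le_ub.
  by exists (normc (n 0)), 0 => //=; rewrite normr0.
by move=> _ [f /= f1 <-]; exact: nM.
Qed.

Lemma dual_ler_normD m n : dual_norm (m + n) <= dual_norm m + dual_norm n.
Proof.
rewrite -rmorphD; apply: dual_norm_le => f f1.
rewrite -[(m + n) f]/(m f + n f) (le_trans (le_normcD _ _))//.
by rewrite lerD// dual_norm_ub.
Qed.

Lemma dual_normZ_le a n : dual_norm (a *: n) <= `|a| * dual_norm n.
Proof.
rewrite normr_normc -rmorphM; apply: dual_norm_le => f f1.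
rewrite -[(a *: n) f]/(a * n f) normcM.
by rewrite ler_wpM2l ?normc_ge0// dual_norm_ub.
Qed.

Lemma dual_norm_ge0 n : 0 <= dual_norm n.
Proof.
rewrite lecR (le_trans (normc_ge0 (n 0)))// dual_norm_ub//.
by rewrite normr0.
Qed.

Lemma dual_normZ a n : dual_norm (a *: n) = `|a| * dual_norm n.
Proof.
have [->|a0] := eqVneq a 0.
  apply/eqP; rewrite eq_le dual_normZ_le normr0 mul0r dual_norm_ge0//.
apply/eqP; rewrite eq_le dual_normZ_le/= -ler_pdivlMl ?normr_gt0//.
by rewrite -normfV (le_trans _ (dual_normZ_le _ _))// scalerA mulVf// scale1r.
Qed.

Lemma dual_norm_eq0 n : dual_norm n = 0 -> n = 0.
Proof.
case=> n0; have nf1 f : `|f| <= 1 -> n f = 0.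
  move=> /(dual_norm_ub n); rewrite n0 => nf.
  by apply: eq0_normc; apply/eqP; rewrite eq_le nf normc_ge0.
apply/dual_eqP => f; rewrite -[RHS]/(0 : R[i]).
have [->|f0] := eqVneq f 0; first exact: dual0.
have nf0 : `|f| != 0 by rewrite normr_eq0.
rewrite -[f](scalerKV nf0) dualZ nf1 ?mulr0//.
by rewrite normrZ normfV normr_id mulVf.
Qed.

HB.instance Definition _ := Lmodule_isNormed.Build R[i] dualL0
  dual_ler_normD dual_normZ dual_norm_eq0.

(* The product (f phi)(x) = \int_0^oo f(x + y) phi(y) dy. For phi in L1w w the
   displayed function satisfies L0_pred, so the default value 0 of insubd is not
   used; its class does not depend on the representative of f. *)
Definition L0_conv (f : L0 w) (phi : R -> R[i]) : L0 w :=
  L0_class (insubd (0 : L0_fun w)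
    (fun x => cintegral (fun y => L0_repr f (x + y) * phi y))).

(* The element n f determined by \int_0^oo (n f) phi = n (f phi), phi in L1w w.
   It exists by the duality of L^1(w) and L^oo(1/w), and is unique as a class. *)
Definition L0_act (n : dualL0) (f : L0 w) : L0 w :=
  xget 0 [set g | forall phi, L1w w phi ->
    cintegral (fun x => L0_repr g x * phi x) = n (L0_conv f phi)].

(* First Arens product; f |-> m (n f) is a bounded functional, so the default
   value 0 of insubd is not used. *)
Definition arens (m n : dualL0) : dualL0 :=
  insubd (0 : dualL0) (fun f => m (L0_act n f)).

Definition right_annihilator : set dualL0 := [set r | forall a, arens a r = 0].

Definition normed_right_ids : set dualL0 :=
  [set u | (forall m, arens m u = m) /\ `|u| = 1].

Definition right_ideal (u : dualL0) : set dualL0 := [set arens u m | m in setT].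

Definition algebra_hom (theta : dualL0 -> dualL0) :=
  linear theta /\ {morph theta : m n / arens m n}.

Definition algebra_iso theta := algebra_hom theta /\ bijective theta.

Definition theta_derivation (theta D : dualL0 -> dualL0) :=
  linear D /\
  forall m n, D (arens m n) = arens (D m) (theta n) + arens (theta m) (D n).

End dual.

Arguments right_annihilator {R} w.
Arguments normed_right_ids {R} w.

(* Main.v *)
(* Put E = theta^-1 D, a derivation in the usual sense. All follows from a bound
   |<E x, f phi>| <= C |x| |f| |phi|: it gives |(E x) f| <= 2 C |x| |f|, so that
   x |-> u (E x), hence x |-> E (u x) = E(u) x + u (E x), is bounded for every
   right identity u. Since x - u x lies in ran(A), and u (u m) = u m, both parts
   of the theorem are then immediate.
   For the bound, let f vanish on [s, oo[ and let F_k be f translated to the right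
   by k s. Let a act as the point mass at s, so that <a m, F_(k+1) phi> =
   <m, F_k phi> and <a m, F_0 phi> = 0. The derivation rule shows that
   <E (a^k x), F_k phi> differs from <E x, f phi> by a bounded functional of x,
   and that <E (a^(k+1) x), F_k phi> is bounded in x. If x |-> <E x, f phi> were
   unbounded, a gliding hump y = \sum_k a^k x_k with very small x_k would make
   <E y, F_k phi> grow faster than |F_k phi|. The constant is uniform in (f, phi)
   by the same gliding hump with the identity in place of a, and arbitrary f are
   norm limits of compactly supported ones because f/w vanishes at infinity. *)
Require Import Defs.
From HB Require Import structures.
From mathcomp Require Import all_boot all_order all_algebra.
From mathcomp Require Import complex.
From mathcomp Require Import all_classical all_reals all_analysis.
From mathcomp Require Import ess_sup_inf measurable_realfun.
From mathcomp Require Import ring lra.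

Set Implicit Arguments.
Unset Strict Implicit.
Unset Printing Implicit Defensive.

Import Order.TTheory GRing.Theory Num.Theory.
Import numFieldNormedType.Exports.
Import ComplexField Normc.

Local Open Scope classical_set_scope.
Local Open Scope ring_scope.
Local Open Scope complex_scope.

(** * Complex functions on the half line *)

Section complex_norm.
Context {R : realType}.
Implicit Types z : R[i].

Lemma normc_sqrtE z :
  normc z = Num.sqrt (complex.Re z ^+ 2 + complex.Im z ^+ 2).
Proof. by case: z. Qed.

Lemma normc_Re_le z : `|complex.Re z| <= normc z.
Proof.
by rewrite normc_sqrtE -sqrtr_sqr ler_wsqrtr// lerDl sqr_ge0.
Qed.

Lemma normc_Im_le z : `|complex.Im z| <= normc z.
Proof.
by rewrite normc_sqrtE -sqrtr_sqr ler_wsqrtr// lerDr sqr_ge0.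
Qed.

Lemma normc_le_ReIm z : normc z <= `|complex.Re z| + `|complex.Im z|.
Proof.
rewrite normc_sqrtE -[leRHS]ger0_norm ?addr_ge0// -sqrtr_sqr ler_wsqrtr//.
rewrite -(real_normK (num_real (complex.Re z))).
rewrite -(real_normK (num_real (complex.Im z))).
by rewrite sqrrD lerD2r lerDl mulrn_wge0// mulr_ge0.
Qed.

Lemma normc_real (a : R) : normc a%:C = `|a|.
Proof. by rewrite normc_sqrtE/= expr0n addr0 sqrtr_sqr. Qed.

Lemma complex_ReM z z' : complex.Re (z * z') =
  complex.Re z * complex.Re z' - complex.Im z * complex.Im z'.
Proof. by case: z => ? ?; case: z'. Qed.

Lemma complex_ImM z z' : complex.Im (z * z') =
  complex.Re z * complex.Im z' + complex.Im z * complex.Re z'.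
Proof. by case: z => ? ?; case: z'. Qed.

Lemma complex_ReD z z' : complex.Re (z + z') = complex.Re z + complex.Re z'.
Proof. by case: z => ? ?; case: z'. Qed.

Lemma complex_ImD z z' : complex.Im (z + z') = complex.Im z + complex.Im z'.
Proof. by case: z => ? ?; case: z'. Qed.

Lemma complexE_ReIm (a b : R) : a%:C + 'i * b%:C = a +i* b.
Proof.
by apply/eqP; rewrite eq_complex complex_ReD complex_ImD complex_ReM complex_ImM/= !(mul0r, mulr0, mul1r, subr0, addr0, add0r) !eqxx.
Qed.

End complex_norm.

Section half_line_integral.
Context {R : realType}.
Local Notation mu := (@lebesgue_measure R).
Local Notation H := (`[0%R : R, +oo[%classic).
Implicit Types (D : set R) (f g : R -> R[i]) (k : R -> R).

Lemma ae_imp (P Q : R -> Prop) : (forall x, P x -> Q x) ->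
  (\forall x \ae mu, P x) -> (\forall x \ae mu, Q x).
Proof.
move=> PQ; exact: (@filterS _ _ (ae_filter_ringOfSetsType mu) _ _ PQ).
Qed.

Lemma ae_imp2 (P Q S : R -> Prop) : (forall x, P x -> Q x -> S x) ->
  (\forall x \ae mu, P x) -> (\forall x \ae mu, Q x) ->
  (\forall x \ae mu, S x).
Proof.
move=> PQ; exact: (@filterS2 _ _ (ae_filter_ringOfSetsType mu) _ _ _ PQ).
Qed.

Lemma ae_forallT (P : R -> Prop) : (forall x, P x) -> (\forall x \ae mu, P x).
Proof. by move=> h; apply: (ae_imp (P := fun=> True)) => //; exact: nearW. Qed.

Lemma half_lineP (x : R) : H x <-> 0 <= x.
Proof. by rewrite /= in_itv/= andbT. Qed.

Lemma measurable_half_line : measurable H.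
Proof. exact: measurable_itv. Qed.
Hint Resolve measurable_half_line : core.

Lemma cmeasurableD D f g : measurable D ->
  cmeasurable D f -> cmeasurable D g -> cmeasurable D (fun x => f x + g x).
Proof.
move=> mD [f1 f2] [g1 g2]; split.
- by under eq_fun do rewrite complex_ReD; exact: measurable_funD.
- by under eq_fun do rewrite complex_ImD; exact: measurable_funD.
Qed.

Lemma cmeasurableM D f g : measurable D ->
  cmeasurable D f -> cmeasurable D g -> cmeasurable D (fun x => f x * g x).
Proof.
move=> mD [f1 f2] [g1 g2]; split.
- under eq_fun do rewrite complex_ReM.
  by apply: measurable_funB => //; exact: measurable_funM.
- under eq_fun do rewrite complex_ImM.
  by apply: measurable_funD => //; exact: measurable_funM.
Qed.

Lemma cmeasurable_cst D a : cmeasurable D (fun=> a).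
Proof. by split; exact: measurable_cst. Qed.

Lemma cmeasurable_real D k : measurable_fun D k ->
  cmeasurable D (fun x => (k x)%:C).
Proof. by move=> mk; split => //=; exact: measurable_cst. Qed.

Lemma measurable_normc D f : measurable D ->
  cmeasurable D f -> measurable_fun D (fun x => normc (f x)).
Proof.
move=> mD [f1 f2]; under eq_fun do rewrite normc_sqrtE.
apply: (measurableT_comp (f := @Num.sqrt R)).
  by apply: continuous_measurable_fun; apply: sqrt_continuous.
by apply: measurable_funD; apply: measurable_funX.
Qed.

Definition cintegrable f :=
  mu.-integrable H (fun x => (complex.Re (f x))%:E) /\
  mu.-integrable H (fun x => (complex.Im (f x))%:E).

Lemma integrable_le_ae D k (h : R -> R) : measurable D -> measurable_fun D h ->
  mu.-integrable D (fun x => (k x)%:E) ->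
  (\forall x \ae mu, D x -> `|h x| <= k x) ->
  mu.-integrable D (fun x => (h x)%:E).
Proof.
move=> mD mh ik hk; apply/integrableP; split; first exact/measurable_EFinP.
move/integrableP : ik => [/measurable_EFinP mk ik]; apply: le_lt_trans ik.
apply: ae_ge0_le_integral => //.
- by apply/measurable_EFinP; exact: measurableT_comp.
- by apply/measurable_EFinP; exact: measurableT_comp.
- by apply: ae_imp hk => x h1 Dx; rewrite lee_fin (le_trans (h1 Dx))// ler_norm.
Qed.

Lemma cintegrable_le f k : cmeasurable H f ->
  mu.-integrable H (fun x => (k x)%:E) ->
  (\forall x \ae mu, H x -> normc (f x) <= k x) -> cintegrable f.
Proof.
move=> [f1 f2] ik fk; split; apply: (integrable_le_ae _ _ ik) => //;
  apply: ae_imp fk => x h /h; apply: le_trans.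
  exact: normc_Re_le.
exact: normc_Im_le.
Qed.

Lemma Re_cintegral f :
  complex.Re (cintegral f) = \int[mu]_(x in H) complex.Re (f x).
Proof. by rewrite /cintegral complexE_ReIm. Qed.

Lemma Im_cintegral f :
  complex.Im (cintegral f) = \int[mu]_(x in H) complex.Im (f x).
Proof. by rewrite /cintegral complexE_ReIm. Qed.

Lemma eq_complexP (z z' : R[i]) : complex.Re z = complex.Re z' ->
  complex.Im z = complex.Im z' -> z = z'.
Proof. by move=> h1 h2; apply/eqP; rewrite eq_complex h1 h2 !eqxx. Qed.

Lemma Rintegral_le_ae D k (h : R -> R) : measurable D -> measurable_fun D h ->
  mu.-integrable D (fun x => (k x)%:E) ->
  (\forall x \ae mu, D x -> `|h x| <= k x) ->
  `|\int[mu]_(x in D) h x| <= \int[mu]_(x in D) k x.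
Proof.
move=> mD mh ik hk; have ih := integrable_le_ae mD mh ik hk.
apply: (le_trans (@le_normr_Rintegral _ _ _ mu D h mD ih)).
have ik' : mu.-integrable D (fun x => `|k x|%:E) by exact: integrable_norm.
have ih' : mu.-integrable D (fun x => `|h x|%:E) by exact: integrable_norm.
have mk : measurable_fun D k by have /integrableP[/measurable_EFinP] := ik.
have -> : \int[mu]_(x in D) k x = \int[mu]_(x in D) `|k x|.
  rewrite /Rintegral; congr fine; apply: ae_eq_integral => //.
  - exact/measurable_EFinP.
  - by apply/measurable_EFinP; exact: measurableT_comp.
  - apply: ae_imp hk => x h1 Dx; rewrite ger0_norm//.
    by rewrite (le_trans _ (h1 Dx)).
apply: fine_le; [exact: integrable_fin_num..|].
apply: ae_ge0_le_integral => //.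
- by apply/measurable_EFinP; exact: measurableT_comp.
- by apply/measurable_EFinP; exact: measurableT_comp.
- by apply: ae_imp hk => x h1 Dx; rewrite lee_fin (le_trans (h1 Dx))// ler_norm.
Qed.

Lemma normc_cintegral_le f k : cmeasurable H f ->
  mu.-integrable H (fun x => (k x)%:E) ->
  (\forall x \ae mu, H x -> normc (f x) <= k x) ->
  normc (cintegral f) <= 2 * \int[mu]_(x in H) k x.
Proof.
move=> [f1 f2] ik fk; apply: (le_trans (normc_le_ReIm _)).
rewrite Re_cintegral Im_cintegral mulr2n mulrDl mul1r.
apply: lerD; apply: Rintegral_le_ae => //; apply: ae_imp fk => x h /h; apply: le_trans.
  exact: normc_Re_le.
exact: normc_Im_le.
Qed.

Lemma cintegralD f g : cintegrable f -> cintegrable g ->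
  cintegral (fun x => f x + g x) = cintegral f + cintegral g.
Proof.
move=> [f1 f2] [g1 g2]; apply: eq_complexP.
- rewrite [RHS]complex_ReD !Re_cintegral -RintegralD//.
  by apply: eq_Rintegral => x _; rewrite complex_ReD.
- rewrite [RHS]complex_ImD !Im_cintegral -RintegralD//.
  by apply: eq_Rintegral => x _; rewrite complex_ImD.
Qed.

Lemma cintegralZl f a : cintegrable f ->
  cintegral (fun x => a * f x) = a * cintegral f.
Proof.
have iZ (k : R) h : mu.-integrable H (fun x => (h x)%:E) ->
    mu.-integrable H (EFin \o (fun x => (k * h x))).
  by move=> ih; apply: eq_integrable (integrableZl _ k ih).
move=> [f1 f2]; apply: eq_complexP.
- rewrite [RHS]complex_ReM !Re_cintegral Im_cintegral -!RintegralZl// -RintegralB//; [|exact: iZ..].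
  by apply: eq_Rintegral => x _; rewrite complex_ReM.
- rewrite [RHS]complex_ImM !Im_cintegral Re_cintegral -!RintegralZl// -RintegralD//; [|exact: iZ..].
  by apply: eq_Rintegral => x _; rewrite complex_ImM.
Qed.

Lemma cintegral_ae_eq f g : cmeasurable H f -> cmeasurable H g ->
  (\forall x \ae mu, H x -> f x = g x) -> cintegral f = cintegral g.
Proof.
move=> [f1 f2] [g1 g2] fg; apply: eq_complexP.
- rewrite !Re_cintegral; congr fine; apply: ae_eq_integral => //;
    [exact/measurable_EFinP..|].
  by apply: ae_imp fg => x h /h ->.
- rewrite !Im_cintegral; congr fine; apply: ae_eq_integral => //;
    [exact/measurable_EFinP..|].
  by apply: ae_imp fg => x h /h ->.
Qed.

Lemma eq_cintegral f g : (forall x, 0 <= x -> f x = g x) ->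
  cintegral f = cintegral g.
Proof.
move=> fg; apply: eq_complexP.
- rewrite !Re_cintegral; apply: eq_Rintegral => x.
  by rewrite inE => /half_lineP /fg ->.
- rewrite !Im_cintegral; apply: eq_Rintegral => x.
  by rewrite inE => /half_lineP /fg ->.
Qed.

End half_line_integral.
#[global] Hint Extern 0 (measurable `[0, +oo[%classic) =>
  exact: measurable_half_line : core.

Section translation.
Context {R : realType}.
Local Notation mu := (@lebesgue_measure R).

Lemma measurable_shift (s : R) : measurable_fun [set: measurableTypeR R]
  (fun x : measurableTypeR R => s + x : measurableTypeR R).
Proof. exact: measurable_funD. Qed.

Lemma lebesgue_measure_shift (s : R) (A : set R) : measurable A ->
  mu ((fun x => s + x) @^-1` A) = mu A.
Proof.
move=> mA.
pose nu := measure_function_pushforward__canonical__measure_function_Measure mu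
  (measurable_shift s).
rewrite -[LHS]/(nu A); apply/esym; apply: lebesgue_measure_unique mA => //.
move=> _ [[a b] /= ab <-]; rewrite /nu /= /pushforward.
have -> : (fun x => s + x) @^-1` `]a, b]%classic = `]a - s, b - s]%classic.
  apply/seteqP; split => x /=; rewrite !in_itv/= ltrBlDl lerBrDl//.
by rewrite !lebesgue_measure_itv/= !lte_fin ltrD2r -!EFinB opprB addrA subrK.
Qed.


Lemma integral_shift (s : R) (f : R -> \bar R) : measurable_fun [set: R] f ->
  (\int[mu]_x f (s + x)%R = \int[mu]_x f x)%E.
Proof.
have ge0 (g : R -> \bar R) : measurable_fun [set: R] g -> (forall x, 0 <= g x)%E ->
    (\int[mu]_x g (s + x)%R = \int[mu]_x g x)%E.
  move=> mg g0; rewrite -[LHS](ge0_integral_pushforward (measurable_shift s) mu (D := [set: measurableTypeR R]))//.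
  apply: (eq_measure_integral mu); first exact: measurable_shift.
  by move=> ? A mA _; exact: lebesgue_measure_shift.
move=> mf; rewrite integralE [RHS]integralE; congr (_ - _)%E.
- rewrite -(ge0 _ (measurable_funepos mf) (fun x => funepos_ge0 f x)).
  by apply: eq_integral => x _; rewrite !funeposE.
- rewrite -(ge0 _ (measurable_funeneg mf) (fun x => funeneg_ge0 f x)).
  by apply: eq_integral => x _; rewrite !funenegE.
Qed.

Lemma ae_shift (s : R) (P : R -> Prop) :
  (\forall x \ae mu, P x) -> (\forall x \ae mu, P (s + x)).
Proof.
move=> [A [mA A0 PA]]; exists ((fun x => s + x) @^-1` A); split.
- by rewrite -[X in measurable X]setTI; exact: measurable_shift.
- by rewrite -A0; exact: lebesgue_measure_shift.
- by move=> x /= nP; exact: PA.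
Qed.

End translation.

Section extension_by_zero.
Context {R : realType}.
Local Notation mu := (@lebesgue_measure R).
Local Notation H := (`[0%R : R, +oo[%classic).
Implicit Types f g : R -> R[i].

(* The definitions of Defs.v leave the values at negative reals unspecified. *)
Definition zext f (x : R) : R[i] := if 0 <= x then f x else 0.

Lemma zext_ge0 f x : 0 <= x -> zext f x = f x.
Proof. by rewrite /zext => ->. Qed.

Lemma zext_lt0 f x : ~~ (0 <= x) -> zext f x = 0.
Proof. by rewrite /zext => /negbTE ->. Qed.

Lemma Re_zext f x : complex.Re (zext f x) = ((fun x => complex.Re (f x)) \_ H) x.
Proof.
rewrite patchE /zext; case: ifPn => x0.
  by rewrite mem_set//; exact/half_lineP.
by rewrite memNset// => /half_lineP; exact/negP.
Qed.

Lemma Im_zext f x : complex.Im (zext f x) = ((fun x => complex.Im (f x)) \_ H) x.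
Proof.
rewrite patchE /zext; case: ifPn => x0.
  by rewrite mem_set//; exact/half_lineP.
by rewrite memNset// => /half_lineP; exact/negP.
Qed.

Lemma cmeasurable_zext f : cmeasurable H f -> cmeasurable setT (zext f).
Proof.
move=> [f1 f2]; split.
- rewrite (_ : (fun x => _) = (fun x => complex.Re (f x)) \_ H).
    by apply/(measurable_restrictT _ _).1 => //.
  by apply/funext => x; rewrite Re_zext.
- rewrite (_ : (fun x => _) = (fun x => complex.Im (f x)) \_ H).
    by apply/(measurable_restrictT _ _).1 => //.
  by apply/funext => x; rewrite Im_zext.
Qed.

Lemma Re_cintegral_zext f :
  complex.Re (cintegral f) = \int[mu]_x complex.Re (zext f x).
Proof.
by rewrite Re_cintegral Rintegral_mkcond; apply: eq_Rintegral => x _; rewrite Re_zext.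
Qed.

Lemma Im_cintegral_zext f :
  complex.Im (cintegral f) = \int[mu]_x complex.Im (zext f x).
Proof.
by rewrite Im_cintegral Rintegral_mkcond; apply: eq_Rintegral => x _; rewrite Im_zext.
Qed.

Lemma cmeasurable_shift (t : R) f : 0 <= t -> cmeasurable H f ->
  cmeasurable H (fun x => f (t + x)).
Proof.
move=> t0 [f1 f2]; have sH : [set t + x | x in H] `<=` H.
  by move=> _ [x /half_lineP x0 <-]; apply/half_lineP; rewrite addr_ge0.
have mt : measurable_fun H (fun x => t + x).
  exact: measurable_funS (measurable_shift t).
split.
- by apply: (measurable_comp (F := H) (f := fun x => complex.Re (f x))).
- by apply: (measurable_comp (F := H) (f := fun x => complex.Im (f x))).
Qed.

Lemma measurable_Rintegral_param (G : R * R -> R) : measurable_fun setT G ->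
  measurable_fun setT (fun x => \int[mu]_y G (x, y)).
Proof.
move=> mG; have mG' : measurable_fun setT (EFin \o G) by exact/measurable_EFinP.
have m1 := measurable_fun_fubini_tonelli_F (m2 := mu) _ (measurable_funepos mG')
  (fun x => funepos_ge0 _ x).
have m2 := measurable_fun_fubini_tonelli_F (m2 := mu) _ (measurable_funeneg mG')
  (fun x => funeneg_ge0 _ x).
rewrite (_ : (fun x => _) = fun x => fine (fubini_F mu (EFin \o G)^\+ x -
    fubini_F mu (EFin \o G)^\- x)%E).
  apply: measurableT_comp; first exact: fine_measurable.
  exact: emeasurable_funB.
apply/funext => x; rewrite /Rintegral integralE /fubini_F; congr (fine (_ - _)).
- by apply: eq_integral => y _; rewrite !funeposE.
- by apply: eq_integral => y _; rewrite !funenegE.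
Qed.

Lemma cmeasurable_cintegral_param (G : R -> R -> R[i]) :
  measurable_fun setT (fun z : R * R => complex.Re (zext (G z.1) z.2)) ->
  measurable_fun setT (fun z : R * R => complex.Im (zext (G z.1) z.2)) ->
  cmeasurable setT (fun x => cintegral (G x)).
Proof.
move=> m1 m2; split.
- under eq_fun do rewrite Re_cintegral_zext.
  exact: (measurable_Rintegral_param m1).
- under eq_fun do rewrite Im_cintegral_zext.
  exact: (measurable_Rintegral_param m2).
Qed.

End extension_by_zero.

(** * The spaces L^1(w) and L^oo(1/w), and their duality *)

Section pairing.
Context {R : realType} (w : weight R).
Local Notation mu := (@lebesgue_measure R).
Local Notation H := (`[0%R : R, +oo[%classic).
Implicit Types (f g phi psi : R -> R[i]) (a : R[i]).

Lemma measurable_weight : measurable_fun H w.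
Proof.
by apply: subspace_continuous_measurable_fun => //; exact: weight_continuous.
Qed.

Lemma weight_ge0 x : 0 <= x -> 0 <= w x.
Proof. by move=> x0; exact/ltW/weight_gt0. Qed.

Definition L1norm phi : R := \int[mu]_(x in H) (w x * normc (phi x)).

Lemma L1norm_ge0 phi : 0 <= L1norm phi.
Proof.
apply: Rintegral_ge0 => x /half_lineP x0.
by rewrite mulr_ge0 ?weight_ge0 ?normc_ge0.
Qed.

Lemma L1w_measurable phi : L1w w phi -> cmeasurable H phi.
Proof. by case. Qed.

Lemma measurable_wnormc phi : cmeasurable H phi ->
  measurable_fun H (fun x => w x * normc (phi x)).
Proof.
move=> mphi; apply: measurable_funM; first exact: measurable_weight.
exact: measurable_normc.
Qed.

Lemma L1wP phi : L1w w phi <-> cmeasurable H phi /\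
  mu.-integrable H (fun x => (w x * normc (phi x))%:E).
Proof.
have e : cmeasurable H phi -> (\int[mu]_(x in H) `|(w x * normc (phi x))%:E| =
    \int[mu]_(x in H) (w x * normc (phi x))%:E)%E.
  move=> mphi; apply: eq_integral => x; rewrite inE => /half_lineP x0.
  by rewrite gee0_abs// lee_fin mulr_ge0 ?weight_ge0 ?normc_ge0.
split=> [[mphi iphi]|[mphi /integrableP[_]]]; split => //.
- apply/integrableP; split; first by apply/measurable_EFinP; exact: measurable_wnormc.
  by rewrite e.
- by rewrite -e.
Qed.

Lemma L1w_integrable phi : L1w w phi ->
  mu.-integrable H (fun x => (w x * normc (phi x))%:E).
Proof. by move=> /L1wP[]. Qed.

Lemma L1w_le phi (k : R -> R) : cmeasurable H phi ->
  mu.-integrable H (fun x => (k x)%:E) ->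
  (\forall x \ae mu, H x -> w x * normc (phi x) <= k x) -> L1w w phi.
Proof.
move=> mphi ik phik; apply/L1wP; split => //.
apply: (integrable_le_ae _ _ ik) => //; first exact: measurable_wnormc.
apply: ae_imp phik => x h Hx; have /half_lineP x0 := Hx.
by rewrite ger0_norm ?h// mulr_ge0 ?weight_ge0 ?normc_ge0.
Qed.

Lemma L1norm_le phi (k : R -> R) : cmeasurable H phi ->
  mu.-integrable H (fun x => (k x)%:E) ->
  (\forall x \ae mu, H x -> w x * normc (phi x) <= k x) ->
  L1norm phi <= \int[mu]_(x in H) k x.
Proof.
move=> mphi ik phik; rewrite -[leLHS]ger0_norm ?L1norm_ge0//.
apply: Rintegral_le_ae => //; first exact: measurable_wnormc.
apply: ae_imp phik => x h Hx; have /half_lineP x0 := Hx.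
by rewrite ger0_norm ?h// mulr_ge0 ?weight_ge0 ?normc_ge0.
Qed.

Lemma integrableZ_half (k : R -> R) (c : R) : mu.-integrable H (fun x => (k x)%:E) ->
  mu.-integrable H (fun x => (c * k x)%:E).
Proof. by move=> ik; apply: eq_integrable (integrableZl _ c ik). Qed.

Lemma RintegralZ_half (k : R -> R) (c : R) : mu.-integrable H (fun x => (k x)%:E) ->
  \int[mu]_(x in H) (c * k x) = c * \int[mu]_(x in H) k x.
Proof. by move=> ik; rewrite RintegralZl. Qed.

Lemma L1wD phi psi : L1w w phi -> L1w w psi -> L1w w (fun x => phi x + psi x).
Proof.
move=> hphi hpsi.
have ik : mu.-integrable H (fun x => (w x * normc (phi x) + w x * normc (psi x))%:E).
  by apply: eq_integrable (integrableD _ (L1w_integrable hphi) (L1w_integrable hpsi)).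
apply: L1w_le ik _; first by apply: cmeasurableD => //; exact: L1w_measurable.
apply: ae_forallT => x /half_lineP x0; rewrite -mulrDr ler_wpM2l ?weight_ge0//.
exact: le_normcD.
Qed.

Lemma L1wZ a phi : L1w w phi -> L1w w (fun x => a * phi x).
Proof.
move=> hphi; apply: L1w_le (integrableZ_half (normc a) (L1w_integrable hphi)) _.
  by apply: cmeasurableM => //; exact: L1w_measurable.
by apply: ae_forallT => x _; rewrite normcM mulrCA.
Qed.

Definition wbounded (c : R) g := cmeasurable H g /\
  \forall x \ae mu, H x -> normc (g x) <= c * w x.

Definition pairing g phi := cintegral (fun x => g x * phi x).

Lemma pairing_measurable c g phi : wbounded c g -> L1w w phi ->
  cmeasurable H (fun x => g x * phi x).
Proof. by move=> [mg _] [mphi _]; exact: cmeasurableM. Qed.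

Lemma wbounded_normcM c g phi : wbounded c g ->
  \forall x \ae mu, H x -> normc (g x * phi x) <= c * (w x * normc (phi x)).
Proof.
move=> [_ gc]; apply: ae_imp gc => x h Hx.
by rewrite normcM mulrA ler_wpM2r ?normc_ge0// h.
Qed.

Lemma pairing_integrable c g phi : wbounded c g -> L1w w phi ->
  cintegrable (fun x => g x * phi x).
Proof.
move=> gc hphi; apply: cintegrable_le (pairing_measurable gc hphi)
  (integrableZ_half c (L1w_integrable hphi)) (wbounded_normcM _ gc).
Qed.

Lemma normc_pairing_le c g phi : wbounded c g -> L1w w phi ->
  normc (pairing g phi) <= 2 * (c * L1norm phi).
Proof.
move=> gc hphi; rewrite -RintegralZ_half; last exact: L1w_integrable.
apply: normc_cintegral_le (pairing_measurable gc hphi)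
  (integrableZ_half c (L1w_integrable hphi)) (wbounded_normcM _ gc).
Qed.

Lemma pairingDr c g phi psi : wbounded c g -> L1w w phi -> L1w w psi ->
  pairing g (fun x => phi x + psi x) = pairing g phi + pairing g psi.
Proof.
move=> gc hphi hpsi.
rewrite -cintegralD; [|exact: pairing_integrable gc _..].
by congr cintegral; apply/funext => x; rewrite mulrDr.
Qed.

Lemma pairingZr c g a phi : wbounded c g -> L1w w phi ->
  pairing g (fun x => a * phi x) = a * pairing g phi.
Proof.
move=> gc hphi; rewrite -cintegralZl; last exact: pairing_integrable gc _.
by congr cintegral; apply/funext => x; rewrite mulrCA.
Qed.

Lemma pairing_combl c c' f g a phi : wbounded c f -> wbounded c' g -> L1w w phi ->
  pairing (fun x => a * f x + g x) phi = a * pairing f phi + pairing g phi.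
Proof.
move=> fc gc hphi; have if1 := pairing_integrable fc hphi.
rewrite -cintegralZl// -cintegralD.
- by congr cintegral; apply/funext => x; rewrite mulrDl mulrA.
- have := pairing_integrable fc (L1wZ a hphi).
  by congr cintegrable; apply/funext => x; rewrite mulrCA.
- exact: pairing_integrable gc _.
Qed.

Lemma pairing_ae_eq f g phi psi : cmeasurable H f -> cmeasurable H g ->
  cmeasurable H phi -> cmeasurable H psi ->
  (\forall x \ae mu, H x -> f x = g x) ->
  (\forall x \ae mu, H x -> phi x = psi x) -> pairing f phi = pairing g psi.
Proof.
move=> mf mg mphi mpsi fg pp; apply: cintegral_ae_eq; [exact: cmeasurableM..|].
by apply: ae_imp2 fg pp => x h1 h2 Hx; rewrite h1// h2.
Qed.

Lemma wbounded_shift c f (t : R) : 0 <= t -> 0 <= c -> cmeasurable H f ->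
  (\forall y \ae mu, t <= y -> normc (f y) <= c * w y) ->
  wbounded (c * w t) (fun y => f (t + y)).
Proof.
move=> t0 c0 mf fc; split; first exact: cmeasurable_shift.
apply: ae_imp (ae_shift t fc) => y h /half_lineP y0.
rewrite (le_trans (h _)) ?lerDl// -mulrA ler_wpM2l//.
exact: weight_submul.
Qed.

Lemma wbounded_translate c f (t : R) : 0 <= t -> 0 <= c -> wbounded c f ->
  wbounded (c * w t) (fun y => f (t + y)).
Proof.
move=> t0 c0 [mf fc]; apply: wbounded_shift => //.
by apply: ae_imp fc => y h ty; apply: h; apply/half_lineP; exact: le_trans ty.
Qed.

(* The function underlying [L0_conv]. *)
Definition cconv f phi (x : R) := pairing (fun y => f (x + y)) phi.

Lemma measurable_prodD :
  measurable_fun [set: R * R] (fun z : R * R => z.1 + z.2).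
Proof. by apply: measurable_funD; [exact: measurable_fst|exact: measurable_snd]. Qed.

Lemma cmeasurable_cconv f phi : cmeasurable H f -> cmeasurable H phi ->
  cmeasurable H (cconv f phi).
Proof.
move=> mf mphi; pose G x y := zext f (x + y) * zext phi y.
have cG : cmeasurable setT (fun x => cintegral (G x)).
  have [f1 f2] := cmeasurable_zext mf; have [p1 p2] := cmeasurable_zext mphi.
  have f1' := measurableT_comp f1 measurable_prodD.
  have f2' := measurableT_comp f2 measurable_prodD.
  have p1' : measurable_fun [set: R * R] (fun z => complex.Re (zext phi z.2)).
    exact: measurableT_comp p1 measurable_snd.
  have p2' : measurable_fun [set: R * R] (fun z => complex.Im (zext phi z.2)).
    exact: measurableT_comp p2 measurable_snd.
  have zG z : zext (G z.1) z.2 = G z.1 z.2.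
    by rewrite {1}/zext; case: ifPn => // z2; rewrite /G /zext (negbTE z2) mulr0.
  apply: cmeasurable_cintegral_param.
  - under eq_fun do rewrite zG /G complex_ReM.
    by apply: measurable_funB; exact: measurable_funM.
  - under eq_fun do rewrite zG /G complex_ImM.
    by apply: measurable_funD; exact: measurable_funM.
have e x : H x -> cintegral (G x) = cconv f phi x.
  move=> /half_lineP x0; apply: eq_cintegral => y y0.
  by rewrite /G /zext addr_ge0// y0.
have [c1 c2] := cG; split.
- apply: (eq_measurable_fun (fun x => complex.Re (cintegral (G x)))).
    by move=> x; rewrite inE => /e ->.
  exact: measurable_funS c1.
- apply: (eq_measurable_fun (fun x => complex.Im (cintegral (G x)))).
    by move=> x; rewrite inE => /e ->.
  exact: measurable_funS c2.
Qed.

Lemma normc_cconv_le c f phi (t : R) : 0 <= t -> 0 <= c -> cmeasurable H f ->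
  (\forall y \ae mu, t <= y -> normc (f y) <= c * w y) -> L1w w phi ->
  normc (cconv f phi t) <= 2 * c * L1norm phi * w t.
Proof.
move=> t0 c0 mf fc hphi.
have := normc_pairing_le (wbounded_shift t0 c0 mf fc) hphi.
by rewrite mulrAC -!mulrA.
Qed.

Lemma wbounded_cconv c f phi : 0 <= c -> wbounded c f -> L1w w phi ->
  wbounded (2 * c * L1norm phi) (cconv f phi).
Proof.
move=> c0 [mf fc] hphi; split.
  by apply: cmeasurable_cconv => //; exact: L1w_measurable.
apply: ae_forallT => t /half_lineP t0; apply: normc_cconv_le => //.
by apply: ae_imp fc => y h ty; apply: h; apply/half_lineP; exact: le_trans ty.
Qed.

Lemma cconv_ae_eq f g phi psi : cmeasurable H f -> cmeasurable H g ->
  cmeasurable H phi -> cmeasurable H psi ->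
  (\forall x \ae mu, H x -> f x = g x) ->
  (\forall x \ae mu, H x -> phi x = psi x) ->
  forall t, 0 <= t -> cconv f phi t = cconv g psi t.
Proof.
move=> mf mg mphi mpsi fg pp t t0; apply: pairing_ae_eq => //.
- exact: cmeasurable_shift.
- exact: cmeasurable_shift.
- apply: ae_imp (ae_shift t fg) => x h /half_lineP x0.
  by apply: h; apply/half_lineP; rewrite addr_ge0.
Qed.

End pairing.

Section convolution.
Context {R : realType} (w : weight R).
Local Notation mu := (@lebesgue_measure R).
Local Notation H := (`[0%R : R, +oo[%classic).
Implicit Types (f g h phi psi : R -> R[i]).

Lemma integrable_half_line (f : R -> \bar R) :
  mu.-integrable setT f -> mu.-integrable H f.
Proof.
have mH : @measurable _ (measurableTypeR R) H by exact: measurable_half_line.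
by apply: integrableS.
Qed.

Lemma Rintegral_Fubini (G : R * R -> R) :
  (mu \x mu)%E.-integrable setT (EFin \o G) ->
  \int[mu]_x \int[mu]_y G (x, y) = \int[mu]_y \int[mu]_x G (x, y).
Proof.
move=> iG; have /integrableP[/measurable_EFinP mG _] := iG.
have mG' : measurable_fun setT (fun z : R * R => G (z.2, z.1)).
  by apply: measurableT_comp mG _; exact: measurable_swap.
rewrite /Rintegral -[X in fine X = _]/(\int[mu]_x (\int[mu]_y G (x, y))%:E)%E.
rewrite -[X in _ = fine X]/(\int[mu]_y (\int[mu]_x G (x, y))%:E)%E.
transitivity (fine (\int[mu]_x \int[mu]_y (G (x, y))%:E)%E).
  congr fine; apply: ae_eq_integral => //.
  - by apply/measurable_EFinP; exact: measurable_Rintegral_param.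
  - by have /integrableP[] := integrable_fubini_F iG.
  - apply: ae_imp (ae_integrable1 iG) => x ix _.
    by rewrite /Rintegral fineK//; exact: integrable_fin_num.
rewrite (Fubini iG); congr fine; apply: ae_eq_integral => //.
- by have /integrableP[+ _] := integrable_fubini_F iG; move=> _;
    exact: (measurable_fubini_G iG).
- apply/measurable_EFinP.
  exact: (measurable_Rintegral_param mG').
- apply: ae_imp (ae_integrable2 iG) => x ix _.
  by rewrite /Rintegral fineK//; exact: integrable_fin_num.
Qed.

Lemma cintegral_swap (K : R -> R -> R[i]) :
  (mu \x mu)%E.-integrable setT (fun z : R * R => (complex.Re (K z.1 z.2))%:E) ->
  (mu \x mu)%E.-integrable setT (fun z : R * R => (complex.Im (K z.1 z.2))%:E) ->
  (forall x z, x < 0 \/ z < 0 -> K x z = 0) ->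
  cintegral (fun x => cintegral (K x)) = cintegral (fun z => cintegral (K^~ z)).
Proof.
move=> i1 i2 K0.
have z1 x : zext (K x) = K x.
  apply/funext => z; rewrite /zext; case: ifPn => //; rewrite -ltNge => z0.
  by rewrite K0//; right.
have z2 z : zext (K^~ z) = K^~ z.
  apply/funext => x; rewrite /zext; case: ifPn => //; rewrite -ltNge => x0.
  by rewrite K0//; left.
have c0 f : (forall x, f x = 0) -> cintegral f = 0.
  move=> f0; apply: eq_complexP.
  - by rewrite Re_cintegral; under eq_Rintegral do rewrite f0; rewrite /Rintegral integral0.
  - by rewrite Im_cintegral; under eq_Rintegral do rewrite f0; rewrite /Rintegral integral0.
have z3 : zext (fun x => cintegral (K x)) = fun x => cintegral (K x).
  apply/funext => x; rewrite /zext; case: ifPn => //; rewrite -ltNge => x0.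
  by rewrite c0// => z; rewrite K0//; left.
have z4 : zext (fun z => cintegral (K^~ z)) = fun z => cintegral (K^~ z).
  apply/funext => z; rewrite /zext; case: ifPn => //; rewrite -ltNge => x0.
  by rewrite c0// => x; rewrite K0//; right.
apply: eq_complexP.
- rewrite [LHS]Re_cintegral_zext [RHS]Re_cintegral_zext z3 z4.
  under eq_Rintegral do rewrite Re_cintegral_zext z1.
  under [RHS]eq_Rintegral do rewrite Re_cintegral_zext z2.
  exact: (Rintegral_Fubini i1).
- rewrite [LHS]Im_cintegral_zext [RHS]Im_cintegral_zext z3 z4.
  under eq_Rintegral do rewrite Im_cintegral_zext z1.
  under [RHS]eq_Rintegral do rewrite Im_cintegral_zext z2.
  exact: (Rintegral_Fubini i2).
Qed.

(* Convolution of L^1(w): [L0_conv (L0_conv f phi) psi = L0_conv f (star phi psi)]. *)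
Definition star phi psi (z : R) : R[i] :=
  cintegral (fun x => zext phi (z - x) * psi x).

Section kernel.
Variables (phi psi : R -> R[i]).
Hypotheses (phi1 : L1w w phi) (psi1 : L1w w psi).

Let wz (z : R) : R := (w \_ H) z.

Let k (x z : R) : R := wz z * normc (zext phi (z - x)) * normc (zext psi x).

Let wz_ge0 z : 0 <= wz z.
Proof.
rewrite /wz patchE; case: ifPn => //; rewrite inE => /half_lineP.
exact: weight_ge0.
Qed.

Let k_ge0 x z : 0 <= k x z.
Proof. by rewrite /k !mulr_ge0 ?normc_ge0. Qed.

Let measurable_k : measurable_fun [set: R * R] (fun xz : R * R => k xz.1 xz.2).
Proof.
have mzphi := measurable_normc measurableT (cmeasurable_zext (L1w_measurable phi1)).
have mzpsi := measurable_normc measurableT (cmeasurable_zext (L1w_measurable psi1)).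
have mwz : measurable_fun [set: R] wz.
  by apply/(measurable_restrictT _ _).1 => //; exact: measurable_weight.
have msub : measurable_fun [set: R * R] (fun z : R * R => z.2 - z.1).
  by apply: measurable_funB; [exact: measurable_snd|exact: measurable_fst].
apply: measurable_funM; first apply: measurable_funM.
- exact: measurableT_comp mwz measurable_snd.
- exact: measurableT_comp mzphi msub.
- exact: measurableT_comp mzpsi measurable_fst.
Qed.

Let measurable_k2 : measurable_fun [set: R * R] (fun zx : R * R => k zx.2 zx.1).
Proof.
have msw : measurable_fun [set: R * R] (fun zx : R * R => (zx.2, zx.1)).
  exact: measurable_swap.
exact: (measurableT_comp measurable_k msw).
Qed.

Let integrable_k : (mu \x mu)%E.-integrable setT (fun xz : R * R => (k xz.1 xz.2)%:E).
Proof.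
apply/integrable12ltyP; first exact/measurable_EFinP.
have mzphi := measurable_normc measurableT (cmeasurable_zext (L1w_measurable phi1)).
have mwz : measurable_fun [set: R] wz.
  by apply/(measurable_restrictT _ _).1 => //; exact: measurable_weight.
pose b x := (L1norm w phi * ((fun x => w x * normc (psi x)) \_ H) x).
have ib : mu.-integrable setT (fun x => (b x)%:E).
  have mH : @measurable _ (measurableTypeR R) H by exact: measurable_half_line.
  have := (integrable_mkcond _ mH).1 (L1w_integrable psi1).
  move=> /(integrableZl measurableT (L1norm w phi)); apply: eq_integrable => // x _.
  by rewrite /b EFinM; congr (_ * _)%E; rewrite !patchE; case: ifP.
have /integrableP[mb] := ib; apply: le_lt_trans.
apply: ge0_le_integral => //.
- by move=> x _; apply: integral_ge0.
- under eq_fun do under eq_integral do rewrite gee0_abs ?lee_fin//.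
  have mk' : measurable_fun [set: R * R] (fun xz : R * R => (k xz.1 xz.2)%:E).
    exact/measurable_EFinP.
  have mF := measurable_fun_fubini_tonelli_F (m2 := mu) _ mk'.
  by apply: mF => xz; rewrite lee_fin.
- exact: measurableT_comp mb.
move=> x _; rewrite gee0_abs; last first.
  rewrite lee_fin /b mulr_ge0 ?L1norm_ge0// patchE; case: ifPn => //.
  by rewrite inE => /half_lineP x0; rewrite mulr_ge0 ?weight_ge0 ?normc_ge0.
under eq_integral do rewrite gee0_abs ?lee_fin//.
have [x0|x0] := leP 0 x; last first.
  rewrite (eq_integral (cst 0%E)); last first.
    by move=> z _; rewrite /k (zext_lt0 psi) ?normc0 ?mulr0// -ltNge.
  by rewrite integral0 lee_fin /b mulr_ge0 ?L1norm_ge0// patchE memNset// => /half_lineP;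
    rewrite leNgt x0.
have mkx : measurable_fun [set: R] (fun z => (k x z)%:E).
  apply/measurable_EFinP; apply: measurable_funM => //; apply: measurable_funM => //.
  apply: measurableT_comp mzphi _; exact: measurable_funB.
rewrite -(integral_shift x mkx).
have ek y : (k x (x + y)%R)%:E = ((fun y => (w (x + y) * normc (phi y) * normc (psi x))%:E) \_ H) y.
  have xyx : x + y - x = y by rewrite addrC addKr.
  rewrite patchE /k xyx; case: ifPn; last first.
    rewrite notin_setE => /half_lineP/negP y0.
    by rewrite (zext_lt0 phi)// normc0 mulr0 mul0r.
  rewrite inE => /half_lineP y0; rewrite !zext_ge0// /wz patchE mem_set//.
  by apply/half_lineP; rewrite addr_ge0.
under eq_integral do rewrite ek.
rewrite -integral_mkcond.
apply: (@le_trans _ _ (\int[mu]_(y in H) ((w x * normc (psi x)) * (w y * normc (phi y)))%:E)%E).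
  apply: ge0_le_integral => //.
  - by move=> y /half_lineP y0; rewrite lee_fin !mulr_ge0 ?normc_ge0 ?weight_ge0// addr_ge0.
  - apply/measurable_EFinP; apply: measurable_funM => //; apply: measurable_funM.
      have sH : [set x + y | y in H] `<=` H.
        by move=> _ [y /half_lineP y0 <-]; apply/half_lineP; rewrite addr_ge0.
      apply: (measurable_comp (F := H) (f := w)) => //.
        exact: measurable_weight.
      exact: measurable_funS (measurable_shift x).
    exact: measurable_normc (L1w_measurable phi1).
  - apply/measurable_EFinP; apply: measurable_funM => //.
    exact: measurable_wnormc (L1w_measurable phi1).
  - move=> y /half_lineP y0; rewrite lee_fin [leRHS]mulrACA [normc (psi x) * _]mulrC mulrA.
    rewrite ler_wpM2r ?normc_ge0// ler_wpM2r ?normc_ge0//.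
    exact: weight_submul.
have iphi := L1w_integrable phi1.
rewrite /b patchE mem_set; last exact/half_lineP.
have := integrableZ_half (w x * normc (psi x)) iphi => ik.
rewrite -[leLHS]fineK; last exact: integrable_fin_num.
by rewrite lee_fin [leRHS]mulrC /L1norm -RintegralZ_half.
Qed.

Let ae_integrable_kz : \forall z \ae mu, mu.-integrable setT (fun x => (k x z)%:E).
Proof. exact: (ae_integrable2 integrable_k). Qed.

Let cmeasurable_kernel z :
  cmeasurable H (fun x => zext phi (z - x) * psi x).
Proof.
apply: cmeasurableM => //; last exact: (L1w_measurable psi1).
have [p1 p2] := cmeasurable_zext (L1w_measurable phi1).
have ms : measurable_fun [set: R] (fun x => z - x) by exact: measurable_funB.
split; apply: (measurable_funS measurableT) => //.
- exact: measurableT_comp p1 ms.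
- exact: measurableT_comp p2 ms.
Qed.

Let integrable_kz_half z : 0 <= z -> mu.-integrable setT (fun x => (k x z)%:E) ->
  mu.-integrable H (fun x => (w z * normc (zext phi (z - x) * psi x))%:E).
Proof.
move=> z0 /integrable_half_line.
apply: eq_integrable => // x; rewrite inE => /half_lineP x0.
rewrite /k normcM mulrA [zext psi x]/zext x0 /wz patchE mem_set//.
exact/half_lineP.
Qed.

Lemma ae_cintegrable_star : \forall z \ae mu, H z ->
  cintegrable (fun x => zext phi (z - x) * psi x).
Proof.
apply: ae_imp ae_integrable_kz => z iz /half_lineP z0.
apply: cintegrable_le (cmeasurable_kernel z) (integrable_kz_half z0 iz) _.
apply: ae_forallT => x _; rewrite ler_peMl ?normc_ge0//.
exact: weight_ge1.
Qed.

Lemma star_L1w : L1w w (star phi psi).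
Proof.
have ik2 : mu.-integrable setT (fun z => (2 * \int[mu]_x k x z)%:E).
  pose kk (zx : R * R) := (k zx.2 zx.1)%:E.
  have mkk : measurable_fun [set: R * R] kk.
    apply/measurable_EFinP.
    exact: measurable_k2.
  have ikk : (mu \x mu)%E.-integrable setT kk.
    apply/integrable21ltyP => //.
    have mk' : measurable_fun [set: R * R] (fun xz : R * R => (k xz.1 xz.2)%:E).
      exact/measurable_EFinP.
    by move: ((integrable12ltyP mu mu mk').1 integrable_k).
  have iF := integrable_fubini_F ikk.
  have mF : measurable_fun setT (fun z => (2 * \int[mu]_x k x z)%:E).
    apply/measurable_EFinP; apply: measurable_funM => //.
    apply: (@measurable_Rintegral_param _ (fun zx : R * R => k zx.2 zx.1)).
    exact: measurable_k2.
  refine (le_integrable _ _ _ (integrableZl _ 2 iF)) => //.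
  move=> z _.
  rewrite EFinM !abseM lee_wpmul2l// /fubini_F /Rintegral /kk.
  by case: (\int[mu]_x (k x z)%:E)%E => [r| |] //; rewrite /= ?normr0 leey.
apply: L1w_le (integrable_half_line ik2) _.
- pose G z x := zext phi (z - x) * psi x.
  have zG z : zext (G z.1) z.2 = zext phi (z.1 - z.2) * zext psi z.2.
    by rewrite /zext /G; case: (0 <= z.2) => //; rewrite mulr0.
  have [p1 p2] := cmeasurable_zext (L1w_measurable phi1).
  have [q1 q2] := cmeasurable_zext (L1w_measurable psi1).
  have msub : measurable_fun [set: R * R] (fun z : R * R => z.1 - z.2).
    by apply: measurable_funB; [exact: measurable_fst|exact: measurable_snd].
  have p1' := measurableT_comp p1 msub.
  have p2' := measurableT_comp p2 msub.
  have q1' : measurable_fun [set: R * R] (fun z => complex.Re (zext psi z.2)).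
    exact: measurableT_comp q1 measurable_snd.
  have q2' : measurable_fun [set: R * R] (fun z => complex.Im (zext psi z.2)).
    exact: measurableT_comp q2 measurable_snd.
  have [c1 c2] : cmeasurable setT (fun z => cintegral (G z)).
    apply: cmeasurable_cintegral_param.
    + under eq_fun do rewrite zG complex_ReM.
      by apply: measurable_funB; exact: measurable_funM.
    + under eq_fun do rewrite zG complex_ImM.
      by apply: measurable_funD; exact: measurable_funM.
  by split; [exact: measurable_funS c1|exact: measurable_funS c2].
- apply: ae_imp ae_integrable_kz => z iz /half_lineP z0.
  have wz0 := weight_gt0 w z0.
  have ih := integrable_kz_half z0 iz.
  have hle : normc (star phi psi z) <=
      2 * ((w z)^-1 * \int[mu]_(x in H) (w z * normc (zext phi (z - x) * psi x))).
    rewrite -RintegralZ_half//.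
    apply: normc_cintegral_le (cmeasurable_kernel z) (integrableZ_half (w z)^-1 ih) _.
    by apply: ae_forallT => x _; rewrite mulKf// gt_eqF.
  rewrite -ler_pdivlMl//; apply: (le_trans hle).
  rewrite [leRHS]mulrCA ler_pM2l// ler_pM2l ?invr_gt0// Rintegral_mkcond.
  rewrite le_eqVlt; apply/orP; left; apply/eqP; apply: eq_Rintegral => x _.
  rewrite patchE /k normcM mulrA; case: ifPn.
    by rewrite inE => /half_lineP x0; rewrite [zext psi x]/zext x0 /wz patchE mem_set//;
      exact/half_lineP.
  rewrite notin_setE => /half_lineP/negP x0.
  by rewrite (zext_lt0 psi)// normc0 mulr0.
Qed.

Let pairing_cconv_bounded c h : cmeasurable H h -> 0 <= c ->
  (forall x, 0 <= x -> normc (h x) <= c * w x) ->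
  pairing (cconv h phi) psi = pairing h (star phi psi).
Proof.
move=> mh c0 hc; have hb : wbounded w c h.
  by split=> //; apply: ae_forallT => x /half_lineP; exact: hc.
pose K x z := zext h z * (zext phi (z - x) * zext psi x).
have [h1 h2] := cmeasurable_zext mh.
have [p1 p2] := cmeasurable_zext (L1w_measurable phi1).
have [q1 q2] := cmeasurable_zext (L1w_measurable psi1).
have msub : measurable_fun [set: R * R] (fun z : R * R => z.2 - z.1).
  by apply: measurable_funB; [exact: measurable_snd|exact: measurable_fst].
have h1' : measurable_fun [set: R * R] (fun z => complex.Re (zext h z.2)).
  exact: measurableT_comp h1 measurable_snd.
have h2' : measurable_fun [set: R * R] (fun z => complex.Im (zext h z.2)).
  exact: measurableT_comp h2 measurable_snd.
have p1' := measurableT_comp p1 msub.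
have p2' := measurableT_comp p2 msub.
have q1' : measurable_fun [set: R * R] (fun z => complex.Re (zext psi z.1)).
  exact: measurableT_comp q1 measurable_fst.
have q2' : measurable_fun [set: R * R] (fun z => complex.Im (zext psi z.1)).
  exact: measurableT_comp q2 measurable_fst.
have Kk x z : normc (K x z) <= c * k x z.
  rewrite /K !normcM /k -!mulrA [leRHS]mulrA ler_wpM2r ?mulr_ge0 ?normc_ge0//.
  rewrite /zext /wz patchE; case: ifPn => z0.
    by rewrite mem_set ?hc//; exact/half_lineP.
  by rewrite memNset ?normc0 ?mulr0// => /half_lineP; exact/negP.
have ick : (mu \x mu)%E.-integrable setT (fun xz : R * R => (c * k xz.1 xz.2)%:E).
  by apply: eq_integrable (integrableZl _ c integrable_k).
rewrite /pairing.
have KE x z : K x z = zext h z * (zext phi (z - x) * zext psi x) by [].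
transitivity (cintegral (fun x => cintegral (K x))).
  apply: eq_cintegral => x x0; rewrite mulrC /cconv /pairing.
  rewrite -cintegralZl; last exact: (pairing_integrable (wbounded_translate x0 c0 hb) phi1).
  have mKx : cmeasurable setT (K x).
    have ms : measurable_fun [set: R] (fun z => z - x) by exact: measurable_funB.
    apply: cmeasurableM => //; apply: cmeasurableM => //.
    by split; [exact: measurableT_comp p1 ms|exact: measurableT_comp p2 ms].
  have e y : zext (fun y => psi x * (h (x + y) * phi y)) y = K x (x + y).
    have xyx : x + y - x = y by rewrite addrC addKr.
    rewrite /K xyx (zext_ge0 psi x0); have [y0|y0] := boolP (0 <= y).
      by rewrite !zext_ge0 ?addr_ge0// mulrCA [psi x * _]mulrC.
    by rewrite zext_lt0// (zext_lt0 phi)// mul0r mulr0.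
  have zK : zext (K x) = K x.
    apply/funext => z; rewrite {1}/zext; case: ifPn => // z0.
    by rewrite /K /zext (negbTE z0) mul0r.
  case: mKx => k1 k2.
  apply: eq_complexP.
  - rewrite [LHS]Re_cintegral_zext [RHS]Re_cintegral_zext zK /Rintegral; congr fine.
    under eq_integral do rewrite e.
    by apply: integral_shift; exact/measurable_EFinP.
  - rewrite [LHS]Im_cintegral_zext [RHS]Im_cintegral_zext zK /Rintegral; congr fine.
    under eq_integral do rewrite e.
    by apply: integral_shift; exact/measurable_EFinP.
have K0 x z : x < 0 \/ z < 0 -> K x z = 0.
  move=> [x0|z0]; first by rewrite /K (zext_lt0 psi) ?mulr0// -ltNge.
  by rewrite /K (zext_lt0 h) ?mul0r// -ltNge.
have mRe : measurable_fun [set: R * R] (fun xz => complex.Re (K xz.1 xz.2)).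
  under eq_fun do rewrite /K !(complex_ReM, complex_ImM).
  by apply: measurable_funB; apply: measurable_funM => //;
    [apply: measurable_funB|apply: measurable_funD]; exact: measurable_funM.
have mIm : measurable_fun [set: R * R] (fun xz => complex.Im (K xz.1 xz.2)).
  under eq_fun do rewrite /K !(complex_ReM, complex_ImM).
  by apply: measurable_funD; apply: measurable_funM => //;
    [apply: measurable_funD|apply: measurable_funB]; exact: measurable_funM.
have iRe : (mu \x mu)%E.-integrable setT (fun xz : R * R => (complex.Re (K xz.1 xz.2))%:E).
  refine (le_integrable _ _ _ ick) => //; first exact/measurable_EFinP.
  move=> ? _; rewrite lee_fin [leRHS]ger0_norm; last by rewrite mulr_ge0 ?k_ge0.
  exact: le_trans (normc_Re_le _) (Kk _ _).
have iIm : (mu \x mu)%E.-integrable setT (fun xz : R * R => (complex.Im (K xz.1 xz.2))%:E).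
  refine (le_integrable _ _ _ ick) => //; first exact/measurable_EFinP.
  move=> ? _; rewrite lee_fin [leRHS]ger0_norm; last by rewrite mulr_ge0 ?k_ge0.
  exact: le_trans (normc_Im_le _) (Kk _ _).
rewrite (cintegral_swap iRe iIm K0); apply: cintegral_ae_eq.
- have msw : measurable_fun [set: R * R] (fun zx : R * R => (zx.2, zx.1)).
    exact: measurable_swap.
  have zK (z : R * R) : zext (K^~ z.1) z.2 = K z.2 z.1.
    rewrite /zext; case: ifPn => // z2; rewrite K0//; left.
    by rewrite ltNge.
  have [c1 c2] : cmeasurable setT (fun z => cintegral (K^~ z)).
    apply: cmeasurable_cintegral_param.
    + under eq_fun do rewrite zK.
      exact: (measurableT_comp mRe msw).
    + under eq_fun do rewrite zK.
      exact: (measurableT_comp mIm msw).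
  by split; [exact: measurable_funS c1|exact: measurable_funS c2].
- by apply: cmeasurableM => //; exact: (L1w_measurable star_L1w).
- apply: ae_imp ae_cintegrable_star => z iz Hz; have /half_lineP z0 := Hz.
  rewrite /star -cintegralZl; last exact: iz.
  by apply: eq_cintegral => x x0; rewrite /K !(zext_ge0 _ z0) (zext_ge0 _ x0).
Qed.

Lemma wbounded_repr c g : 0 <= c -> wbounded w c g ->
  exists g', [/\ cmeasurable H g', forall x, 0 <= x -> normc (g' x) <= c * w x &
    \forall x \ae mu, H x -> g x = g' x].
Proof.
move=> c0 [mg gc]; pose A := H `&` [set x | normc (g x) <= c * w x].
have mA : measurable A.
  apply: measurable_fun_le => //; first exact: measurable_normc.
  by apply: measurable_funM => //; exact: measurable_weight.
exists (fun x => (\1_A x)%:C * g x); split.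
- apply: cmeasurableM => //; apply: cmeasurable_real.
  exact: measurable_indic.
- move=> x x0; rewrite normcM normc_real indicE; case: (boolP (x \in A)).
    by rewrite inE => -[_ /=]; rewrite normr1 mul1r.
  by rewrite normr0 mul0r mulr_ge0// weight_ge0.
- apply: ae_imp gc => x h Hx; rewrite indicE mem_set ?mul1r//.
  by split => //; exact: h.
Qed.

Lemma pairing_cconv c h : 0 <= c -> wbounded w c h ->
  pairing (cconv h phi) psi = pairing h (star phi psi).
Proof.
move=> c0 hb; have [mh _] := hb; have [g [mg gc hg]] := wbounded_repr c0 hb.
have mphi := L1w_measurable phi1; have mpsi := L1w_measurable psi1.
rewrite (pairing_ae_eq mh mg (L1w_measurable star_L1w) (L1w_measurable star_L1w) hg)//;
  last exact: ae_forallT.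
rewrite -(pairing_cconv_bounded mg c0 gc); apply: pairing_ae_eq => //.
- exact: cmeasurable_cconv.
- exact: cmeasurable_cconv.
- apply: ae_forallT => x /half_lineP x0; apply: cconv_ae_eq => //; exact: ae_forallT.
- exact: ae_forallT.
Qed.

Lemma cconv_star c f t : 0 <= t -> 0 <= c -> wbounded w c f ->
  cconv (cconv f phi) psi t = cconv f (star phi psi) t.
Proof.
move=> t0 c0 fc; have wt := weight_ge0 w t0.
have fb := wbounded_translate t0 c0 fc.
rewrite -[RHS](pairing_cconv (mulr_ge0 c0 wt) fb).
rewrite [LHS]/cconv; congr (pairing _ psi); apply/funext => y.
rewrite /cconv; congr (pairing _ phi); apply/funext => z.
by rewrite addrA.
Qed.

End kernel.
End convolution.

Section dual_of_L1.
Context {R : realType} (w : weight R).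
Local Notation mu := (@lebesgue_measure R).
Local Notation H := (`[0%R : R, +oo[%classic).
Local Notation pdf := (exponential_pdf (1 : R)).
Implicit Types (f g phi psi : R -> R[i]) (D E : set (measurableTypeR R)).

Lemma ae_le_Rintegral D (h k : R -> R) : measurable D ->
  mu.-integrable D (fun x => (h x)%:E) -> mu.-integrable D (fun x => (k x)%:E) ->
  (forall E, E `<=` D -> measurable E ->
    \int[mu]_(x in E) h x <= \int[mu]_(x in E) k x) ->
  \forall x \ae mu, D x -> h x <= k x.
Proof.
move=> mD ih ik hk.
have /integrableP[/measurable_EFinP mh _] := ih.
have /integrableP[/measurable_EFinP mk _] := ik.
pose E := D `\` (D `&` [set x | h x <= k x]).
have mE : measurable E by apply: measurableD => //; exact: measurable_fun_le.
have ED : E `<=` D by move=> x [].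
have ihE := integrableS mD mE ED ih; have ikE := integrableS mD mE ED ik.
have Ehk x : E x -> k x < h x.
  by move=> [Dx /not_andP[//|/= /negP]]; rewrite -ltNge.
have i0 : (\int[mu]_(x in E) `|(h x - k x)%:E| = 0)%E.
  have e : (\int[mu]_(x in E) `|(h x - k x)%:E| = \int[mu]_(x in E) (h x - k x)%:E)%E.
    apply: eq_integral => x; rewrite inE => /Ehk kh.
    by rewrite gee0_abs// lee_fin subr_ge0 ltW.
  apply/eqP; rewrite eq_le integral_ge0// andbT e.
  have -> : (\int[mu]_(x in E) (h x - k x)%:E =
      (\int[mu]_(x in E) h x - \int[mu]_(x in E) k x)%:E)%E.
    rewrite EFinB /Rintegral !fineK; [|exact: integrable_fin_num..].
    by rewrite -integralB_EFin.
  by rewrite lee_fin subr_le0; exact: hk.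
have := (ae_eq_integral_abs mu mE _).1 i0.
move=> /(_ _)/ae_imp; apply.
  move=> x hx Dx; rewrite leNgt; apply/negP => kh.
  have : E x by split => // -[_ /=]; rewrite leNgt kh.
  by move=> /hx[]/eqP; rewrite subr_eq0 gt_eqF.
apply/measurable_EFinP; apply: measurable_funB.
- exact: measurable_funS mh.
- exact: measurable_funS mk.
Qed.

Lemma pdf_gt0 (x : R) : 0 <= x -> 0 < pdf x.
Proof. by move=> x0; rewrite exponential_pdfE// mul1r expR_gt0. Qed.

Lemma pdf_ge0 (x : R) : 0 <= pdf x.
Proof. by apply: exponential_pdf_ge0. Qed.

Lemma integrable_pdf E : measurable E -> mu.-integrable E (fun x => (pdf x)%:E).
Proof.
by move=> mE; apply: integrableS (integrable_exponential_pdf ltr01).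
Qed.

(* With this density, 1_E q lies in L^1(w) for every Borel set E, and its norm is
   a finite measure of E. *)
Let q (x : R) : R := pdf x / w x.

Let measurable_q : measurable_fun H q.
Proof.
apply: measurable_funM.
  exact: (measurable_funS measurableT) (measurable_exponential_pdf _).
apply: (eq_measurable_fun (fun x => w x `^ (-1))).
  move=> x; rewrite inE => /half_lineP x0.
  by rewrite powR_inv1// weight_ge0.
by apply: (measurableT_comp (measurable_powR _)); exact: measurable_weight.
Qed.

Let q_gt0 x : 0 <= x -> 0 < q x.
Proof. by move=> x0; rewrite divr_gt0 ?pdf_gt0 ?weight_gt0. Qed.

Let wq x : 0 <= x -> w x * q x = pdf x.
Proof. by move=> x0; rewrite mulrC divfK// gt_eqF// weight_gt0. Qed.

Let measurable_qV : measurable_fun H (fun x => (q x)^-1).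
Proof.
apply: (eq_measurable_fun (fun x => q x `^ (-1))).
  move=> x; rewrite inE => /half_lineP x0.
  by rewrite powR_inv1// ltW// q_gt0.
exact: (measurableT_comp (measurable_powR _)).
Qed.

Definition test_fun E (x : R) : R[i] := (\1_E x * q x)%:C.

Lemma test_fun_L1w E : measurable E -> L1w w (test_fun E).
Proof.
move=> mE; have ipdf : mu.-integrable H (fun x => (pdf x)%:E).
  apply: integrable_half_line; exact: integrable_exponential_pdf.
apply: L1w_le ipdf _.
  by apply: cmeasurable_real; apply: measurable_funM.
apply: ae_forallT => x /half_lineP x0; rewrite normc_real ger0_norm; last first.
  by rewrite mulr_ge0// ltW// q_gt0.
rewrite mulrCA wq// indicE; case: (x \in E); rewrite ?mul1r ?mul0r//.
exact: pdf_ge0.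
Qed.

Lemma L1norm_test_fun E : measurable E ->
  L1norm w (test_fun E) = \int[mu]_(x in E) pdf x.
Proof.
move=> mE; rewrite /L1norm Rintegral_mkcond [RHS]Rintegral_mkcond.
apply: eq_Rintegral => x _; rewrite !patchE; case: ifPn.
  rewrite inE => /half_lineP x0; rewrite normc_real ger0_norm; last first.
    by rewrite mulr_ge0// ltW// q_gt0.
  by rewrite mulrCA wq// indicE; case: (x \in E); rewrite ?mul1r ?mul0r.
rewrite notin_setE => /half_lineP/negP; rewrite -ltNge => x0.
by rewrite lt0_exponential_pdf//; case: ifP.
Qed.

(* The bound makes nu countably additive, so that Radon-Nikodym applies. *)
Lemma dominated_density (nu : set (measurableTypeR R) -> R) (K : R) :
  nu set0 = 0 ->
  (forall A B, measurable A -> measurable B -> [disjoint A & B] ->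
    nu (A `|` B) = nu A + nu B) ->
  (forall E, measurable E -> `|nu E| <= K * \int[mu]_(x in E) pdf x) ->
  exists h : R -> R, mu.-integrable setT (fun x => (h x)%:E) /\
    forall E, measurable E -> \int[mu]_(x in E) h x = nu E.
Proof.
move=> nu0 nuU nuK; pose nue E := (nu E)%:E.
pose m E := \int[mu]_(x in E) pdf x.
have mU A B : measurable A -> measurable B -> [disjoint A & B] ->
    m (A `|` B) = m A + m B.
  move=> mA mB AB; apply: Rintegral_setU => //.
  by apply: integrable_pdf; exact: measurableU.
have sumU (nu' : set (measurableTypeR R) -> R) (F : (set (measurableTypeR R))^nat) n :
    nu' set0 = 0 ->
    (forall A B, measurable A -> measurable B -> [disjoint A & B] ->
    nu' (A `|` B) = nu' A + nu' B) -> (forall i, measurable (F i)) ->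
    trivIset setT F ->
    nu' (\big[setU/set0]_(0 <= i < n) F i) = \sum_(0 <= i < n) nu' (F i).
  move=> nu'0 nu'U mF tF; elim: n => [|n IH]; first by rewrite !big_nil.
  rewrite !big_nat_recr//= nu'U ?IH//; first exact: bigsetU_measurable.
  apply/disj_setPS => x [Ux Fx]; move: Ux.
  rewrite big_mkord -bigcup_mkord => -[i /= ni Fix].
  have := tF i n Logic.I Logic.I; move=> /(_ _)/eqP.
  have : (F i `&` F n !=set0) by exists x.
  by move=> ne /(_ ne) => /eqP ein; move: ni; rewrite ein ltnn.
have sigma : semi_sigma_additive nue.
  move=> F mF tF mUF; rewrite /nue.
  have cm : (\sum_(0 <= i < n) m (F i)) @[n --> \oo] --> m (\bigcup_n F n).
    have mpdf : measurable_fun [set: measurableTypeR R] (fun x => (pdf x)%:E).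
      by apply/measurable_EFinP; exact: measurable_exponential_pdf.
    have := @semi_sigma_additive_nng_induced _ _ _ mu _ mpdf
      (fun x => pdf_ge0 x) F mF tF mUF.
    have mE A : measurable A -> (\int[mu]_(x in A) (pdf x)%:E = (m A)%:E)%E.
      by move=> mA; rewrite /m /Rintegral fineK//; apply: integrable_fin_num => //;
        exact: integrable_pdf.
    rewrite (mE _ mUF) => /fine_cvgP[_]; apply: cvg_trans.
    apply: near_eq_cvg; apply: nearW => n /=.
    by under eq_bigr do rewrite mE//; rewrite sumEFin.
  apply: cvg_EFin; first by apply: nearW => n; rewrite sumEFin.
  rewrite (_ : fine \o _ = fun n => \sum_(0 <= i < n) nu (F i)); last first.
    by apply/funext => n /=; rewrite sumEFin.
  apply/cvgrPdist_le => e e0.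
  have K0 : 0 < `|K| + 1 by rewrite ltr_wpDl.
  have := cm => /cvgrPdist_le/(_ (e / (`|K| + 1)))/(_ _)[]; first by rewrite divr_gt0.
  move=> N _ NP; exists N => // n Nn /=; have {NP} := NP n Nn => /=.
  rewrite -(sumU m)//; last by rewrite /m Rintegral_set0.
  rewrite -(sumU nu)//; set U := \big[setU/set0]_(0 <= i < n) F i.
  have mUn : measurable U by exact: bigsetU_measurable.
  have UF : U `<=` \bigcup_n F n.
    rewrite /U big_mkord -bigcup_mkord => x [i _ Fix]; exists i => //.
  have mV : measurable (\bigcup_n F n `\` U) by exact: measurableD.
  have dUV : [disjoint U & \bigcup_n F n `\` U].
    by apply/disj_setPS => x [Ux []].
  have -> : \bigcup_n F n = U `|` (\bigcup_n F n `\` U) by rewrite setDUK.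
  have aux (a b : R) : a + b - a = b by rewrite addrC addKr.
  rewrite (mU _ _ mUn mV dUV) (nuU _ _ mUn mV dUV) !aux => mle.
  rewrite (le_trans (nuK _ mV))//.
  have m0 : 0 <= m (\bigcup_n F n `\` U) by apply: Rintegral_ge0 => x _; exact: pdf_ge0.
  move: mle; rewrite ger0_norm// ler_pdivlMr// mulrC => mle.
  apply: le_trans mle; rewrite ler_wpM2r// (le_trans (ler_norm K))//.
  by rewrite lerDl.
have nue0 : nue set0 = 0%E by rewrite /nue nu0.
have nuefin E : measurable E -> nue E \is a fin_num by [].
pose nuC : {charge set (measurableTypeR R) -> \bar R} :=
  HB.pack nue (isCharge.Build _ _ _ nue nue0 nuefin sigma).
have nudom : nuC `<< mu.
  apply/null_content_dominatesP => A mA muA.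
  have : `|nu A| <= 0.
    rewrite (le_trans (nuK _ mA))// /Rintegral (@null_set_integral _ _ _ _ A)//= ?mulr0//.
    by apply/measurable_EFinP; exact: (measurable_funS measurableT) (measurable_exponential_pdf _).
  by rewrite normr_le0 => /eqP nuA; rewrite /nuC/= /nue nuA.
exists (fun x => fine (Radon_Nikodym nuC mu x)).
have fE : (fun x => (fine (Radon_Nikodym nuC mu x))%:E) = Radon_Nikodym nuC mu.
  by apply/funext => x; rewrite fineK// Radon_Nikodym_fin_num.
split; first by rewrite fE; exact: Radon_Nikodym_integrable.
move=> E mE; rewrite /Rintegral fE -Radon_Nikodym_integral//.
Qed.

Lemma Re_pairing_test_fun g E : measurable E ->
  complex.Re (pairing g (test_fun E)) = \int[mu]_(x in E) (complex.Re (g x) * q x).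
Proof.
move=> mE; rewrite Re_cintegral Rintegral_mkcond [RHS]Rintegral_mkcond.
apply: eq_Rintegral => x _; rewrite !patchE; case: ifPn => xH.
  rewrite complex_ReM/= mulr0 subr0 indicE.
  by case: (x \in E); rewrite ?mul1r ?mul0r ?mulr0.
move: xH; rewrite notin_setE => /half_lineP/negP; rewrite -ltNge => x0.
by rewrite /q lt0_exponential_pdf// mul0r mulr0; case: ifP.
Qed.

Lemma Im_pairing_test_fun g E : measurable E ->
  complex.Im (pairing g (test_fun E)) = \int[mu]_(x in E) (complex.Im (g x) * q x).
Proof.
move=> mE; rewrite Im_cintegral Rintegral_mkcond [RHS]Rintegral_mkcond.
apply: eq_Rintegral => x _; rewrite !patchE; case: ifPn => xH.
  rewrite complex_ImM/= mulr0 add0r indicE.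
  by case: (x \in E); rewrite ?mul1r ?mul0r ?mulr0.
move: xH; rewrite notin_setE => /half_lineP/negP; rewrite -ltNge => x0.
by rewrite /q lt0_exponential_pdf// mul0r mulr0; case: ifP.
Qed.

Lemma ae_le_of_pairing D g (K : R) : measurable D -> D `<=` H ->
  mu.-integrable D (fun x => (complex.Re (g x) * q x)%:E) ->
  mu.-integrable D (fun x => (complex.Im (g x) * q x)%:E) ->
  (forall E, E `<=` D -> measurable E ->
    normc (pairing g (test_fun E)) <= K * L1norm w (test_fun E)) ->
  \forall x \ae mu, D x -> normc (g x) <= 2 * K * w x.
Proof.
move=> mD DH iRe iIm hE.
have ik : mu.-integrable D (fun x => (K * pdf x)%:E).
  by apply: eq_integrable (integrableZl mD K (integrable_pdf mD)).
have one (h : R -> R) : mu.-integrable D (fun x => (h x * q x)%:E) ->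
    (forall E, E `<=` D -> measurable E ->
      `|\int[mu]_(x in E) (h x * q x)| <= K * L1norm w (test_fun E)) ->
    \forall x \ae mu, D x -> `|h x| <= K * w x.
  move=> ih hh.
  have hk E : E `<=` D -> measurable E ->
      \int[mu]_(x in E) (K * pdf x) = K * L1norm w (test_fun E).
    by move=> ED mE; rewrite RintegralZl ?L1norm_test_fun//; exact: integrable_pdf.
  have ihN : mu.-integrable D (fun x => (- (h x * q x))%:E).
    apply: eq_integrable (integrableZl mD (-1) ih) => // x _.
    by rewrite -EFinM mulN1r.
  have h1 : \forall x \ae mu, D x -> h x * q x <= K * pdf x.
    apply: ae_le_Rintegral => // E ED mE; rewrite hk//.
    exact: le_trans (ler_norm _) (hh E ED mE).
  have h2 : \forall x \ae mu, D x -> - (h x * q x) <= K * pdf x.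
    apply: ae_le_Rintegral => // E ED mE; rewrite hk//.
    have -> : \int[mu]_(x in E) (- (h x * q x)) = - \int[mu]_(x in E) (h x * q x).
      rewrite -mulN1r -RintegralZl//; last exact: integrableS ih.
      by apply: eq_Rintegral => x _; rewrite mulN1r.
    by apply: le_trans (hh E ED mE); rewrite -normrN ler_norm.
  apply: ae_imp2 h1 h2 => x h1 h2 Dx; have /half_lineP x0 := DH x Dx.
  have q0 := q_gt0 x0; rewrite -(ler_pM2r q0) -mulrA wq//.
  rewrite -[X in _ * X](gtr0_norm q0) -normrM ler_norml h1// andbT.
  by rewrite lerNl h2.
have aeRe := one (fun x => complex.Re (g x)) iRe.
have aeIm := one (fun x => complex.Im (g x)) iIm.
have {}aeRe : \forall x \ae mu, D x -> `|complex.Re (g x)| <= K * w x.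
  apply: aeRe => E ED mE; rewrite -Re_pairing_test_fun//.
  exact: le_trans (normc_Re_le _) (hE E ED mE).
have {}aeIm : \forall x \ae mu, D x -> `|complex.Im (g x)| <= K * w x.
  apply: aeIm => E ED mE; rewrite -Im_pairing_test_fun//.
  exact: le_trans (normc_Im_le _) (hE E ED mE).
apply: ae_imp2 aeRe aeIm => x h1 h2 Dx; rewrite (le_trans (normc_le_ReIm _))//.
by rewrite -mulrA mulr2n mulrDl mul1r lerD ?h1 ?h2.
Qed.

Definition L1_functional (L : (R -> R[i]) -> R[i]) (K : R) :=
  (forall a phi psi, L1w w phi -> L1w w psi ->
    L (fun x => a * phi x + psi x) = a * L phi + L psi) /\
  (forall phi, L1w w phi -> normc (L phi) <= K * L1norm w phi).

Section functional.
Variables (L : (R -> R[i]) -> R[i]) (K : R).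
Hypothesis LK : L1_functional L K.

Let Llin := LK.1.
Let Lbd := LK.2.

Lemma L1_functional0 : L (fun=> 0) = 0.
Proof.
have h0 : L1w w (fun=> 0).
  have := L1wZ 0 (test_fun_L1w measurableT).
  by congr (L1w w); apply/funext => x; rewrite mul0r.
have e : (fun x : R => -1 * 0 + 0 : R[i]) = fun=> 0.
  by apply/funext => x; rewrite mulr0 addr0.
by have := Llin (-1) h0 h0; rewrite e => ->; rewrite mulN1r addNr.
Qed.

Hypothesis L0 : forall E, measurable E -> L (test_fun E) = 0.

Import HBNNSimple.

Let L_simple (s : {nnsfun (measurableTypeR R) >-> R}) :
  L1w w (fun x => (s x * q x)%:C) /\ L (fun x => (s x * q x)%:C) = 0.
Proof.
pose r : seq R := finmap.enum_fset (fset_set (range s)).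
pose c (i : nat) := nth 0 r i.
pose S n x : R[i] := \sum_(i < n) (c i)%:C * test_fun (s @^-1` [set c i]) x.
have Sn n : L1w w (S n) /\ L (S n) = 0.
  elim: n => [|n [IH1 IH2]].
    rewrite (_ : S 0%N = fun=> 0); last by apply/funext => x; rewrite /S big_ord0.
    split; last exact: L1_functional0.
    have := L1wZ 0 (test_fun_L1w measurableT).
    by congr (L1w w); apply/funext => x; rewrite mul0r.
  have mE : measurable (s @^-1` [set c n]) by exact: measurable_sfunP.
  have -> : S n.+1 = fun x => (c n)%:C * test_fun (s @^-1` [set c n]) x + S n x.
    by apply/funext => x; rewrite /S big_ord_recr/= addrC.
  have ht := test_fun_L1w mE.
  split; first by apply: L1wD => //; exact: L1wZ.
  by rewrite Llin// IH2 L0// mulr0 addr0.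
have e : (fun x => (s x * q x)%:C) = S (size r).
  apply/funext => x; rewrite fimfunEord /S mulr_suml rmorph_sum/=.
  by apply: eq_bigr => i _; rewrite -mulrA [LHS]rmorphM.
by rewrite e; exact: Sn.
Qed.

Let L_nonneg (p : R -> R) : (forall x, 0 <= x -> 0 <= p x) ->
  L1w w (fun x => (p x)%:C) -> L (fun x => (p x)%:C) = 0.
Proof.
move=> p0 hp; have [mp _] := L1w_measurable hp.
have mH : @measurable _ (measurableTypeR R) H by exact: measurable_half_line.
have mpsi : measurable_fun (H : set (measurableTypeR R)) (fun x => (p x / q x)%:E).
  by apply/measurable_EFinP; exact: measurable_funM.
have psi0 x : H x -> (0 <= (p x / q x)%:E)%E.
  by move=> /half_lineP x0; rewrite lee_fin divr_ge0 ?p0// ltW// q_gt0.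
pose s := nnsfun_approx mH mpsi.
pose phi n x : R[i] := -1 * (s n x * q x)%:C + (p x)%:C.
have phiE n x : phi n x = (p x - s n x * q x)%:C.
  by rewrite /phi mulN1r addrC -rmorphB.
have hphi n : L1w w (phi n).
  by apply: L1wD => //; apply: L1wZ; have [] := L_simple (s n).
have Lphi n : L (phi n) = L (fun x => (p x)%:C).
  have [h1 h2] := L_simple (s n).
  by rewrite /phi Llin// h2 mulr0 add0r.
have sq x n : H x -> 0 <= p x - s n x * q x <= p x.
  move=> Hx; have /half_lineP x0 := Hx; have qx := q_gt0 x0.
  rewrite subr_ge0 gerBl mulr_ge0 ?(ltW qx)// andbT -ler_pdivlMr// -lee_fin.
  by rewrite /s nnsfun_approxE; exact: le_approx.
have cvg0 : (\int[mu]_(x in H) (w x * normc (phi n x))%:E)%E @[n --> \oo] --> 0%E.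
  have := @dominated_convergence _ _ _ mu H mH
    (fun n x => (w x * normc (phi n x))%:E) (cst 0%E) (fun x => (w x * normc (p x)%:C)%:E).
  case=> //.
  - by move=> n; apply/measurable_EFinP; exact: measurable_wnormc (L1w_measurable (hphi n)).
  - apply: ae_forallT => x Hx; have /half_lineP x0 := Hx; have qx := q_gt0 x0.
    apply: cvg_EFin; first exact: nearW.
    have cs : s n x @[n --> \oo] --> p x / q x.
      have := cvg_nnsfun_approx mH mpsi psi0 Hx.
      by move=> /fine_cvgP[].
    rewrite (_ : fine \o _ = fun n => w x * `|p x - s n x * q x|); last first.
      by apply/funext => n; rewrite /comp phiE normc_real.
    have e0 : 0 = w x * `|p x - p x / q x * q x|.
      by rewrite divfK ?gt_eqF// subrr normr0 mulr0.
    rewrite [X in _ --> X]e0; apply: cvgM; first exact: cvg_cst.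
    apply: cvg_norm; apply: cvgB; first exact: cvg_cst.
    by apply: cvgM => //; exact: cvg_cst.
  - exact: L1w_integrable.
  - apply: ae_forallT => x n Hx; have /half_lineP x0 := Hx.
    have /andP[s1 s2] := sq x n Hx.
    rewrite phiE !normc_real lee_fin ger0_norm; last first.
      by rewrite mulr_ge0// weight_ge0.
    by rewrite ler_wpM2l ?weight_ge0// !ger0_norm// p0.
  by move=> _ _; rewrite integral0.
apply: eq0_normc; apply/eqP; rewrite eq_le normc_ge0 andbT.
have cvg0' : K * L1norm w (phi n) @[n --> \oo] --> 0.
  rewrite -[X in _ --> X](mulr0 K); apply: cvgM; first exact: cvg_cst.
  by move: cvg0 => /fine_cvgP[_].
rewrite -(cvg_lim _ cvg0')//; apply: limr_ge; first by apply/cvg_ex; exists 0.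
by apply: nearW => n; rewrite -(Lphi n); exact: Lbd.
Qed.

Lemma L1_functional_eq0 phi : L1w w phi -> L phi = 0.
Proof.
move=> hphi; have [m1 m2] := L1w_measurable hphi; have iphi := L1w_integrable hphi.
have part (p : R -> R) : measurable_fun H p -> (forall x, 0 <= p x) ->
    (forall x, p x <= normc (phi x)) -> L1w w (fun x => (p x)%:C) /\
    L (fun x => (p x)%:C) = 0.
  move=> mp p0 pphi; have h : L1w w (fun x => (p x)%:C).
    apply: L1w_le iphi _; first exact: cmeasurable_real.
    apply: ae_forallT => x /half_lineP x0; rewrite normc_real ger0_norm//.
    by rewrite ler_wpM2l ?weight_ge0.
  by split => //; apply: L_nonneg.
have pos (h : R -> R) : measurable_fun H h -> (forall x, `|h x| <= normc (phi x)) ->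
    L1w w (fun x => (h x)%:C) /\ L (fun x => (h x)%:C) = 0.
  move=> mh hphi'.
  have mhN : measurable_fun H (fun x => - h x).
    rewrite (_ : (fun x => _) = fun x => 0 - h x); first exact: measurable_funB.
    by apply/funext => x; rewrite sub0r.
  have [h1 h2] := part (fun x => Num.max (h x) 0) (measurable_maxr mh (measurable_cst _))
    (fun x => ltac:(by rewrite le_max lexx orbT))
    (fun x => ltac:(by rewrite ge_max normc_ge0 andbT (le_trans (ler_norm _))//)).
  have [h3 h4] := part (fun x => Num.max (- h x) 0)
    (measurable_maxr mhN (measurable_cst _))
    (fun x => ltac:(by rewrite le_max lexx orbT))
    (fun x => ltac:(by rewrite ge_max normc_ge0 andbT (le_trans (ler_norm _))// normrN)).
  have e : (fun x => (h x)%:C) = fun x => -1 * (Num.max (- h x) 0)%:C + (Num.max (h x) 0)%:C.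
    apply/funext => x; rewrite mulN1r addrC -rmorphB/=; congr (_%:C).
    have [h0|h0] := leP 0 (h x).
      by rewrite max_r ?subr0// oppr_le0.
    by rewrite max_l ?oppr_ge0 ?(ltW h0)// opprK add0r.
  by rewrite e; split; [apply: L1wD => //; exact: L1wZ|rewrite Llin// h2 h4 mulr0 addr0].
have [h1 h2] := pos _ m1 (fun x => normc_Re_le (phi x)).
have [h3 h4] := pos _ m2 (fun x => normc_Im_le (phi x)).
have e : phi = fun x => 'i * (complex.Im (phi x))%:C + (complex.Re (phi x))%:C.
  by apply/funext => x; rewrite addrC complexE_ReIm; case: (phi x).
by rewrite e Llin// h2 h4 mulr0 addr0.
Qed.

End functional.

Lemma L1_dual (L : (R -> R[i]) -> R[i]) (K : R) : L1_functional L K ->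
  exists g, [/\ wbounded w (2 * K) g, forall phi, L1w w phi -> pairing g phi = L phi &
    forall D (K' : R), measurable D -> D `<=` H ->
      (forall E, E `<=` D -> measurable E ->
        normc (L (test_fun E)) <= K' * L1norm w (test_fun E)) ->
      \forall x \ae mu, D x -> normc (g x) <= 2 * K' * w x].
Proof.
move=> LK; have [Llin Lbd] := LK.
have part (P : R[i] -> R) : P 0 = 0 -> {morph P : a b / a + b} ->
    (forall z, `|P z| <= normc z) -> exists h : R -> R,
    mu.-integrable setT (fun x => (h x)%:E) /\
    forall E, measurable E -> \int[mu]_(x in E) h x = P (L (test_fun E)).
  move=> P0 PD Ple; apply: (@dominated_density _ K).
  - rewrite (_ : test_fun set0 = fun=> 0); first by rewrite (L1_functional0 LK).
    by apply/funext => x; rewrite /test_fun indic0 mul0r.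
  - move=> A B mA mB /disj_setPS AB; rewrite -PD; congr P.
    rewrite -[L (test_fun A)]mul1r -Llin; [|exact: test_fun_L1w..].
    congr L; apply/funext => x; rewrite mul1r /test_fun -rmorphD/= -mulrDl; congr (_ * _)%:C.
    rewrite !indicE in_setU; case: (boolP (x \in A)) => xA; case: (boolP (x \in B)) => xB;
      rewrite ?addr0 ?add0r//.
    by exfalso; apply: (AB x); split; rewrite -inE.
  - move=> E mE; rewrite (le_trans (Ple _))// -L1norm_test_fun//.
    by apply: Lbd; exact: test_fun_L1w.
have [h1 [ih1 h1E]] := part (fun z => complex.Re z) erefl complex_ReD normc_Re_le.
have [h2 [ih2 h2E]] := part (fun z => complex.Im z) erefl complex_ImD normc_Im_le.
pose g x : R[i] := (h1 x / q x) +i* (h2 x / q x).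
have mH : @measurable _ (measurableTypeR R) H by exact: measurable_half_line.
have mg : cmeasurable H g.
  have /integrableP[/measurable_EFinP mh1 _] := ih1.
  have /integrableP[/measurable_EFinP mh2 _] := ih2.
  have mh1' : measurable_fun H h1 by apply: measurable_funS mh1.
  have mh2' : measurable_fun H h2 by apply: measurable_funS mh2.
  by split; [exact: (measurable_funM mh1' measurable_qV)|
    exact: (measurable_funM mh2' measurable_qV)].
have gRe x : H x -> complex.Re (g x) * q x = h1 x.
  by move=> /half_lineP x0; rewrite /= divfK// gt_eqF// q_gt0.
have gIm x : H x -> complex.Im (g x) * q x = h2 x.
  by move=> /half_lineP x0; rewrite /= divfK// gt_eqF// q_gt0.
have test_fun_half E : test_fun E = test_fun (E `&` H).
  apply/funext => x; rewrite /test_fun; congr (_%:C).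
  have [x0|x0] := leP 0 x.
    by rewrite !indicE in_setI [x \in H]mem_set ?andbT//; exact/half_lineP.
  by rewrite /q lt0_exponential_pdf// mul0r !mulr0.
have gE E : measurable E -> pairing g (test_fun E) = L (test_fun E).
  move=> mE; rewrite test_fun_half; have mEH : measurable (E `&` H) by exact: measurableI.
  apply: eq_complexP.
  - rewrite Re_pairing_test_fun// -h1E//; apply: eq_Rintegral => x.
    by rewrite inE => -[_ /gRe].
  - rewrite Im_pairing_test_fun// -h2E//; apply: eq_Rintegral => x.
    by rewrite inE => -[_ /gIm].
have gD D (K' : R) : measurable D -> D `<=` H ->
    (forall E, E `<=` D -> measurable E ->
      normc (L (test_fun E)) <= K' * L1norm w (test_fun E)) ->
    \forall x \ae mu, D x -> normc (g x) <= 2 * K' * w x.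
  move=> mD DH hE; apply: ae_le_of_pairing => //.
  - apply: (@eq_integrable _ _ _ mu D mD (fun x => (h1 x)%:E)); last exact: integrableS ih1.
    by move=> x; rewrite inE => /DH /gRe ->.
  - apply: (@eq_integrable _ _ _ mu D mD (fun x => (h2 x)%:E)); last exact: integrableS ih2.
    by move=> x; rewrite inE => /DH /gIm ->.
  - by move=> E ED mE; rewrite gE//; exact: hE.
have gb : wbounded w (2 * K) g.
  split => //; apply: gD => // E _ mE; apply: Lbd; exact: test_fun_L1w.
exists g; split => // phi hphi.
have Delta : L1_functional (fun phi => -1 * L phi + pairing g phi) (K + 2 * (2 * K)).
  split=> [a p1 p2 hp1 hp2|p hp].
    rewrite Llin// (pairingDr gb) ?(pairingZr _ gb)//; last exact: L1wZ.
    by ring.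
  rewrite (le_trans (le_normcD _ _))// mulrDl lerD//.
    have -> : (-1 : R[i]) = (-1)%:C by rewrite rmorphN.
    by rewrite normcM normc_real normrN1 mul1r; exact: Lbd.
  by rewrite -!mulrA [2 * (K * _)]mulrA; exact: normc_pairing_le.
have := @L1_functional_eq0 _ _ Delta _ phi hphi; move=> /(_ _)/eqP.
rewrite mulN1r addrC subr_eq0 => h; apply/eqP/h => E mE.
by rewrite gE// mulN1r addNr.
Qed.

Lemma pairing_le_ae D c g (K : R) : measurable D -> D `<=` H -> wbounded w c g ->
  (forall E, E `<=` D -> measurable E ->
    normc (pairing g (test_fun E)) <= K * L1norm w (test_fun E)) ->
  \forall x \ae mu, D x -> normc (g x) <= 2 * K * w x.
Proof.
move=> mD DH gb.
have mH : @measurable _ (measurableTypeR R) H by exact: measurable_half_line.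
apply: ae_le_of_pairing => //.
- have [+ _] := pairing_integrable gb (test_fun_L1w measurableT).
  move=> /(integrableS mH mD DH); apply: eq_integrable => // x.
  by rewrite inE complex_ReM/= indicT mul1r mulr0 subr0.
- have [_] := pairing_integrable gb (test_fun_L1w measurableT).
  move=> /(integrableS mH mD DH); apply: eq_integrable => // x.
  by rewrite inE complex_ImM/= indicT mul1r mulr0 add0r.
Qed.

End dual_of_L1.

(** * The dual algebra of L_0^oo(w) *)

Section real_norm.
Context {R : realType}.
Implicit Types (V W : normedModType R[i]).

Definition rnorm V (x : V) : R := complex.Re `|x|.

Lemma rnormE V (x : V) : `|x| = (rnorm x)%:C.
Proof.
rewrite /rnorm; have : 0 <= `|x| by [].
by case: `|x| => a b; rewrite lecE/= => /andP[/eqP -> _].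
Qed.

Lemma rnorm_ge0 V (x : V) : 0 <= rnorm x.
Proof. rewrite -lecR -rnormE; exact: normr_ge0. Qed.

Lemma rnorm_le V (x : V) (c : R) : (rnorm x <= c) = (`|x| <= c%:C).
Proof. by rewrite rnormE lecR. Qed.

Lemma rnormD V (x y : V) : rnorm (x + y) <= rnorm x + rnorm y.
Proof. by rewrite -lecR rmorphD/= -!rnormE ler_normD. Qed.

Lemma rnormZ V a (x : V) : rnorm (a *: x) = normc a * rnorm x.
Proof.
have : (rnorm (a *: x))%:C = (normc a * rnorm x)%:C.
  by rewrite [RHS]rmorphM -rnormE normrZ normr_normc (rnormE x).
by case.
Qed.

Lemma rnorm0 V : rnorm (0 : V) = 0.
Proof. by rewrite /rnorm normr0. Qed.

Lemma rnormN V (x : V) : rnorm (- x) = rnorm x.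
Proof. by rewrite /rnorm normrN. Qed.

Lemma rnormB V (x y : V) : rnorm (x - y) <= rnorm x + rnorm y.
Proof. by rewrite -(rnormN y) rnormD. Qed.

Lemma rnorm_eq0 V (x : V) : rnorm x = 0 -> x = 0.
Proof. by move=> x0; apply: normr0_eq0; rewrite rnormE x0. Qed.

Lemma bounded_continuous V W (f : V -> W) (M : R) : linear f ->
  (forall x, rnorm (f x) <= M * rnorm x) -> continuous f.
Proof.
move=> lf fM x; apply/cvgrPdist_le => e e0.
have e0' : 0 < complex.Re e by move: e0; rewrite ltcE/= => /andP[].
have eE : e = (complex.Re e)%:C.
  by move: e0; rewrite ltcE/=; case: (e) => a b /= /andP[/eqP ->].
have M0 : 0 < `|M| + 1 by rewrite ltr_wpDl.
have d0 : 0 < (complex.Re e / (`|M| + 1))%:C by rewrite ltcR divr_gt0.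
near=> y.
have xy : `|x - y| <= (complex.Re e / (`|M| + 1))%:C.
  by near: y; apply: cvgr_dist_le => //; exact: cvg_id.
have -> : f x - f y = f (x - y).
  by rewrite addrC -scaleN1r -lf scaleN1r addrC.
rewrite eE -rnorm_le (le_trans (fM _))//.
move: xy; rewrite -rnorm_le ler_pdivlMr// mulrC; apply: le_trans.
rewrite ler_wpM2r ?rnorm_ge0// (le_trans (ler_norm M))//.
by rewrite lerDl.
Unshelve. all: by end_near. Qed.

End real_norm.

Section classes.
Context {R : realType} (w : weight R).
Local Notation mu := (@lebesgue_measure R).
Local Notation H := (`[0%R : R, +oo[%classic).
Implicit Types (f g : L0 w) (phi psi : R -> R[i]) (n m : dualL0 w).

Lemma wess_sup_le D (mD : measurable D) (h : R -> R[i]) (c : R) : D `<=` H ->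
  (wess_sup w mD h <= c%:E)%E <->
  \forall x \ae mu, D x -> normc (h x) <= c * w x.
Proof.
move=> DH; split.
- move=> /ess_supP/mrestr_ae; apply: ae_imp => x hx Dx.
  have /half_lineP x0 := DH x Dx.
  by have := hx Dx; rewrite lee_fin ler_pdivrMr// weight_gt0.
- move=> hc; apply/ess_supP/mrestr_ae; apply: ae_imp hc => x hx Dx.
  have /half_lineP x0 := DH x Dx.
  by rewrite lee_fin ler_pdivrMr ?hx// weight_gt0.
Qed.

Lemma L0_predI (h : R -> R[i]) (c : R) : wbounded w c h ->
  (forall e : R, 0 < e -> exists2 t : R, 0 <= t &
    \forall x \ae mu, t < x -> normc (h x) <= e * w x) ->
  h \in L0_pred w.
Proof.
move=> [mh hc] he; apply/L0_predP; split => //.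
- apply: (@le_lt_trans _ _ c%:E); last exact: ltry.
  exact/wess_sup_le.
- apply/fine_cvgP; split.
    near=> x; have x0 : 0 <= x by near: x; exact: nbhs_pinfty_ge.
    have xH := sub_tail x0.
    rewrite ge0_fin_numE; last by apply: wess_sup_ge0 => //; exact: lebesgue_measure_tail.
    apply: (@le_lt_trans _ _ c%:E); last exact: ltry.
    by apply/wess_sup_le => //; apply: ae_imp hc => y hy xy; apply: hy; exact: xH.
  apply/cvgrPdist_le => e e0; have [t t0 ht] := he e e0.
  near=> x; have tx : t <= x by near: x; apply: nbhs_pinfty_ge; exact: num_real.
  have x0 : 0 <= x by exact: le_trans tx.
  have xH := sub_tail x0.
  have l : (wess_sup w (measurable_itv `]x, +oo[) h <= e%:E)%E.
    apply/wess_sup_le => //; apply: ae_imp ht => y hy /=; rewrite in_itv/= andbT => xy.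
    by apply: hy; exact: le_lt_trans xy.
  have g : (0 <= wess_sup w (measurable_itv `]x, +oo[) h)%E.
    by apply: wess_sup_ge0 => //; exact: lebesgue_measure_tail.
  rewrite sub0r normrN /comp ger0_norm ?fine_ge0//.
  by rewrite -lee_fin fineK// ge0_fin_numE// (le_lt_trans l)// ltry.
Unshelve. all: by end_near. Qed.

Lemma L0_tail (h : L0_fun w) (e : R) : 0 < e -> exists2 t : R, 0 <= t &
  \forall x \ae mu, t < x -> normc (h x) <= e * w x.
Proof.
move=> e0; have /L0_predP[_ _ /fine_cvgP[fin]] := L0_valP h.
move=> /cvgrPdist_le/(_ e e0) c.
have := filterI fin (filterI c (nbhs_pinfty_ge (num_real (0 : R)))).
case=> t0 [_ /(_ (t0 + 1))]; rewrite ltrDl ltr01 => /(_ isT)[tf [tc t10]].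
exists (t0 + 1) => //; have tH := sub_tail t10.
have := (@wess_sup_le _ (measurable_itv `]t0 + 1, +oo[) h e tH).1.
move=> /(_ _)/ae_imp; apply; last first.
  rewrite -[X in (X <= _)%E]fineK// lee_fin.
  by move: tc; rewrite /comp sub0r normrN => /(le_trans (ler_norm _)).
by move=> x hx tx; apply: hx; rewrite /= in_itv/= tx.
Qed.

Lemma rnorm_class (h : L0_fun w) :
  rnorm (L0_class h) = fine (wess_sup w (measurable_itv `[0%R, +oo[) h).
Proof. by rewrite /rnorm -[`|_|]/(L0_norm _) L0_normE. Qed.

Lemma wbounded_L0_fun (h : L0_fun w) : wbounded w (rnorm (L0_class h)) h.
Proof.
have /L0_predP[mh _ _] := L0_valP h; split => //.
by apply/(wess_sup_le (measurable_itv _)) => //; rewrite rnorm_class fineK// L0_fun_wess_sup.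
Qed.

Lemma wbounded_repr_class f : wbounded w (rnorm f) (L0_repr f).
Proof. by rewrite -{1}[f]L0_reprK; exact: wbounded_L0_fun. Qed.

Lemma rnorm_class_le (h : L0_fun w) (c : R) : wbounded w c h ->
  rnorm (L0_class h) <= c.
Proof.
move=> [_ hc]; rewrite rnorm_class -lee_fin fineK ?L0_fun_wess_sup//.
exact/wess_sup_le.
Qed.

Lemma repr_class (h : L0_fun w) :
  \forall x \ae mu, H x -> L0_repr (L0_class h) x = h x.
Proof. exact/L0_classP/L0_reprK. Qed.

Lemma L0_eqP f g : f = g <-> \forall x \ae mu, H x -> L0_repr f x = L0_repr g x.
Proof.
split=> [->|h]; first exact: ae_forallT.
by rewrite -[f]L0_reprK -[g]L0_reprK; apply/L0_classP.
Qed.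

Lemma repr_comb a f g : \forall x \ae mu, H x ->
  L0_repr (a *: f + g) x = a * L0_repr f x + L0_repr g x.
Proof.
have -> : a *: f + g = L0_class (a *: L0_repr f + L0_repr g).
  by rewrite L0_classD L0_classZ !L0_reprK.
by apply: ae_imp (repr_class (a *: L0_repr f + L0_repr g)) => x h /h ->.
Qed.

Lemma L0_measurable f : cmeasurable H (L0_repr f).
Proof. by have [] := wbounded_repr_class f. Qed.

Definition L0_pairing f phi := pairing (L0_repr f) phi.

Lemma L0_pairing_comb a f g phi : L1w w phi ->
  L0_pairing (a *: f + g) phi = a * L0_pairing f phi + L0_pairing g phi.
Proof.
move=> hphi; have bf := wbounded_repr_class f; have bg := wbounded_repr_class g.
rewrite -(pairing_combl a bf bg hphi); apply: pairing_ae_eq.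
- exact: L0_measurable.
- apply: cmeasurableD => //; last exact: L0_measurable.
  by apply: cmeasurableM => //; exact: L0_measurable.
- exact: (@L1w_measurable _ w).
- exact: (@L1w_measurable _ w).
- exact: repr_comb.
- exact: ae_forallT.
Qed.

Lemma L0_pairing_combr f a phi psi : L1w w phi -> L1w w psi ->
  L0_pairing f (fun x => a * phi x + psi x) =
  a * L0_pairing f phi + L0_pairing f psi.
Proof.
move=> hphi hpsi; have bf := wbounded_repr_class f.
by rewrite /L0_pairing (pairingDr bf) ?(pairingZr _ bf)//; exact: L1wZ.
Qed.

Lemma L0_pairing_le f phi : L1w w phi ->
  normc (L0_pairing f phi) <= 2 * (rnorm f * L1norm w phi).
Proof. by move=> hphi; exact: normc_pairing_le (wbounded_repr_class f) hphi. Qed.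

Lemma rnorm_le_pairing f (K : R) : 0 <= K ->
  (forall phi, L1w w phi -> normc (L0_pairing f phi) <= K * L1norm w phi) ->
  rnorm f <= 2 * K.
Proof.
move=> K0 fK; rewrite -[f]L0_reprK; apply: rnorm_class_le; split.
  exact: L0_measurable.
apply: pairing_le_ae => //; first exact: wbounded_repr_class.
by move=> E _ mE; apply: fK; exact: test_fun_L1w.
Qed.

Lemma L0_pairing_inj f g :
  (forall phi, L1w w phi -> L0_pairing f phi = L0_pairing g phi) -> f = g.
Proof.
move=> fg; apply/eqP; rewrite -subr_eq0; apply/eqP/rnorm_eq0/eqP.
rewrite eq_le rnorm_ge0 andbT -[leRHS](mulr0 2); apply: rnorm_le_pairing => // phi hphi.
by rewrite addrC -scaleN1r L0_pairing_comb// fg// mulN1r addNr normc0 mul0r.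
Qed.

Lemma cconv_L0 (h : L0_fun w) phi : L1w w phi -> cconv h phi \in L0_pred w.
Proof.
move=> hphi; have hb := wbounded_L0_fun h; have [mh _] := hb.
apply: (L0_predI (wbounded_cconv (rnorm_ge0 _) hb hphi)) => e e0.
have N0 : 0 < 2 * (L1norm w phi + 1) by rewrite mulr_gt0// ltr_wpDl// L1norm_ge0.
have [t t0 ht] := L0_tail h (divr_gt0 e0 N0).
exists t => //; apply: ae_forallT => x tx; have x0 : 0 <= x by exact/ltW/(le_lt_trans t0).
have := normc_cconv_le x0 (ltW (divr_gt0 e0 N0)) mh _ hphi.
move=> /(_ _)/le_trans; apply.
  by apply: ae_imp ht => y hy xy; apply: hy; exact: lt_le_trans xy.
rewrite ler_wpM2r ?weight_ge0// -mulrA mulrCA -[leRHS]mulr1 -mulrA ler_pM2l//.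
by rewrite ler_pdivrMl// mulr1 ler_pM2l// lerDl.
Qed.

Lemma repr_conv f phi : L1w w phi -> \forall x \ae mu, H x ->
  L0_repr (L0_conv f phi) x = cconv (L0_repr f) phi x.
Proof.
move=> hphi; rewrite /L0_conv.
have : (cconv (L0_repr f) phi) \in L0_pred w by exact: cconv_L0.
move=> h; have e : L0_val (insubd (0 : L0_fun w) (cconv (L0_repr f) phi)) =
    cconv (L0_repr f) phi by exact: (@insubdK _ _ _ (0 : L0_fun w)).
apply: ae_imp (repr_class (insubd (0 : L0_fun w) (cconv (L0_repr f) phi))) => x hx Hx.
by rewrite -[in RHS]e; exact: hx.
Qed.

Lemma L0_conv_le f phi (c : R) : 0 <= c -> L1w w phi ->
  wbounded w c (L0_repr f) -> rnorm (L0_conv f phi) <= 2 * c * L1norm w phi.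
Proof.
move=> c0 hphi fc; rewrite -[L0_conv f phi]L0_reprK; apply: rnorm_class_le.
split; first exact: L0_measurable.
have [_ hc] := wbounded_cconv c0 fc hphi.
by apply: ae_imp2 (repr_conv f hphi) hc => x e h Hx; rewrite e// h.
Qed.

Lemma rnorm_conv f phi : L1w w phi ->
  rnorm (L0_conv f phi) <= 2 * rnorm f * L1norm w phi.
Proof.
move=> hphi; apply: L0_conv_le => //; first exact: rnorm_ge0.
exact: wbounded_repr_class.
Qed.

Lemma L0_conv_comb a f g phi : L1w w phi ->
  L0_conv (a *: f + g) phi = a *: L0_conv f phi + L0_conv g phi.
Proof.
move=> hphi; have mphi := L1w_measurable hphi; apply/L0_eqP.
have h1 := repr_conv (a *: f + g) hphi.
have h2 := repr_comb a (L0_conv f phi) (L0_conv g phi).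
have h3 := ae_imp2 (fun x h h' => conj h h') (repr_conv f hphi) (repr_conv g hphi).
apply: ae_imp2 (ae_imp2 (fun x h h' => conj h h') h1 h2) h3 => x [e1 e2] [e3 e4] Hx.
have /half_lineP x0 := Hx; apply: (etrans (e1 Hx)); apply: esym.
apply: (etrans (e2 Hx)); apply: (etrans (congr2 (fun u v => a * u + v) (e3 Hx) (e4 Hx))).
have bf := wbounded_translate x0 (rnorm_ge0 f) (wbounded_repr_class f).
have bg := wbounded_translate x0 (rnorm_ge0 g) (wbounded_repr_class g).
rewrite /cconv -(pairing_combl a bf bg hphi); apply: esym.
have mf := L0_measurable f; have mg := L0_measurable g.
apply: (@cconv_ae_eq _ _ (fun x => a * L0_repr f x + L0_repr g x)) => //.
- exact: L0_measurable.
- apply: cmeasurableD => //; exact: cmeasurableM.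
- exact: repr_comb.
- exact: ae_forallT.
Qed.

Lemma L0_conv_combr f a phi psi : L1w w phi -> L1w w psi ->
  L0_conv f (fun x => a * phi x + psi x) = a *: L0_conv f phi + L0_conv f psi.
Proof.
move=> hphi hpsi; apply/L0_eqP.
have h12 : L1w w (fun x => a * phi x + psi x) by apply: L1wD => //; exact: L1wZ.
have h1 := repr_conv f h12.
have h2 := repr_comb a (L0_conv f phi) (L0_conv f psi).
have h3 := ae_imp2 (fun x h h' => conj h h') (repr_conv f hphi) (repr_conv f hpsi).
apply: ae_imp2 (ae_imp2 (fun x h h' => conj h h') h1 h2) h3 => x [e1 e2] [e3 e4] Hx.
have /half_lineP x0 := Hx; apply: (etrans (e1 Hx)); apply: esym.
apply: (etrans (e2 Hx)); apply: (etrans (congr2 (fun u v => a * u + v) (e3 Hx) (e4 Hx))).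
have bf := wbounded_translate x0 (rnorm_ge0 f) (wbounded_repr_class f).
by apply: esym; rewrite /cconv (pairingDr bf) ?(pairingZr _ bf)//; exact: L1wZ.
Qed.

Lemma L0_pairing_conv f phi psi : L1w w phi -> L1w w psi ->
  L0_pairing (L0_conv f phi) psi = L0_pairing f (star phi psi).
Proof.
move=> hphi hpsi; rewrite /L0_pairing.
rewrite -(pairing_cconv hphi hpsi (rnorm_ge0 f) (wbounded_repr_class f)).
apply: pairing_ae_eq; try exact: (@L1w_measurable _ w); try exact: L0_measurable.
- apply: cmeasurable_cconv; first exact: L0_measurable.
  exact: (@L1w_measurable _ w).
- exact: repr_conv.
- exact: ae_forallT.
Qed.

Lemma L0_conv_conv f phi psi : L1w w phi -> L1w w psi ->
  L0_conv (L0_conv f phi) psi = L0_conv f (star phi psi).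
Proof.
move=> hphi hpsi; have hs := star_L1w hphi hpsi; apply/L0_eqP.
apply: ae_imp2 (repr_conv (L0_conv f phi) hpsi) (repr_conv f hs) => x e1 e2 Hx.
have /half_lineP x0 := Hx; apply: (etrans (e1 Hx)); apply: esym; apply: (etrans (e2 Hx)).
rewrite -(cconv_star hphi hpsi x0 (rnorm_ge0 f) (wbounded_repr_class f)).
apply: esym; apply: cconv_ae_eq => //.
- exact: L0_measurable.
- by apply: cmeasurable_cconv; [exact: L0_measurable|exact: (@L1w_measurable _ w)].
- exact: (@L1w_measurable _ w).
- exact: (@L1w_measurable _ w).
- exact: repr_conv.
- exact: ae_forallT.
Qed.

Lemma normc_dual_le n f : normc (n f) <= rnorm n * rnorm f.
Proof.
have [->|f0] := eqVneq f 0; first by rewrite dual0 normc0 rnorm0 mulr0.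
have nf : 0 < rnorm f.
  by rewrite lt_neqAle rnorm_ge0 andbT eq_sym; apply: contra_neq f0 => /rnorm_eq0.
have : normc (n ((rnorm f)^-1%:C *: f)) <= rnorm n.
  apply: (le_trans (dual_norm_ub n _)) => //.
  by rewrite -[1]/(1%:C) -rnorm_le rnormZ normc_real gtr0_norm ?invr_gt0// mulVf// gt_eqF.
by rewrite dualZ normcM normc_real gtr0_norm ?invr_gt0// mulrC ler_pdivrMr.
Qed.

Lemma rnorm_dual_le n (M : R) : 0 <= M ->
  (forall f, normc (n f) <= M * rnorm f) -> rnorm n <= M.
Proof.
move=> M0 nM; rewrite rnorm_le; apply: dual_norm_le => f f1.
rewrite (le_trans (nM f))// ler_piMr//.
by rewrite rnorm_le.
Qed.

Lemma dual_predI (F : L0 w -> R[i]) (M : R) :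
  (forall a f g, F (a *: f + g) = a * F f + F g) ->
  (forall f, normc (F f) <= M * rnorm f) -> F \in @dual_pred _ w.
Proof.
move=> lF bF; apply/asboolP; split; first exact: lF.
exact: (@bounded_continuous _ _ R[i]^o _ M).
Qed.

Lemma L0_act_exists n f : exists g, forall phi, L1w w phi ->
  L0_pairing g phi = n (L0_conv f phi).
Proof.
have LK : L1_functional w (fun phi => n (L0_conv f phi)) (rnorm n * (2 * rnorm f)).
  split=> [a phi psi hphi hpsi|phi hphi].
    by rewrite L0_conv_combr// dual_linear.
  rewrite (le_trans (normc_dual_le _ _))// -mulrA ler_wpM2l ?rnorm_ge0//.
  exact: rnorm_conv.
have [g [gb gE gD]] := L1_dual LK.
have gL0 : g \in L0_pred w.
  apply: (L0_predI gb) => e e0.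
  have N0 : 0 < 4 * (rnorm n + 1) by rewrite mulr_gt0// ltr_wpDl// rnorm_ge0.
  have [t t0 ht] := L0_tail (L0_repr f) (divr_gt0 e0 N0).
  exists t => //; set c := e / _ in ht; have c0 : 0 <= c by rewrite ltW// divr_gt0.
  pose D : set (measurableTypeR R) := `]t, +oo[%classic.
  have mD : measurable D by exact: measurable_itv.
  have DH : D `<=` H by exact: sub_tail.
  pose f' x := (\1_D x)%:C * L0_repr f x.
  have fb' : wbounded w c f'.
    split; first by apply: cmeasurableM => //; [exact: cmeasurable_real|exact: L0_measurable].
    apply: ae_imp ht => x hx /half_lineP x0; rewrite /f' indicE; case: (boolP (x \in D)).
      by rewrite inE /D/= in_itv/= andbT mul1r => /hx.
    by rewrite mul0r normc0 mulr_ge0// weight_ge0.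
  have fE E : E `<=` D -> measurable E -> rnorm (L0_conv f (test_fun w E)) <=
      2 * c * L1norm w (test_fun w E).
    move=> ED mE; have hE := test_fun_L1w w mE.
    rewrite -[L0_conv _ _]L0_reprK; apply: rnorm_class_le.
    split; first exact: L0_measurable.
    have [_ hc] := wbounded_cconv c0 fb' hE.
    apply: ae_imp2 (repr_conv f hE) hc => x e1 e2 Hx; rewrite e1//.
    move/half_lineP: (Hx) => x0; rewrite (le_trans _ (e2 Hx))//.
    rewrite (_ : cconv (L0_repr f) (test_fun w E) x = cconv f' (test_fun w E) x)//.
    apply: eq_cintegral => y y0; rewrite /f' /test_fun !indicE.
    case: (boolP (y \in E)) => yE; last by rewrite mul0r !mulr0.
    rewrite [x + y \in D]mem_set ?mul1r//.
    have : D y by apply: ED; rewrite -inE.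
    rewrite /D/= !in_itv/= !andbT => ty; rewrite (lt_le_trans ty)//.
    by rewrite lerDr.
  have := gD D (rnorm n * (2 * c)) mD DH.
  move=> /(_ _)/ae_imp; apply.
    move=> x hx tx; have : D x by rewrite /D/= in_itv/= tx.
    move=> /hx/le_trans; apply; rewrite ler_wpM2r//.
      by rewrite weight_ge0// ltW// (le_lt_trans t0).
    have -> : 2 * (rnorm n * (2 * c)) = (4 * (rnorm n + 1))^-1 * (4 * rnorm n) * e.
      by rewrite /c; ring.
    rewrite -[leRHS]mul1r ler_pM2r// ler_pdivrMl// mulr1 ler_pM2l//.
    by rewrite lerDl.
  move=> E ED mE; rewrite (le_trans (normc_dual_le _ _))// -mulrA ler_wpM2l ?rnorm_ge0//.
  exact: fE.
exists (L0_class (MkL0Fun gL0)) => phi hphi; rewrite -gE//.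
apply: pairing_ae_eq; try exact: (@L1w_measurable _ w); try exact: L0_measurable.
- by case: gb.
- exact: repr_class.
- exact: ae_forallT.
Qed.

Lemma L0_actP n f phi : L1w w phi -> L0_pairing (L0_act n f) phi = n (L0_conv f phi).
Proof.
move=> hphi; have [g hg] := L0_act_exists n f.
have := @xgetPex _ (0 : L0 w) [set g | forall phi, L1w w phi ->
    cintegral (fun x => L0_repr g x * phi x) = n (L0_conv f phi)].
by move=> /(_ (ex_intro _ g hg)) /(_ phi hphi).
Qed.

(* Otherwise unification unfolds these into representatives of classes. *)
#[local] Opaque L0_conv L0_act L0_pairing.

Lemma rnorm_act n f : rnorm (L0_act n f) <= 4 * rnorm n * rnorm f.
Proof.
have -> : 4 * rnorm n * rnorm f = 2 * (rnorm n * (2 * rnorm f)) by ring.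
apply: rnorm_le_pairing => [|phi hphi]; first by rewrite !mulr_ge0// rnorm_ge0.
rewrite L0_actP// (le_trans (normc_dual_le _ _))// -mulrA ler_wpM2l ?rnorm_ge0//.
exact: rnorm_conv.
Qed.

Lemma L0_act_comb n a f g : L0_act n (a *: f + g) = a *: L0_act n f + L0_act n g.
Proof.
apply: L0_pairing_inj => phi hphi.
apply: (etrans (L0_actP n (a *: f + g) hphi)); apply: esym.
apply: (etrans (L0_pairing_comb a (L0_act n f) (L0_act n g) hphi)).
apply: (etrans (congr2 (fun u v => a * u + v) (L0_actP n f hphi) (L0_actP n g hphi))).
apply: (etrans (esym (dual_linear n a (L0_conv f phi) (L0_conv g phi)))).
exact: (congr1 (dual_fun n) (esym (L0_conv_comb a f g hphi))).
Qed.

Lemma L0_act_combl a m n f : L0_act (a *: m + n) f = a *: L0_act m f + L0_act n f.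
Proof.
apply: L0_pairing_inj => phi hphi.
by rewrite [RHS]L0_pairing_comb// !L0_actP.
Qed.

Lemma L0_act_conv n f phi : L1w w phi ->
  L0_conv (L0_act n f) phi = L0_act n (L0_conv f phi).
Proof.
move=> hphi; apply: L0_pairing_inj => psi hpsi.
apply: (etrans (L0_pairing_conv (L0_act n f) hphi hpsi)).
apply: (etrans (L0_actP n f (star_L1w hphi hpsi))); apply: esym.
apply: (etrans (L0_actP n (L0_conv f phi) hpsi)).
exact: (congr1 (dual_fun n) (L0_conv_conv f hphi hpsi)).
Qed.

Lemma arensE m n f : arens m n f = m (L0_act n f).
Proof.
have h : (fun f => m (L0_act n f)) \in @dual_pred _ w.
  apply: (@dual_predI _ (rnorm m * (4 * rnorm n))) => [a f1 f2|f1].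
    by rewrite (L0_act_comb n a f1 f2) dual_linear.
  rewrite (le_trans (normc_dual_le _ _))// -[leRHS]mulrA ler_wpM2l ?rnorm_ge0//.
  exact: rnorm_act.
have e : dual_fun (arens m n) = fun f => m (L0_act n f).
  exact: (@insubdK _ _ _ (0 : dualL0 w)).
by rewrite e.
Qed.

Lemma dual_combE a m n f : (a *: m + n) f = a * m f + n f.
Proof. by []. Qed.

Lemma arens_combr a m n p : arens p (a *: m + n) = a *: arens p m + arens p n.
Proof.
apply/dual_eqP => f; apply: (etrans (arensE _ _ f)); apply: esym.
apply: (etrans (dual_combE a (arens p m) (arens p n) f)).
apply: (etrans (congr2 (fun u v => a * u + v) (arensE p m f) (arensE p n f))).
apply: (etrans (esym (dual_linear p a (L0_act m f) (L0_act n f)))).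
exact: (congr1 (dual_fun p) (esym (L0_act_combl a m n f))).
Qed.

Lemma rnorm_arens m n : rnorm (arens m n) <= 4 * rnorm m * rnorm n.
Proof.
apply: rnorm_dual_le => [|f]; first by rewrite !mulr_ge0// rnorm_ge0.
rewrite arensE (le_trans (normc_dual_le _ _))//.
have -> : 4 * rnorm m * rnorm n * rnorm f = rnorm m * (4 * rnorm n * rnorm f) by ring.
by rewrite ler_wpM2l ?rnorm_ge0// rnorm_act.
Qed.

Lemma L0_act_arens m n f : L0_act (arens m n) f = L0_act m (L0_act n f).
Proof.
apply: L0_pairing_inj => phi hphi.
apply: (etrans (L0_actP (arens m n) f hphi)).
apply: (etrans (arensE m n (L0_conv f phi))); apply: esym.
apply: (etrans (L0_actP m (L0_act n f) hphi)).
exact: (congr1 (dual_fun m) (L0_act_conv n f hphi)).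
Qed.

Lemma arensA m n p : arens (arens m n) p = arens m (arens n p).
Proof.
apply/dual_eqP => f; apply: (etrans (arensE (arens m n) p f)).
apply: (etrans (arensE m n (L0_act p f))); apply: esym.
apply: (etrans (arensE m (arens n p) f)).
exact: (congr1 (dual_fun m) (L0_act_arens n p f)).
Qed.

Lemma dual_separates f g : (forall n, n f = n g) -> f = g.
Proof.
move=> fg; apply: L0_pairing_inj => phi hphi.
have h : (fun f => L0_pairing f phi) \in @dual_pred _ w.
  apply: (@dual_predI _ (2 * L1norm w phi)) => [a f1 f2|f1].
    exact: L0_pairing_comb.
  by rewrite -mulrA [L1norm _ _ * _]mulrC; exact: L0_pairing_le.
exact: (fg (MkDualL0 h)).
Qed.

End classes.

Section shift.
Context {R : realType} (w : weight R) (s : R).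
Hypothesis s0 : 0 <= s.
Local Notation mu := (@lebesgue_measure R).
Local Notation H := (`[0%R : R, +oo[%classic).
Implicit Types (f g : L0 w) (phi psi : R -> R[i]) (n m : dualL0 w).

Lemma shift_L0 (h : L0_fun w) : (fun x => h (s + x)) \in L0_pred w.
Proof.
have hb := wbounded_L0_fun h; have ws := weight_gt0 w s0.
apply: (L0_predI (wbounded_translate s0 (rnorm_ge0 _) hb)) => e e0.
have [t t0 ht] := L0_tail h (divr_gt0 e0 ws).
exists t => //; apply: ae_imp (ae_shift s ht) => x hx tx.
have x0 : 0 <= x by exact/ltW/(le_lt_trans t0).
have := hx (lt_le_trans tx _); rewrite lerDr => /(_ s0)/le_trans; apply.
rewrite -mulrA ler_wpM2l ?(ltW e0)// mulrC ler_pdivrMr// mulrC.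
exact: weight_submul.
Qed.

Definition L0_shift f : L0 w := L0_class (MkL0Fun (shift_L0 (L0_repr f))).

Lemma repr_shift f : \forall x \ae mu, H x ->
  L0_repr (L0_shift f) x = L0_repr f (s + x).
Proof. exact: (repr_class (MkL0Fun (shift_L0 (L0_repr f)))). Qed.

Lemma half_shift (x : R) : H x -> H (s + x).
Proof. by move=> /half_lineP x0; apply/half_lineP; rewrite addr_ge0. Qed.

Lemma L0_shift_comb a f g : L0_shift (a *: f + g) = a *: L0_shift f + L0_shift g.
Proof.
apply/L0_eqP.
have h1 := repr_shift (a *: f + g).
have h2 := repr_comb a (L0_shift f) (L0_shift g).
have h3 := ae_imp2 (fun x h h' => conj h h') (repr_shift f) (repr_shift g).
have h4 := ae_shift s (repr_comb a f g).
apply: ae_imp2 (ae_imp2 (fun x h h' => conj h h') h1 h2)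
  (ae_imp2 (fun x h h' => conj h h') h3 h4) => x [e1 e2] [[e3 e4] e5] Hx.
apply: (etrans (e1 Hx)); apply: (etrans (e5 (half_shift Hx))); apply: esym.
apply: (etrans (e2 Hx)).
exact: (congr2 (fun u v => a * u + v) (e3 Hx) (e4 Hx)).
Qed.

Lemma rnorm_shift f : rnorm (L0_shift f) <= w s * rnorm f.
Proof.
rewrite mulrC; apply: rnorm_class_le.
exact: (wbounded_translate s0 (rnorm_ge0 _) (wbounded_repr_class f)).
Qed.

Lemma L0_conv_shift f phi : L1w w phi ->
  L0_conv (L0_shift f) phi = L0_shift (L0_conv f phi).
Proof.
move=> hphi; apply/L0_eqP.
have h1 := repr_conv (L0_shift f) hphi.
have h2 := repr_shift (L0_conv f phi).
have h3 := ae_shift s (repr_conv f hphi).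
apply: ae_imp2 (ae_imp2 (fun x h h' => conj h h') h1 h2) h3 => x [e1 e2] e3 Hx.
have /half_lineP x0 := Hx.
apply: (etrans (e1 Hx)); apply: esym; apply: (etrans (e2 Hx)).
apply: (etrans (e3 (half_shift Hx))); apply: esym.
have mphi := L1w_measurable hphi.
transitivity (cconv (fun y => L0_repr f (s + y)) phi x).
  apply: cconv_ae_eq => //; [exact: L0_measurable| |exact: repr_shift|exact: ae_forallT].
  by apply: cmeasurable_shift => //; exact: L0_measurable.
by rewrite /cconv; congr (pairing _ phi); apply/funext => y; rewrite addrA.
Qed.

Definition translate phi (x : R) := zext phi (x - s).

Lemma cmeasurable_translate phi : cmeasurable H phi -> cmeasurable H (translate phi).
Proof.
move=> /cmeasurable_zext[p1 p2].
have ms : measurable_fun [set: R] (fun x => x - s) by exact: measurable_funB.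
split; apply: (measurable_funS measurableT) => //.
- exact: measurableT_comp p1 ms.
- exact: measurableT_comp p2 ms.
Qed.

Lemma translate_L1w phi : L1w w phi -> L1w w (translate phi).
Proof.
move=> hphi; have mphi := L1w_measurable hphi.
have mr := cmeasurable_translate mphi; split => //.
pose k := (fun x => w x * normc (translate phi x)) \_ H.
have mk : measurable_fun setT (fun x => (k x)%:E).
  apply/measurable_EFinP; apply/(measurable_restrictT _ _).1 => //.
  exact: measurable_wnormc.
rewrite integral_mkcond [X in (X < _)%E](_ : _ = \int[mu]_x (k x)%:E)%E; last first.
  by apply: eq_integral => x _; rewrite /k !patchE; case: ifP.
rewrite -(integral_shift s mk).
have /integrableP[mi] := integrableZ_half (w s) (L1w_integrable hphi).
apply: le_lt_trans; rewrite [leRHS]integral_mkcond.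
have xsx (x : R) : s + x - s = x by rewrite addrC addKr.
apply: ge0_le_integral => //.
- move=> x _; rewrite lee_fin /k patchE; case: ifPn => //.
  by rewrite inE => /half_lineP x0; rewrite mulr_ge0 ?weight_ge0 ?normc_ge0.
- exact: (measurableT_comp mk (measurable_shift s)).
- apply/(measurable_restrictT _ _).1 => //; exact: measurableT_comp mi.
- move=> x _; rewrite /k [X in (X%:E <= _)%E]patchE /translate xsx.
  have [x0|x0] := boolP (0 <= x).
    rewrite patchE !mem_set; [|exact/half_lineP|by apply: half_shift; exact/half_lineP].
    rewrite zext_ge0// abse_EFin lee_fin ger0_norm; last first.
      by rewrite !mulr_ge0 ?weight_ge0 ?normc_ge0.
    by rewrite mulrA ler_wpM2r ?normc_ge0// weight_submul.
  rewrite zext_lt0// normc0 mulr0 if_same patchE.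
  by case: ifP => _; [exact: abse_ge0|exact: lexx].
Qed.

Lemma pairing_translate (h : R -> R[i]) phi : cmeasurable H h -> cmeasurable H phi ->
  pairing h (translate phi) = pairing (fun x => h (s + x)) phi.
Proof.
move=> mh mphi.
have xsx (x : R) : s + x - s = x by rewrite addrC addKr.
have mK : cmeasurable setT (zext (fun x => h x * translate phi x)).
  by apply: cmeasurable_zext; apply: cmeasurableM => //; exact: cmeasurable_translate.
have e x : zext (fun x => h x * translate phi x) (s + x) =
    zext (fun x => h (s + x) * phi x) x.
  have [x0|x0] := boolP (0 <= x).
    by rewrite !zext_ge0 ?addr_ge0// /translate xsx zext_ge0.
  rewrite [RHS]zext_lt0//; have [y0|y0] := boolP (0 <= s + x).
    by rewrite zext_ge0// /translate xsx zext_lt0// mulr0.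
  by rewrite zext_lt0.
case: mK => m1 m2; rewrite /pairing; apply: eq_complexP.
- rewrite [LHS]Re_cintegral_zext [RHS]Re_cintegral_zext /Rintegral; congr fine.
  rewrite -(@integral_shift _ s (fun x => (complex.Re (zext (fun x => h x * translate phi x) x))%:E));
    last exact/measurable_EFinP.
  by apply: eq_integral => x _; rewrite e.
- rewrite [LHS]Im_cintegral_zext [RHS]Im_cintegral_zext /Rintegral; congr fine.
  rewrite -(@integral_shift _ s (fun x => (complex.Im (zext (fun x => h x * translate phi x) x))%:E));
    last exact/measurable_EFinP.
  by apply: eq_integral => x _; rewrite e.
Qed.

Lemma L0_pairing_translate f phi : L1w w phi ->
  L0_pairing f (translate phi) = L0_pairing (L0_shift f) phi.
Proof.
move=> hphi; have mphi := L1w_measurable hphi; have mf := L0_measurable f.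
rewrite /L0_pairing pairing_translate//; apply: pairing_ae_eq => //.
- exact: cmeasurable_shift.
- exact: L0_measurable.
- by apply: ae_imp (repr_shift f) => x h /h ->.
- exact: ae_forallT.
Qed.

Lemma L0_conv_translate f phi : L1w w phi ->
  L0_conv f (translate phi) = L0_conv (L0_shift f) phi.
Proof.
move=> hphi; have mphi := L1w_measurable hphi; have mf := L0_measurable f.
apply/L0_eqP.
apply: ae_imp2 (repr_conv f (translate_L1w hphi)) (repr_conv (L0_shift f) hphi) => x e1 e2 Hx.
have /half_lineP x0 := Hx.
apply: (etrans (e1 Hx)); apply: esym; apply: (etrans (e2 Hx)); apply: esym.
rewrite {1}/cconv pairing_translate//; last exact: cmeasurable_shift.
transitivity (cconv (fun y => L0_repr f (s + y)) phi x).
  rewrite /cconv; congr (pairing _ phi); apply/funext => y.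
  by rewrite addrCA.
apply: cconv_ae_eq => //; [|exact: L0_measurable| |exact: ae_forallT].
- exact: cmeasurable_shift.
- by apply: ae_imp (repr_shift f) => y h /h ->.
Qed.

Lemma L0_act_shift n f : L0_act n (L0_shift f) = L0_shift (L0_act n f).
Proof.
apply: L0_pairing_inj => phi hphi.
apply: (etrans (L0_actP n (L0_shift f) hphi)).
apply: (etrans (congr1 (dual_fun n) (esym (L0_conv_translate f hphi)))).
apply: (etrans (esym (L0_actP n f (translate_L1w hphi)))).
exact: L0_pairing_translate.
Qed.

Section point_mass.
Variable u : dualL0 w.
Hypothesis u_id : forall m, arens m u = m.

Lemma right_id_act f : L0_act u f = f.
Proof. by apply: dual_separates => m; rewrite -arensE u_id. Qed.

Lemma right_id_conv f phi : L1w w phi -> u (L0_conv f phi) = L0_pairing f phi.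
Proof. by move=> hphi; rewrite -L0_actP// right_id_act. Qed.

Lemma shift_dual_pred : (fun f => u (L0_shift f)) \in @dual_pred _ w.
Proof.
apply: (@dual_predI _ _ _ (rnorm u * w s)) => [a f g|f].
  apply: (etrans (congr1 (dual_fun u) (L0_shift_comb a f g))).
  exact: dual_linear.
by rewrite (le_trans (normc_dual_le _ _))// -mulrA ler_wpM2l ?rnorm_ge0// rnorm_shift.
Qed.

(* Modulo the right annihilator this is the point mass at [s]. *)
Definition point_mass : dualL0 w := MkDualL0 shift_dual_pred.

Lemma arens_point_mass m f phi : L1w w phi ->
  arens point_mass m (L0_conv f phi) = m (L0_conv (L0_shift f) phi).
Proof.
move=> hphi; apply: (etrans (arensE _ _ _)).
apply: (etrans (congr1 (dual_fun u) (esym (L0_act_shift m (L0_conv f phi))))).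
apply: (etrans (congr1 (fun g => dual_fun u (L0_act m g)) (esym (L0_conv_shift f hphi)))).
apply: (etrans (congr1 (dual_fun u) (esym (L0_act_conv m (L0_shift f) hphi)))).
apply: (etrans (right_id_conv (L0_act m (L0_shift f)) hphi)).
exact: L0_actP.
Qed.

End point_mass.
End shift.

(** * Existence of a right identity *)

Section generalized_limit.
Context {R : realType}.

(* The limit along a free ultrafilter. *)
Lemma generalized_limit : exists LIM : (nat -> R[i]) -> R[i],
  [/\ forall a z z' (B : R), (forall k, normc (z k) <= B) ->
        (forall k, normc (z' k) <= B) ->
        LIM (fun k => a * z k + z' k) = a * LIM z + LIM z',
      forall c, LIM (fun=> c) = c &
      forall z (B B' : R) N, (forall k, normc (z k) <= B') ->
        (forall k, (N <= k)%N -> normc (z k) <= B) -> normc (LIM z) <= 2 * B].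
Proof.
have [U [uU ooU]] := ultraFilterLemma (@eventually_filter).
have pU : ProperFilter U by exact: ultra_proper.
have cvgU (a : nat -> R) (B : R) : (forall k, `|a k| <= B) -> a @ U --> lim (a @ U).
  move=> aB; have uaU : UltraFilter (a @ U).
    split; first exact: fmap_proper_filter.
    move=> G pG sUG; apply/seteqP; split=> [A GA|//].
    have [//|UnA] := in_ultra_setVsetC (a @^-1` A) uU.
    have GnA : G (~` A) by exact: (sUG (~` A) UnA).
    have G0 : G (A `&` ~` A) by exact: (@filterI _ _ (@filter_filter _ _ pG)).
    by move: G0; rewrite setICr => /filter_not_empty.
  have aU : (a @ U) `[- B, B]%classic.
    apply: (@filterE _ U _ (a @^-1` `[- B, B]%classic)) => k.
    by rewrite /preimage/= in_itv/= -ler_norml aB.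
  have := @segment_compact R (- B) B; rewrite compact_ultra => /(_ _ uaU aU)[l [_ al]].
  by apply/cvg_ex; exists l.
have limU (a : nat -> R) (l : R) : a @ U --> l -> lim (a @ U) = l.
  by move=> al; exact: cvg_lim.
have ReB (z : nat -> R[i]) (B : R) : (forall k, normc (z k) <= B) -> forall k, `|complex.Re (z k)| <= B.
  by move=> zB k; exact: le_trans (normc_Re_le _) (zB k).
have ImB (z : nat -> R[i]) (B : R) : (forall k, normc (z k) <= B) -> forall k, `|complex.Im (z k)| <= B.
  by move=> zB k; exact: le_trans (normc_Im_le _) (zB k).
exists (fun z => lim ((fun k => complex.Re (z k)) @ U) +i*
                 lim ((fun k => complex.Im (z k)) @ U)); split.
- move=> a z z' B zB zB'.
  have c1 := cvgU _ B (ReB z B zB); have c2 := cvgU _ B (ImB z B zB).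
  have c3 := cvgU _ B (ReB z' B zB'); have c4 := cvgU _ B (ImB z' B zB').
  apply: eq_complexP.
  + rewrite complex_ReD complex_ReM/=; apply: limU.
    under eq_fun do rewrite complex_ReD complex_ReM.
    apply: cvgD => //; apply: cvgB; apply: cvgM => //; exact: cvg_cst.
  + rewrite complex_ImD complex_ImM/=; apply: limU.
    under eq_fun do rewrite complex_ImD complex_ImM.
    apply: cvgD => //; apply: cvgD; apply: cvgM => //; exact: cvg_cst.
- by move=> c; apply: eq_complexP => /=; apply: limU; exact: cvg_cst.
- move=> z B B' N zB' zB.
  have bd (a : nat -> R) : (forall k, `|a k| <= normc (z k)) -> `|lim (a @ U)| <= B.
    move=> az; have c : a @ U --> lim (a @ U).
      by apply: (cvgU _ B') => k; exact: le_trans (az k) (zB' k).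
    have cn : (fun k => `|a k|) @ U --> `|lim (a @ U)| by exact: cvg_norm.
    rewrite -(limU _ _ cn); apply: limr_le.
      by apply/cvg_ex; eexists; exact: cn.
    apply: ooU; exists N => // k /= Nk; exact: le_trans (az k) (zB k Nk).
  rewrite (le_trans (normc_le_ReIm _))//= mulr2n mulrDl mul1r lerD// bd// => k.
    exact: normc_Re_le.
  exact: normc_Im_le.
Qed.

End generalized_limit.

Section right_identity.
Context {R : realType} (w : weight R).
Local Notation mu := (@lebesgue_measure R).
Local Notation H := (`[0%R : R, +oo[%classic).
Implicit Types (f g : L0 w) (phi psi : R -> R[i]) (n m : dualL0 w).

Lemma weight_bounded (b : R) : 0 <= b ->
  exists2 W : R, 0 < W & forall x, 0 <= x <= b -> w x <= W.
Proof.
move=> b0; have [|c cb hc] := @EVT_max R w 0 b b0.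
  apply: continuous_subspaceW; last exact: weight_continuous.
  by move=> x /=; rewrite !in_itv/= => /andP[->].
exists (w c).
  by apply: weight_gt0; move: cb; rewrite in_itv/= => /andP[].
by move=> x xb; apply: hc; rewrite in_itv.
Qed.

Lemma integrable_itv (a b : R) :
  mu.-integrable H (fun x => (\1_`[a, b] x : R)%:E).
Proof. by apply: integrable_half_line; exact: integrable_indic_itv. Qed.

Lemma Rintegral_itv (a b : R) : 0 <= a -> a <= b ->
  \int[mu]_(x in H) (\1_`[a, b] x : R) = b - a.
Proof.
move=> a0 ab; rewrite /Rintegral integral_indic; [|exact: measurable_half_line|exact: measurable_itv].
rewrite setIidl; last first.
  move=> x /=; rewrite !in_itv/= andbT => /andP[ax _]; exact: le_trans ax.
rewrite /= lebesgue_measure_itv/= lte_fin; case: ifPn => [_|] //=.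
by rewrite -leNgt => ba; rewrite (@le_anti _ _ a b) ?ab// subrr.
Qed.

Definition itv_fun (b x : R) : R[i] := (\1_`[0, b] x)%:C.

Lemma cmeasurable_itv_fun (b : R) : cmeasurable H (itv_fun b).
Proof. by apply: cmeasurable_real; exact: measurable_indic. Qed.

Lemma itv_fun_L1w (b : R) : 0 <= b -> L1w w (itv_fun b).
Proof.
move=> b0; have [W W0 wW] := weight_bounded b0.
apply: L1w_le (cmeasurable_itv_fun b) (integrableZ_half W (integrable_itv 0 b)) _.
apply: ae_forallT => x _; rewrite normc_real indicE; case: (boolP (x \in _)) => xb.
  by rewrite normr1 !mulr1 wW//; move: xb; rewrite inE/= in_itv.
by rewrite normr0 !mulr0.
Qed.

Lemma ae_eq0_itv (h : R -> R) :
  (forall b, 0 <= b -> mu.-integrable `[0, b] (fun x => (h x)%:E)) ->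
  (forall b, 0 <= b -> \int[mu]_(x in `[0, b]) h x = 0) ->
  \forall x \ae mu, H x -> h x = 0.
Proof.
move=> ih h0.
have step (N : nat) : \forall x \ae mu, 0 <= x <= N%:R -> h x = 0.
  pose f := h \_ `[0, N%:R].
  have iN := ih N%:R (ler0n _ _).
  have ifT : mu.-integrable setT (fun x => (f x)%:E).
    have mI : @measurable _ (measurableTypeR R) `[0, N%:R]%classic by exact: measurable_itv.
    have := (@integrable_mkcond _ (measurableTypeR R) _ mu _ (fun x => (h x)%:E) mI).1 iN.
    by apply: eq_integrable => // x _; rewrite /f !patchE; case: ifP.
  have lf : locally_integrable [set: R] f by exact: integrable_locally_restrict.
  have F0 : (fun x => \int[mu]_(t in [set` `]-oo, x]]) f t) = cst 0.
    apply/funext => x; rewrite /f -Rintegral_mkcondr.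
    have [x0|x0] := ltP x 0.
      rewrite (_ : _ `&` _ = set0) ?Rintegral_set0//.
      apply/seteqP; split => // y [/=]; rewrite !in_itv/= => yx /andP[y0 _].
      by move: (le_lt_trans (le_trans y0 yx) x0); rewrite ltxx.
    rewrite (_ : _ `&` _ = `[0, Num.min x N%:R]%classic).
      by apply: h0; rewrite le_min x0 ler0n.
    apply/seteqP; split => y /=; rewrite !in_itv/= le_min.
      by move=> [-> /andP[-> ->]].
    by move=> /and3P[-> -> ->].
  have := @FTC1Ny R f _ lf.
  move=> /(_ _)/ae_imp; apply; last first.
    by move=> y; apply: integrableS ifT.
  move=> x; rewrite F0 => -[_ +] /andP[x0 xN]; rewrite derive1_cst => /esym.
  by rewrite /f patchE mem_set//= in_itv/= x0 xN.
have := ae_foralln step; apply: ae_imp => x hx /half_lineP x0.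
apply: (hx (Num.truncn x).+1); rewrite x0/=.
by apply: ltW; exact: truncnS_gt.
Qed.

Lemma L0_eq_itv f g : (forall b, 0 <= b ->
  L0_pairing f (itv_fun b) = L0_pairing g (itv_fun b)) -> f = g.
Proof.
move=> fg; pose d := -1 *: g + f.
have d0 b : 0 <= b -> L0_pairing d (itv_fun b) = 0.
  by move=> b0; rewrite L0_pairing_comb ?fg ?mulN1r ?addNr//; exact: itv_fun_L1w.
have id b : 0 <= b -> cintegrable (fun x => L0_repr d x * itv_fun b x).
  by move=> b0; exact: pairing_integrable (wbounded_repr_class d) (itv_fun_L1w b0).
have sH b : (`[0, b] : set R) `<=` H.
  by move=> x /=; rewrite !in_itv/= => /andP[->].
have mH : @measurable _ (measurableTypeR R) H by exact: measurable_half_line.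
have mI b : @measurable _ (measurableTypeR R) `[0, b]%classic by exact: measurable_itv.
have aeRe : \forall x \ae mu, H x -> complex.Re (L0_repr d x) = 0.
  apply: ae_eq0_itv => b b0.
    have [/(integrableS mH (mI b) (@sH b)) h _] := id b b0.
    apply: eq_integrable h => // x; rewrite inE => xb.
    by rewrite complex_ReM/= indicE mem_set// mulr1 mulr0 subr0.
  have hz : \int[mu]_(x in H) complex.Re (L0_repr d x * itv_fun b x) = 0.
    by rewrite -Re_cintegral -/(pairing _ _) [pairing _ _](d0 b b0).
  rewrite -[RHS]hz.
  rewrite Rintegral_mkcond [RHS]Rintegral_mkcond; apply: eq_Rintegral => x _.
  rewrite !patchE complex_ReM/= mulr0 subr0 indicE; case: (boolP (x \in `[0, b]%classic)) => xb.
    by rewrite mem_set ?mulr1//; apply: sH; move: xb; rewrite inE; exact.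
  by rewrite mulr0; case: ifP.
have aeIm : \forall x \ae mu, H x -> complex.Im (L0_repr d x) = 0.
  apply: ae_eq0_itv => b b0.
    have [_ /(integrableS mH (mI b) (@sH b)) h] := id b b0.
    apply: eq_integrable h => // x; rewrite inE => xb.
    by rewrite complex_ImM/= indicE mem_set// mulr1 mulr0 add0r.
  have hz : \int[mu]_(x in H) complex.Im (L0_repr d x * itv_fun b x) = 0.
    by rewrite -Im_cintegral -/(pairing _ _) [pairing _ _](d0 b b0).
  rewrite -[RHS]hz.
  rewrite Rintegral_mkcond [RHS]Rintegral_mkcond; apply: eq_Rintegral => x _.
  rewrite !patchE complex_ImM/= mulr0 add0r indicE; case: (boolP (x \in `[0, b]%classic)) => xb.
    by rewrite mem_set ?mulr1//; apply: sH; move: xb; rewrite inE; exact.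
  by rewrite mulr0; case: ifP.
have : rnorm d <= 0.
  rewrite -[d]L0_reprK; apply: rnorm_class_le; split; first exact: L0_measurable.
  apply: ae_imp2 aeRe aeIm => x h1 h2 Hx; rewrite mul0r (le_trans (normc_le_ReIm _))//.
  by rewrite h1// h2// normr0 addr0.
move=> dle; have /rnorm_eq0 : rnorm d = 0 by apply/eqP; rewrite eq_le dle rnorm_ge0.
by move=> /eqP; rewrite /d scaleN1r addrC subr_eq0 => /eqP.
Qed.

Lemma cconv_itv_close f (b : R) : 0 <= b -> exists2 C : R, 0 <= C &
  forall t, 0 <= t <= 1 ->
  normc (cconv (L0_repr f) (itv_fun b) t - L0_pairing f (itv_fun b)) <= C * t.
Proof.
move=> b0; have b1 : 0 <= b + 1 by rewrite addr_ge0.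
have [W W0 wW] := weight_bounded b1.
exists (2 * rnorm f * (W * 2)) => [|t /andP[t0 t1]].
  by rewrite !mulr_ge0 ?rnorm_ge0// ltW.
have hi := itv_fun_L1w b0; have hr := translate_L1w t0 hi.
rewrite /cconv -pairing_translate//; last 2 first.
- exact: L0_measurable.
- exact: cmeasurable_itv_fun.
rewrite -[pairing _ _]/(L0_pairing f _) addrC -mulN1r -L0_pairing_combr//.
pose delta x : R[i] := -1 * itv_fun b x + translate t (itv_fun b) x.
have hd : L1w w delta by apply: L1wD => //; exact: L1wZ.
rewrite (le_trans (L0_pairing_le f hd))// mulrA -!mulrA ler_wpM2l// ler_wpM2l ?rnorm_ge0//.
have ik : mu.-integrable H (fun x => (W * (\1_`[0, t] x + \1_`[b, b + t] x))%:E).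
  apply: integrableZ_half.
  by apply: eq_integrable (integrableD _ (integrable_itv 0 t) (integrable_itv b (b + t))).
have -> : W * (2 * t) = \int[mu]_(x in H) (W * (\1_`[0, t] x + \1_`[b, b + t] x)).
  rewrite RintegralZ_half; last first.
    by apply: eq_integrable (integrableD _ (integrable_itv 0 t) (integrable_itv b (b + t))).
  rewrite RintegralD//; [|exact: integrable_itv..].
  by rewrite !Rintegral_itv// ?lerDl// subr0 [b + t]addrC addrK mulr2n mulrDl mul1r.
apply: L1norm_le ik _; first exact: L1w_measurable hd.
apply: ae_forallT => x /half_lineP x0.
have dE : normc (delta x) <= \1_`[0, t] x + \1_`[b, b + t] x.
  rewrite /delta /translate /zext /itv_fun !indicE !mem_setE !in_itv/= x0/= mulN1r.
  have [xt|xt] := leP t x; last first.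
    have -> : (0 <= x - t) = false by rewrite subr_ge0 leNgt xt.
    rewrite addr0 (ltW xt).
    rewrite -rmorphN normc_real normrN; case: (x <= b); rewrite ?normr1 ?normr0.
      by rewrite lerDl.
    by rewrite addr_ge0.
  rewrite subr_ge0 xt lerBlDr -rmorphN -rmorphD normc_real andTb.
  have [xb|xb] := leP x b.
    by rewrite (le_trans xb) ?lerDl//= addNr normr0 addr_ge0.
  rewrite (ltW xb)/= oppr0 add0r; case: (x <= b + t); rewrite ?normr1 ?normr0 ?addr_ge0//.
  by rewrite lerDr.
apply: (@le_trans _ _ (w x * (\1_`[0, t] x + \1_`[b, b + t] x))).
  by rewrite ler_wpM2l ?weight_ge0.
have [xb|xb] := leP x (b + 1).
  by rewrite ler_wpM2r ?addr_ge0// wW// x0.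
have -> : \1_`[0, t] x = 0 :> R.
  rewrite indicE memNset//= in_itv/= => /andP[_ xt].
  by have := lt_le_trans xb xt; rewrite ltNge (le_trans t1)// lerDr.
have -> : \1_`[b, b + t] x = 0 :> R.
  rewrite indicE memNset//= in_itv/= => /andP[_ xt].
  by have := lt_le_trans xb xt; rewrite ltrD2l ltNge t1.
by rewrite addr0 !mulr0.
Qed.

(* A weak* cluster point of the approximate identity k 1_[0, 1/k]. *)
Lemma right_identity_exists : exists u : dualL0 w, forall m, arens m u = m.
Proof.
have [LIM [LIMD LIMc LIMle]] := @generalized_limit R.
have [W W0 wW] := weight_bounded ler01.
pose e (k : nat) (x : R) : R[i] := (k.+1%:R)%:C * itv_fun k.+1%:R^-1 x.
have k0 (k : nat) : 0 <= k.+1%:R^-1 :> R by rewrite invr_ge0.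
have he k : L1w w (e k) by apply: L1wZ; exact: itv_fun_L1w.
have k1 (k : nat) : k.+1%:R^-1 <= 1 :> R by rewrite invf_le1 ?ltr0n// ler1n.
have ie k : mu.-integrable H (fun x => (k.+1%:R * \1_`[0, k.+1%:R^-1] x)%:E).
  by apply: integrableZ_half; exact: integrable_itv.
have inte k : \int[mu]_(x in H) (k.+1%:R * \1_`[0, k.+1%:R^-1] x) = 1.
  rewrite RintegralZ_half; last exact: integrable_itv.
  by rewrite Rintegral_itv// subr0 divff.
have normce k x : normc (e k x) = k.+1%:R * \1_`[0, k.+1%:R^-1] x.
  by rewrite /e /itv_fun -rmorphM normc_real ger0_norm// mulr_ge0.
have eW k : L1norm w (e k) <= W.
  rewrite -[leRHS]mulr1 -(inte k) -RintegralZ_half//.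
  apply: L1norm_le (L1w_measurable (he k)) (integrableZ_half W (ie k)) _.
  apply: ae_forallT => x /half_lineP x0; rewrite normce.
  have [xk|xk] := boolP (x <= k.+1%:R^-1).
    by rewrite ler_wpM2r ?mulr_ge0// wW// x0 (le_trans xk).
  by rewrite indicE memNset ?mulr0//= in_itv/= x0 (negbTE xk).
pose z f k := L0_pairing f (e k).
have zB f k : normc (z f k) <= 2 * (rnorm f * W).
  rewrite (le_trans (L0_pairing_le _ (he k)))// ler_wpM2l// ler_wpM2l ?rnorm_ge0//.
have zBB f g k : normc (z f k) <= 2 * (rnorm f * W) + 2 * (rnorm g * W).
  by rewrite (le_trans (zB f k))// lerDl !mulr_ge0 ?rnorm_ge0// ltW.
have up : (fun f => LIM (z f)) \in @dual_pred _ w.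
  apply: (@dual_predI _ _ _ (2 * (2 * W))) => [a f g|f].
    rewrite -(LIMD a _ _ (2 * (rnorm f * W) + 2 * (rnorm g * W))) //; last first.
      by move=> k; rewrite addrC.
    by congr LIM; apply/funext => k; exact: L0_pairing_comb.
  rewrite -!mulrA [W * _]mulrC; exact: (LIMle _ _ _ 0%N (zB f)).
exists (MkDualL0 up) => m; apply/dual_eqP => f; rewrite arensE.
apply: (congr1 (dual_fun m)); apply: L0_eq_itv => b b0.
have hi := itv_fun_L1w b0.
apply: (etrans (L0_actP _ _ hi)); rewrite -[LHS]/(LIM (z (L0_conv f (itv_fun b)))).
have [C C0 hC] := cconv_itv_close f b0.
set c := L0_pairing f (itv_fun b); set g := L0_conv f (itv_fun b).
have zc k : normc (-1 * c + z g k) <= 2 * (C / k.+1%:R).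
  have bc : wbounded w (normc c) (fun=> c).
    split; first exact: cmeasurable_cst.
    by apply: ae_forallT => x /half_lineP x0; rewrite ler_peMr ?normc_ge0// weight_ge1.
  have bg := wbounded_cconv (rnorm_ge0 f) (wbounded_repr_class f) hi.
  have cE : c = pairing (fun=> c) (e k).
    rewrite /pairing cintegralZl; last first.
      have b1 : wbounded w 1 (fun=> 1).
        split; first exact: cmeasurable_cst.
        apply: ae_forallT => x /half_lineP x0; rewrite mul1r.
        by rewrite -[1]/(1%:C) normc_real normr1 weight_ge1.
      by have := pairing_integrable b1 (he k); congr cintegrable; apply/funext => x; rewrite mul1r.
    rewrite (_ : cintegral (e k) = 1) ?mulr1//; apply: eq_complexP.
      rewrite Re_cintegral -[RHS](inte k); apply: eq_Rintegral => x _.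
      by rewrite /e /itv_fun -rmorphM.
    rewrite Im_cintegral /Rintegral (eq_integral (cst 0%E)) ?integral0// => x _.
    by rewrite /e /itv_fun -rmorphM.
  have gE : z g k = pairing (cconv (L0_repr f) (itv_fun b)) (e k).
    apply: pairing_ae_eq; try exact: L1w_measurable (he k); try exact: L0_measurable.
    - by case: bg.
    - exact: repr_conv.
    - exact: ae_forallT.
  rewrite {1}cE gE -(pairing_combl (-1) bc bg (he k)).
  rewrite (_ : C / _ = \int[mu]_(x in H)
      (C / k.+1%:R * (k.+1%:R * \1_`[0, k.+1%:R^-1] x))); last first.
    by rewrite RintegralZ_half// inte mulr1.
  apply: normc_cintegral_le.
  - apply: cmeasurableM => //; last exact: L1w_measurable (he k).
    by case: bg => mg _; exact: cmeasurableD (cmeasurable_cst _ _) mg.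
  - by apply: integrableZ_half; exact: ie.
  - apply: ae_forallT => x /half_lineP x0; rewrite normcM normce.
    have [xk|xk] := boolP (x <= k.+1%:R^-1); last first.
      by rewrite indicE memNset ?mulr0//= in_itv/= x0 (negbTE xk).
    rewrite ler_wpM2r ?mulr_ge0// mulN1r addrC (le_trans (hC _ _))//.
      by rewrite x0 (le_trans xk).
    by rewrite ler_wpM2l.
have LIMz : normc (-1 * c + LIM (z g)) <= 0.
  apply/ler_addgt0Pl => eps eps0; rewrite addr0.
  have := LIMD (-1) (fun=> c) (z g) (normc c + 2 * (rnorm g * W)).
  rewrite LIMc => <-; last 2 first.
  - by move=> k; rewrite lerDl !mulr_ge0 ?rnorm_ge0// ltW.
  - by move=> k; rewrite (le_trans (zB g k))// lerDr normc_ge0.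
  pose N := Num.truncn (4 * C / eps).
  have -> : eps = 2 * (eps / 2) by rewrite mulrC divfK.
  apply: (LIMle _ _ (2 * C) N) => k.
    rewrite (le_trans (zc k))// ler_wpM2l// ler_piMr//.
  move=> Nk; rewrite (le_trans (zc k))//.
  have NC : 4 * C / eps < k.+1%:R.
    by rewrite (lt_le_trans (truncnS_gt _))// ler_nat ltnS.
  rewrite ltr_pdivrMr// in NC; rewrite mulrA ler_pdivrMr//.
  by move: NC; clear; move: k.+1%:R => K NC; lra.
apply/eqP; rewrite -subr_eq0 addrC -mulN1r; apply/eqP/eq0_normc/eqP.
by rewrite eq_le LIMz normc_ge0.
Qed.

End right_identity.

(** * The gliding hump argument *)

Section gliding_hump.
Context {R : realType}.
Implicit Types V : normedModType R[i].

Lemma geometric_le0 (x K : R) : (forall n, x <= K * 2^-1 ^+ n) -> x <= 0.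
Proof.
move=> xK; have c : (fun n => K * 2^-1 ^+ n) @ \oo --> K * 0.
  by apply: cvgMr; apply: cvg_expr; rewrite ger0_norm ?invr_ge0// invf_lt1// ltr1n.
rewrite -(mulr0 K) -(cvg_lim _ c)//; apply: limr_ge; last exact: nearW.
by apply/cvg_ex; eexists; exact: c.
Qed.

Lemma sum_half_lt (c : R) m n : 0 <= c ->
  \sum_(m <= k < n) c * 2^-1 ^+ k <= 2 * c * 2^-1 ^+ m.
Proof.
move=> c0; have [nm|mn] := leqP n m.
  by rewrite big_geq// !mulr_ge0// exprn_ge0// invr_ge0.
suff -> : \sum_(m <= k < n) c * 2^-1 ^+ k =
    2 * c * 2^-1 ^+ m - 2 * c * 2^-1 ^+ n.
  by rewrite lerBlDr lerDl !mulr_ge0// exprn_ge0// invr_ge0.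
rewrite -(subnKC (ltnW mn)); elim: (n - m)%N => [|d IH].
  by rewrite addn0 big_geq// subrr.
by rewrite addnS big_nat_recr/= ?leq_addr// IH exprS; field.
Qed.

Definition series_complete V := forall (x : nat -> V) (c : R),
  (forall k, rnorm (x k) <= c * 2^-1 ^+ k) ->
  exists y, forall n, rnorm (y - \sum_(0 <= k < n) x k) <= 4 * c * 2^-1 ^+ n.

(* For the shift argument adm k i is i = k; with P the identity and adm constant
   this is the uniform boundedness principle. *)
Lemma gliding_hump V (P : V -> V) (r : R) (I : Type) (adm : nat -> I -> Prop)
    (q : I -> V -> R) : series_complete V ->
  linear P -> (forall x, rnorm (P x) <= r * rnorm x) ->
  (forall i x y, q i (x - y) <= q i x + q i y) ->
  (forall i (t : R) x, 0 <= t -> q i (t%:C *: x) = t * q i x) ->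
  (forall x, exists M, forall k i, adm k i -> q i x <= M) ->
  (forall k i, adm k i -> exists C, forall x, q i (iter k.+1 P x) <= C * rnorm x) ->
  exists k C, forall i x, adm k i -> q i (iter k P x) <= C * rnorm x.
Proof.
move=> Vc linP Pr qB qZ qM qC; apply: contrapT => nC.
pose r' := Num.max r 1; have r1 : 1 <= r' by rewrite le_max lexx orbT.
have r0 : 0 < r' by exact: lt_le_trans r1.
have Pr' k x : rnorm (iter k P x) <= r' ^+ k * rnorm x.
  elim: k => [|k IH]; first by rewrite mul1r.
  rewrite iterS (le_trans (Pr _))// exprS -mulrA.
  apply: (@le_trans _ _ (r' * rnorm (iter k P x))); last by rewrite ler_wpM2l// ltW.
  by rewrite ler_wpM2r ?rnorm_ge0// le_max lexx.
have linPk k a x y : iter k P (a *: x + y) = a *: iter k P x + iter k P y.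
  by elim: k => //= k ->; rewrite linP.
have iterP0 k : iter k P 0 = 0.
  by have := linPk k (-1) 0 0; rewrite scaler0 addr0 scaleN1r addNr.
have iterPD k x y : iter k P (x + y) = iter k P x + iter k P y.
  by rewrite -[x]scale1r linPk !scale1r.
have iterPB k x y : iter k P (x - y) = iter k P x - iter k P y.
  by rewrite addrC -scaleN1r linPk scaleN1r addrC.
have [M hM] := choice qM.
have exC (z : nat * I) : exists c : R, adm z.1 z.2 ->
    0 <= c /\ forall x, q z.2 (iter z.1.+1 P x) <= c * rnorm x.
  case: z => k i /=.
  have [a|na] := pselect (adm k i); last by exists 0.
  have [c hc] := qC k i a; exists (Num.max c 0) => _; split.
    by rewrite le_max lexx orbT.
  by move=> x; rewrite (le_trans (hc x))// ler_wpM2r ?rnorm_ge0// le_max lexx.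
have [C hC] := choice exC.
have step (z : nat * V * R) : exists v : V * I, 0 < z.2 ->
    [/\ adm z.1.1 v.2, rnorm v.1 <= z.2 &
        M z.1.2 + z.1.1%:R + 2 <= q v.2 (iter z.1.1 P v.1)].
  case: z => [[k s] e]/=; pose B := M s + k%:R + 2.
  have big c : exists v : V * I, adm k v.2 /\ c * rnorm v.1 < q v.2 (iter k P v.1).
    apply: contrapT => nv; apply: nC; exists k, c => i x ki; rewrite leNgt.
    by apply/negP => lt; apply: nv; exists (x, i).
  have [e0|e0] := ltP 0 e; last first.
    by have [v _] := big 0; exists v.
  have [[x i]/= [ki lt]] := big (`|B| / e).
  have x0 : 0 < rnorm x.
    rewrite lt_neqAle rnorm_ge0 andbT eq_sym; apply/eqP => x0.
    move: lt; rewrite x0 mulr0 (rnorm_eq0 x0).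
    by rewrite iterP0 -(scaler0 _ (0 : R)%:C) qZ// mul0r ltxx.
  pose t := e / rnorm x; have t0 : 0 <= t by rewrite divr_ge0 ?rnorm_ge0// ltW.
  exists (t%:C *: x, i) => _; split => //=.
    by rewrite rnormZ normc_real ger0_norm// divfK// gt_eqF.
  have -> : iter k P (t%:C *: x) = t%:C *: iter k P x.
    by have := linPk k t%:C x 0; rewrite iterP0 !addr0.
  rewrite qZ// (le_trans (ler_norm _))// -/B.
  apply: (@le_trans _ _ (t * (`|B| / e * rnorm x))); last by rewrite ler_wpM2l// ltW.
  suff -> : t * (`|B| / e * rnorm x) = `|B| by [].
  by rewrite /t; field; rewrite !gt_eqF.
have [g hg] := choice step.
pose eps k (d : R) : R := 2^-1 ^+ k * d / r' ^+ k.
pose st := fix st k : V * R := if k is j.+1 then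
  let v := g (j, (st j).1, eps j (st j).2) in
  ((st j).1 + iter j P v.1, Num.min (st j).2 (1 / (4 * (1 + C (j, v.2)))))
  else (0, 1).
pose v k := g (k, (st k).1, eps k (st k).2).
have h0 k : 0 < (2^-1 : R) ^+ k by rewrite exprn_gt0// invr_gt0.
have rk0 k : 0 < r' ^+ k by rewrite exprn_gt0.
have [dP vP] : (forall k, 0 < (st k).2) /\ forall k,
    [/\ adm k (v k).2, rnorm (v k).1 <= eps k (st k).2 &
        M (st k).1 + k%:R + 2 <= q (v k).2 (iter k P (v k).1)].
  have vP k : 0 < (st k).2 -> [/\ adm k (v k).2, rnorm (v k).1 <= eps k (st k).2 &
        M (st k).1 + k%:R + 2 <= q (v k).2 (iter k P (v k).1)].
    move=> dk; apply: (hg (k, (st k).1, eps k (st k).2)).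
    by rewrite /= /eps divr_gt0// mulr_gt0.
  suff dP k : 0 < (st k).2 by split => // k; exact: vP.
  elim: k => //= k IH; rewrite lt_min IH/= -/(v k).
  have [ak _ _] := vP k IH; have [C0 _] := hC (k, (v k).2) ak.
  by rewrite divr_gt0// mulr_gt0// ltr_wpDr.
have dmono j i : (st (i + j)%N).2 <= (st j).2.
  by elim: i => [|i IH]; rewrite ?add0n// addSn/= ge_min IH.
have d1 k : (st k).2 <= 1 by rewrite -[k]addn0; exact: (dmono 0%N k).
have sE n : (st n).1 = \sum_(0 <= k < n) iter k P (v k).1.
  by elim: n => [|n IH]; [rewrite big_geq|rewrite big_nat_recr//= -IH].
have vr k : r' ^+ k * rnorm (v k).1 <= 2^-1 ^+ k * (st k).2.
  by have [_ + _] := vP k; rewrite /eps ler_pdivlMr// mulrC.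
have [y hy] : exists y, forall n, rnorm (y - (st n).1) <= 4 * 1 * 2^-1 ^+ n.
  have [|y hy] := Vc (fun k => iter k P (v k).1) 1; last by exists y => n; rewrite sE.
  move=> k; rewrite (le_trans (Pr' k _))// (le_trans (vr k))// mul1r.
  by rewrite ler_piMr// ltW.
pose j := Num.truncn `|M y|.
pose d := (st j.+1).2.
have [z hz] : exists z, forall n,
    rnorm (z - \sum_(0 <= i < n) iter i P (v (i + j.+1)%N).1) <= 4 * d * 2^-1 ^+ n.
  apply: (Vc (fun i => iter i P (v (i + j.+1)%N).1) d) => i.
  rewrite (le_trans (Pr' i _))//.
  apply: (@le_trans _ _ (r' ^+ (i + j.+1) * rnorm (v (i + j.+1)%N).1)).
    by rewrite ler_wpM2r ?rnorm_ge0// ler_weXn2l// leq_addr.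
  rewrite (le_trans (vr _))// mulrC; apply: ler_pM => //; first exact: ltW.
  by rewrite ler_wiXn2l// ?leq_addr// ?invr_ge0// invf_le1// ler1n.
have yE : y = (st j.+1).1 + iter j.+1 P z.
  apply/eqP; rewrite -subr_eq0; apply/eqP/rnorm_eq0/eqP; rewrite eq_le rnorm_ge0 andbT.
  apply: (@geometric_le0 _ (4 + r' ^+ j.+1 * (4 * d))) => n.
  have linN : iter j.+1 P (z - \sum_(0 <= i < n) iter i P (v (i + j.+1)%N).1) =
      iter j.+1 P z - ((st (n + j.+1)%N).1 - (st j.+1).1).
    rewrite iterPB; congr (_ - _); elim: n => [|n IH].
      by rewrite big_geq// subrr iterP0.
    have -> : \sum_(0 <= i < n.+1) iter i P (v (i + j.+1)%N).1 =
        \sum_(0 <= i < n) iter i P (v (i + j.+1)%N).1 + iter n P (v (n + j.+1)%N).1.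
      by rewrite big_nat_recr.
    rewrite iterPD IH -iterD [(j.+1 + n)%N]addnC addSn.
    rewrite -[(st (n + j.+1).+1).1]/((st (n + j.+1)%N).1 + iter (n + j.+1) P (v (n + j.+1)%N).1).
    by rewrite addrAC.
  have -> : y - ((st j.+1).1 + iter j.+1 P z) = y - (st (n + j.+1)%N).1 -
      iter j.+1 P (z - \sum_(0 <= i < n) iter i P (v (i + j.+1)%N).1).
    by rewrite linN opprB -[_ - _ - iter _ _ z]addrA subrKA opprD.
  rewrite (le_trans (rnormB _ _))// mulrDl lerD//.
    rewrite (le_trans (hy _))// mulr1 ler_wpM2l// ler_wiXn2l ?leq_addr ?invr_ge0//.
    by rewrite invf_le1// ler1n.
  by rewrite (le_trans (Pr' _ _))// -mulrA ler_wpM2l// ltW.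
have [ajv _ qj] := vP j; have [C0 Cj] := hC (j, (v j).2) ajv.
have C1 : 0 < 1 + C (j, (v j).2) by rewrite ltr_wpDr.
have zd : rnorm z <= 4 * d by have := hz 0%N; rewrite big_geq// subr0 expr0 mulr1.
have Pz : q (v j).2 (iter j.+1 P z) <= 1.
  rewrite (le_trans (Cj z))//; apply: (@le_trans _ _ (C (j, (v j).2) * (4 * d))).
    by rewrite ler_wpM2l.
  apply: (@le_trans _ _ (C (j, (v j).2) / (1 + C (j, (v j).2)))).
    rewrite ler_wpM2l// mulrC -ler_pdivlMr// -invfM mulrC -[_^-1]mul1r.
    by rewrite /d/= ge_min lexx orbT.
  by rewrite ler_pdivrMr// mul1r lerDr.
have vE : iter j P (v j).1 = y - iter j.+1 P z - (st j).1.
  by rewrite {1}yE addrK -[(st j.+1).1]/((st j).1 + iter j P (v j).1) addrC addKr.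
have : q (v j).2 (iter j P (v j).1) <= M y + 1 + M (st j).1.
  rewrite vE (le_trans (qB _ _ _))// lerD//; last exact: hM ajv.
  by rewrite (le_trans (qB _ _ _))// lerD//; exact: hM ajv.
move=> /(le_trans qj); apply/negP; rewrite -ltNge.
have : M y < j.+1%:R by rewrite (le_lt_trans (ler_norm _))// truncnS_gt.
by rewrite -[j.+1]addn1 natrD; lra.
Qed.

End gliding_hump.

Section hump_sequences.
Context {R : realType} (w : weight R).
Local Notation mu := (@lebesgue_measure R).
Local Notation H := (`[0%R : R, +oo[%classic).
Implicit Types (f g : L0 w) (phi psi : R -> R[i]) (n m : dualL0 w).

Lemma dual_sumE (x : nat -> dualL0 w) N f :
  (\sum_(0 <= k < N) x k) f = \sum_(0 <= k < N) x k f.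
Proof.
elim: N => [|N IH]; first by rewrite !big_geq.
rewrite [in RHS]big_nat_recr//= -IH big_nat_recr//=.
Qed.

(* The sum of the series is its generalized limit, evaluated pointwise. *)
Lemma dual_series_complete : series_complete (dualL0 w).
Proof.
move=> x c xc; have [LIM [LIMD LIMc LIMle]] := @generalized_limit R.
have c0 : 0 <= c by have := xc 0%N; rewrite expr0 mulr1; apply: le_trans; exact: rnorm_ge0.
pose s N f := \sum_(0 <= k < N) x k f.
have sB1 i j f : (i <= j)%N ->
    normc (-1 * s i f + s j f) <= 2 * c * 2^-1 ^+ i * rnorm f.
  move=> ij; have -> : -1 * s i f + s j f = \sum_(i <= k < j) x k f.
    by rewrite /s [in X in _ + X](big_cat_nat (leq0n i) ij)/= mulN1r addKr.
  apply: (@le_trans _ _ (\sum_(i <= k < j) c * 2^-1 ^+ k * rnorm f)).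
    elim/big_rec2: _ => [|k a b _ ba]; first by rewrite normc0.
    rewrite (le_trans (le_normcD _ _))// lerD// (le_trans (normc_dual_le _ _))//.
    by rewrite ler_wpM2r ?rnorm_ge0.
  by rewrite -mulr_suml ler_wpM2r ?rnorm_ge0// sum_half_lt.
have sB i j f : normc (-1 * s i f + s j f) <= 2 * c * 2^-1 ^+ (minn i j) * rnorm f.
  have [ij|/ltnW ji] := leqP i j; first exact: sB1.
  by rewrite -normcN opprD mulN1r opprK addrC -mulN1r sB1.
have s0 N f : normc (s N f) <= 2 * c * rnorm f.
  have := sB 0%N N f; rewrite min0n expr0 mulr1 [s 0%N f]big_geq// mulr0 add0r; exact.
have up : (fun f => LIM (s^~ f)) \in @dual_pred _ w.
  apply: (@dual_predI _ _ _ (2 * (2 * c))) => [a f g|f].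
    rewrite -(LIMD a _ _ (2 * c * rnorm f + 2 * c * rnorm g)).
    - congr LIM; apply/funext => N; rewrite /s mulr_sumr -big_split/=.
      apply: eq_bigr => k _; exact: dual_linear.
    - by move=> k; rewrite (le_trans (s0 _ _))// lerDl !mulr_ge0 ?rnorm_ge0.
    - by move=> k; rewrite (le_trans (s0 _ _))// lerDr !mulr_ge0 ?rnorm_ge0.
  by rewrite -mulrA; exact: (LIMle _ _ _ 0%N (s0^~ f)).
exists (MkDualL0 up) => N; apply: rnorm_dual_le => [|f].
  by rewrite !mulr_ge0// exprn_ge0// invr_ge0.
have -> : (MkDualL0 up - \sum_(0 <= k < N) x k) f = -1 * s N f + LIM (s^~ f).
  rewrite addrC -scaleN1r; apply: (etrans (dual_combE _ _ _ _)).
  by rewrite dual_sumE.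
have B k : normc (s k f) <= 2 * c * rnorm f + normc (s N f).
  by rewrite (le_trans (s0 _ _))// lerDl normc_ge0.
have <- : LIM (fun k => -1 * s N f + s k f) = -1 * s N f + LIM (s^~ f).
  have := LIMD (-1) (fun=> s N f) (s^~ f) (2 * c * rnorm f + normc (s N f)).
  by rewrite LIMc; apply => // k; rewrite lerDr !mulr_ge0 ?rnorm_ge0.
rewrite (_ : 4 * c * _ * _ = 2 * (2 * c * 2^-1 ^+ N * rnorm f)); last by ring.
apply: (LIMle _ _ (2 * c * rnorm f) N) => k.
  rewrite (le_trans (sB N k f))// ler_wpM2r ?rnorm_ge0// ler_piMr ?mulr_ge0//.
  by rewrite exprn_ile1 ?invr_ge0// invf_le1// ler1n.
by move=> Nk; rewrite (le_trans (sB N k f))// (minn_idPl Nk).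
Qed.

Lemma compact_support_L0 (h : R -> R[i]) (c N : R) : 0 <= c -> cmeasurable H h ->
  (forall x, 0 <= x -> normc (h x) <= c) -> (forall x, N <= x -> h x = 0) ->
  h \in L0_pred w.
Proof.
move=> c0 mh hc hN; apply: (@L0_predI _ _ _ c).
  split => //; apply: ae_forallT => x /half_lineP x0; rewrite (le_trans (hc x x0))//.
  by rewrite ler_peMr// weight_ge1.
move=> e e0; exists (Num.max N 0); first by rewrite le_max lexx orbT.
apply: ae_forallT => x; rewrite gt_max => /andP[Nx x0].
have -> : h x = 0 by apply: hN; exact: ltW.
by rewrite normc0 mulr_ge0 ?weight_ge0// ltW.
Qed.

Lemma shift_class (s : R) (s0 : 0 <= s) (h : L0_fun w) :
  \forall x \ae mu, H x -> L0_repr (L0_shift s0 (L0_class h)) x = h (s + x).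
Proof.
have := ae_shift s (repr_class h).
apply: ae_imp2 (repr_shift s0 (L0_class h)) => x e1 e2 Hx.
by rewrite e1// e2//; exact: half_shift.
Qed.

Definition compact_support f := exists (h : L0_fun w) (c N : R),
  [/\ 0 <= N, 0 <= c, forall x, 0 <= x -> normc (h x) <= c,
      forall x, N <= x -> h x = 0 & f = L0_class h].

Lemma hump_sequence f : compact_support f ->
  exists (N : R) (N0 : 0 <= N) (F : nat -> L0 w), [/\ F 0%N = f,
    forall k, L0_shift N0 (F k.+1) = F k & L0_shift N0 (F 0%N) = 0].
Proof.
move=> [h [c [N [N0 c0 hc hN ->]]]]; exists N, N0.
have mh : cmeasurable H h by have /L0_predP[] := L0_valP h.
have tP (s : R) : 0 <= s -> translate s h \in L0_pred w.
  move=> s0; apply: (@compact_support_L0 _ c (s + N)) => //.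
  - exact: cmeasurable_translate.
  - move=> x x0; rewrite /translate; have [xs|xs] := boolP (0 <= x - s).
      by rewrite zext_ge0// hc.
    by rewrite zext_lt0// normc0.
  - move=> x sNx; rewrite /translate zext_ge0 ?hN//; first by rewrite lerBrDl.
    by rewrite subr_ge0 (le_trans _ sNx)// lerDl.
have kN k : 0 <= k%:R * N by rewrite mulr_ge0.
exists (fun k => L0_class (MkL0Fun (tP _ (kN k)))); split.
- apply/L0_classP; apply: ae_forallT => x /half_lineP x0.
  by rewrite -[LHS]/(zext h (x - 0 * N)) mul0r subr0 zext_ge0.
- move=> k; apply/L0_eqP.
  apply: ae_imp2
    (shift_class N0 (MkL0Fun (tP _ (kN k.+1)))) (repr_class (MkL0Fun (tP _ (kN k)))) => x e1 e2 Hx.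
  rewrite e1// e2// -[LHS]/(zext h (N + x - k.+1%:R * N)) -[RHS]/(zext h (x - k%:R * N)).
  by congr zext; rewrite -natr1; ring.
- rewrite -(L0_class0 w); apply/L0_eqP.
  apply: ae_imp2
    (shift_class N0 (MkL0Fun (tP _ (kN 0%N)))) (repr_class (0 : L0_fun w)) => x e1 e2 Hx.
  have /half_lineP x0 := Hx.
  rewrite e1// e2// -[LHS]/(zext h (N + x - 0 * N)) mul0r subr0.
  by rewrite zext_ge0 ?addr_ge0// hN// lerDl.
Qed.

Lemma compact_support_dense f (e : R) : 0 < e -> exists g,
  [/\ compact_support g, rnorm g <= rnorm f & rnorm (f - g) <= e].
Proof.
move=> e0; have [g [mg gf fg]] := wbounded_repr (rnorm_ge0 f) (wbounded_repr_class f).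
have [N N0 fN] := L0_tail (L0_repr f) e0.
have N1 : 0 <= N + 1 by rewrite addr_ge0.
have [W W0 wW] := weight_bounded w N1.
pose h x : R[i] := (\1_`[0, N] x : R)%:C * g x.
have hE x : 0 <= x -> h x = if x <= N then g x else 0.
  by move=> x0; rewrite /h indicE mem_setE in_itv/= x0/=; case: (x <= N); rewrite ?mul1r ?mul0r.
have hg x : 0 <= x -> normc (h x) <= rnorm f * w x.
  move=> x0; rewrite hE//; case: ifP => _; first exact: gf.
  by rewrite normc0 mulr_ge0 ?rnorm_ge0 ?weight_ge0.
have mh : cmeasurable H h.
  apply: cmeasurableM => //.
  by apply: cmeasurable_real; exact: measurable_indic.
have hc x : 0 <= x -> normc (h x) <= rnorm f * W.
  move=> x0; have [xN|xN] := leP x N.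
    rewrite (le_trans (hg x x0))// ler_wpM2l ?rnorm_ge0// wW// x0 (le_trans xN)//.
    by rewrite lerDl.
  by rewrite hE// (lt_geF xN) normc0 mulr_ge0 ?rnorm_ge0// ltW.
have hN x : N + 1 <= x -> h x = 0.
  move=> Nx; have xN : N < x by rewrite (lt_le_trans _ Nx)// ltrDl.
  by rewrite hE ?(le_trans N0 (ltW xN))// (lt_geF xN).
have c0 : 0 <= rnorm f * W by rewrite mulr_ge0 ?rnorm_ge0// ltW.
pose h' := MkL0Fun (compact_support_L0 c0 mh hc hN).
exists (L0_class h'); split; first by exists h', (rnorm f * W), (N + 1).
  by apply: rnorm_class_le; split => //; apply: ae_forallT => x /half_lineP; exact: hg.
rewrite -[f - _]L0_reprK; apply: rnorm_class_le; split; first exact: L0_measurable.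
have e1 := repr_comb (-1) (L0_class h') f.
apply: (ae_imp2 _ (ae_imp2 _ e1 (repr_class h')) (ae_imp2 _ fg fN)); last 2 first.
- by move=> x p1 p2; exact: (conj p1 p2).
- by move=> x p1 p2; exact: (conj p1 p2).
move=> x [p1 p2] [p3 p4] Hx; have /half_lineP x0 := Hx.
rewrite addrC -scaleN1r p1// p2// -[L0_val h' x]/(h x) hE// mulN1r.
have [xN|xN] := leP x N; last by rewrite oppr0 add0r; exact: p4.
by rewrite p3// addNr normc0 mulr_ge0 ?weight_ge0// ltW.
Qed.

End hump_sequences.

Lemma continuous_comp_within (T U V : topologicalType) (A : set U)
    (G : T -> U) (D : U -> V) : continuous G -> (forall y, A (G y)) ->
  {within A, continuous D} -> continuous (D \o G).
Proof.
move=> Gc AG /subspace_continuousP Dc x.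
have GA : G @ x --> within A (nbhs (G x)).
  move=> B wB; have := Gc x _ wB; apply: (@filterS _ (nbhs x)) => y.
  by apply; exact: AG.
exact: cvg_comp GA (Dc _ (AG x)).
Qed.

Section linear_maps.
Context {K : pzRingType} {U V : lmodType K} (F : U -> V).
Hypothesis F_linear : linear F.

Lemma linear_mapB x y : F (x - y) = F x - F y.
Proof. by rewrite addrC -scaleN1r F_linear scaleN1r addrC. Qed.

Lemma linear_mapD x y : F (x + y) = F x + F y.
Proof. by rewrite -[x in LHS]scale1r F_linear scale1r. Qed.

Lemma linear_map0 : F 0 = 0.
Proof. by rewrite -(subrr 0) linear_mapB subrr. Qed.

Lemma linear_mapZ a x : F (a *: x) = a *: F x.
Proof. by rewrite -[a *: x]addr0 F_linear linear_map0 addr0. Qed.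

End linear_maps.

(** * Derivations *)

Section derivation.
Context {R : realType} (w : weight R).
Implicit Types (f g : L0 w) (phi psi : R -> R[i]) (n m x : dualL0 w).
Variables (E : dualL0 w -> dualL0 w) (u : dualL0 w).
Hypothesis E_linear : linear E.
Hypothesis E_der : forall m n, E (arens m n) = arens (E m) n + arens m (E n).
Hypothesis u_id : forall m, arens m u = m.

Lemma der_subE x y g : E (x - y) g = E x g - E y g.
Proof. exact: (congr1 (fun m => dual_fun m g) (linear_mapB E_linear x y)). Qed.

Lemma der_scaleE a x g : E (a *: x) g = a * E x g.
Proof. exact: (congr1 (fun m => dual_fun m g) (linear_mapZ E_linear a x)). Qed.

Lemma der_hump_sequence (s : R) (s0 : 0 <= s) (F : nat -> L0 w) phi :
  L1w w phi -> (forall k, L0_shift s0 (F k.+1) = F k) ->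
  L0_shift s0 (F 0%N) = 0 ->
  exists C, forall x, normc (E x (L0_conv (F 0%N) phi)) <= C * rnorm x.
Proof.
move=> hphi FS F0; pose a := point_mass s0 u; pose P x := arens a x.
pose G k := L0_conv (F k) phi.
have linP : linear P by move=> b x y; exact: arens_combr.
have Pr x : rnorm (P x) <= 4 * rnorm a * rnorm x by exact: rnorm_arens.
have r0 : 0 <= 4 * rnorm a by rewrite mulr_ge0 ?rnorm_ge0.
have Prk k x : rnorm (iter k P x) <= (4 * rnorm a) ^+ k * rnorm x.
  elim: k => [|k IH]; first by rewrite mul1r.
  by rewrite iterS (le_trans (Pr _))// exprS -[_ * _ ^+ k * _]mulrA ler_wpM2l.
have EaP x g : E (P x) g = arens (E a) x g + arens a (E x) g.
  exact: (congr1 (fun m => dual_fun m g) (E_der a x)).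
have aS x k : arens a (E x) (G k.+1) = E x (G k).
  exact: (etrans (arens_point_mass s0 u_id (E x) (F k.+1) hphi)
    (congr1 (fun f => E x (L0_conv f phi)) (FS k))).
have a0 x : arens a (E x) (G 0%N) = 0.
  apply: (etrans (arens_point_mass s0 u_id (E x) (F 0%N) hphi)); rewrite F0.
  suff -> : L0_conv (0 : L0 w) phi = 0 by exact: dual0.
  apply: rnorm_eq0; apply/eqP; rewrite eq_le rnorm_ge0 andbT.
  by rewrite (le_trans (rnorm_conv _ hphi))// rnorm0 mulr0 mul0r.
have EP x k : E (P x) (G k.+1) = arens (E a) x (G k.+1) + E x (G k).
  exact: (etrans (EaP x _) (congr1 (+%R _) (aS x k))).
have EP0 x : E (P x) (G 0%N) = arens (E a) x (G 0%N).
  exact: (etrans (EaP x _) (etrans (congr1 (+%R _) (a0 x)) (addr0 _))).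
have arB n m g : normc (arens n m g) <= 4 * rnorm n * rnorm m * rnorm g.
  apply: (le_trans (normc_dual_le (arens n m) g)).
  by apply: (ler_wpM2r (rnorm_ge0 g)); exact: rnorm_arens.
have Ek k : exists2 C, 0 <= C & forall x,
    normc (E (iter k P x) (G k) - E x (G 0%N)) <= C * rnorm x.
  elim: k => [|k [C C0 IH]].
    by exists 0 => [|x]; rewrite ?lexx// [iter _ _ _]/= subrr normc0 mul0r.
  exists (4 * rnorm (E a) * (4 * rnorm a) ^+ k * rnorm (G k.+1) + C) => [|x].
    by rewrite addr_ge0 ?mulr_ge0 ?exprn_ge0 ?rnorm_ge0.
  rewrite iterS EP -addrA (le_trans (le_normcD _ _))// mulrDl lerD//.
  apply: (le_trans (arB _ _ _)); rewrite [leRHS]mulrAC; apply: (ler_wpM2r (rnorm_ge0 _)).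
  rewrite -[leRHS]mulrA; apply: ler_wpM2l; last exact: Prk.
  exact: (mulr_ge0 _ (rnorm_ge0 _)).
have G1 k : 0 < rnorm (G k) + 1 by rewrite ltr_wpDl ?rnorm_ge0.
have G2 k : 0 <= (rnorm (G k) + 1)^-1 by rewrite invr_ge0 ltW.
have [||||k [C hC]] := @gliding_hump R (dualL0 w) P (4 * rnorm a) nat
    (fun k i => i = k) (fun k x => normc (E x (G k)) / (rnorm (G k) + 1))
    (@dual_series_complete R w) linP Pr.
- move=> k x y; rewrite -mulrDl; apply: (ler_wpM2r (G2 k)).
  by rewrite der_subE (le_trans (le_normcD _ _))// normcN.
- move=> k t x t0; by rewrite der_scaleE normcM normc_real ger0_norm// mulrA.
- move=> x; exists (rnorm (E x)) => k _ ->; rewrite ler_pdivrMr//.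
  by rewrite (le_trans (normc_dual_le _ _))// ler_wpM2l ?rnorm_ge0// lerDl.
- move=> k _ ->; have [C C0 hC] := Ek k.
  exists ((C * (4 * rnorm a) + 4 * rnorm (E a) * rnorm (G 0%N)) / (rnorm (G k) + 1)) => x.
  rewrite mulrAC; apply: (ler_wpM2r (G2 k)); rewrite iterSr.
  have -> : E (iter k P (P x)) (G k) =
      (E (iter k P (P x)) (G k) - E (P x) (G 0%N)) + E (P x) (G 0%N) by rewrite subrK.
  rewrite (le_trans (le_normcD _ _))// mulrDl lerD//.
    by rewrite (le_trans (hC _))// -mulrA ler_wpM2l.
  by rewrite EP0 [leRHS]mulrAC; exact: arB.
have [C' _ hC'] := Ek k; exists (C * (rnorm (G k) + 1) + C') => x.
have := hC k x erefl; rewrite ler_pdivrMr// => hx.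
have -> : E x (G 0%N) = E (iter k P x) (G k) - (E (iter k P x) (G k) - E x (G 0%N)).
  by rewrite subKr.
rewrite (le_trans (le_normcD _ _))// normcN mulrDl lerD//.
by rewrite mulrAC.
Qed.

Lemma der_compact_bound : exists C, forall f phi x, compact_support f -> L1w w phi ->
  normc (E x (L0_conv f phi)) <= C * rnorm x * (rnorm f * L1norm w phi).
Proof.
pose N (z : L0 w * (R -> R[i])) := rnorm z.1 * L1norm w z.2.
have N0 z : 0 <= N z by exact: (mulr_ge0 (rnorm_ge0 _) (L1norm_ge0 _ _)).
have NV z : 0 <= (N z)^-1 by rewrite invr_ge0.
pose adm (k : nat) (z : L0 w * (R -> R[i])) := compact_support z.1 /\ L1w w z.2.
pose q (z : L0 w * (R -> R[i])) x := normc (E x (L0_conv z.1 z.2)) / N z.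
have EN x z : L1w w z.2 -> normc (E x (L0_conv z.1 z.2)) <= 2 * rnorm (E x) * N z.
  move=> hz; apply: (le_trans (normc_dual_le _ _)).
  rewrite [2 * _]mulrC -mulrA; apply: (ler_wpM2l (rnorm_ge0 _)).
  by rewrite /N mulrA; exact: rnorm_conv.
have iter_id k x : iter k id x = x by exact: iter_fix.
have [||||||k [C hC]] := @gliding_hump R (dualL0 w) id 1 _ adm q
    (@dual_series_complete R w).
- by [].
- by move=> x; rewrite mul1r.
- move=> z x y; rewrite /q -mulrDl; apply: (ler_wpM2r (NV z)).
  by rewrite der_subE (le_trans (le_normcD _ _))// normcN.
- move=> z t x t0; rewrite /q.
  by rewrite der_scaleE normcM normc_real ger0_norm// mulrA.
- move=> x; exists (2 * rnorm (E x)) => _ z [_ hz]; rewrite /q.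
  have [Nz|Nz] := eqVneq (N z) 0.
    by rewrite Nz invr0 mulr0 mulr_ge0 ?rnorm_ge0.
  by rewrite ler_pdivrMr ?lt_neqAle ?N0 1?eq_sym ?Nz//; exact: EN.
- move=> k z [/hump_sequence[s [s0 [F [Fz FS F0]]]] hz].
  have [C hC] := der_hump_sequence hz FS F0.
  exists (C / N z) => x; rewrite iter_id /q mulrAC; apply: (ler_wpM2r (NV z)).
  by rewrite -Fz; exact: hC.
exists C => f phi x cf hphi; have := hC (f, phi) x (conj cf hphi); rewrite iter_id /q /=.
rewrite -/(N (f, phi)); have [Nz _|Nz] := eqVneq (N (f, phi)) 0.
  have := EN x (f, phi) hphi; rewrite Nz !mulr0; exact.
by rewrite ler_pdivrMr// lt_neqAle N0 eq_sym Nz.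
Qed.

Lemma der_conv_bound : exists C, forall f phi x, L1w w phi ->
  normc (E x (L0_conv f phi)) <= C * rnorm x * (rnorm f * L1norm w phi).
Proof.
have [C hC] := der_compact_bound; exists `|C| => f phi x hphi.
have [K K0] : exists2 K : R, 0 <= K & forall e : R, 0 < e ->
    normc (E x (L0_conv f phi)) <= `|C| * rnorm x * (rnorm f * L1norm w phi) + K * e.
  exists (rnorm (E x) * (2 * L1norm w phi)) => [|e e0].
    exact: (mulr_ge0 (rnorm_ge0 _) (mulr_ge0 _ (L1norm_ge0 _ _))).
  have [g [cg gf fg]] := compact_support_dense f e0.
  have fE : L0_conv f phi = 1 *: L0_conv (f - g) phi + L0_conv g phi.
    rewrite -(L0_conv_comb _ _ _ hphi); congr (L0_conv _ phi).
    by rewrite scale1r subrK.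
  have -> : E x (L0_conv f phi) =
      E x (L0_conv (f - g) phi) + E x (L0_conv g phi).
    apply: (etrans (congr1 (dual_fun (E x)) fE)).
    by apply: (etrans (dual_linear _ _ _ _)); rewrite mul1r.
  rewrite (le_trans (le_normcD _ _))// addrC lerD//.
    apply: (le_trans (hC _ _ x cg hphi)).
    apply: (@le_trans _ _ (`|C| * rnorm x * (rnorm g * L1norm w phi))).
      apply: ler_wpM2r; first exact: (mulr_ge0 (rnorm_ge0 _) (L1norm_ge0 _ _)).
      by apply: (ler_wpM2r (rnorm_ge0 _)); exact: ler_norm.
    apply: ler_wpM2l; first exact: (mulr_ge0 _ (rnorm_ge0 _)).
    exact: (ler_wpM2r (L1norm_ge0 _ _)).
  apply: (le_trans (normc_dual_le _ _)).
  rewrite -mulrA; apply: (ler_wpM2l (rnorm_ge0 _)).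
  apply: (le_trans (rnorm_conv _ hphi)); rewrite mulrAC.
  by apply: ler_wpM2l => //; exact: (mulr_ge0 _ (L1norm_ge0 _ _)).
move=> hK; apply/ler_addgt0Pr => e e0.
have K1 : 0 < K + 1 by rewrite ltr_wpDl.
rewrite (le_trans (hK (e / (K + 1)) _)) ?divr_gt0// lerD2l mulrA ler_pdivrMr//.
by rewrite mulrC ler_pM2l// lerDl.
Qed.

Lemma der_left_mul_bound : exists M, forall x, rnorm (E (arens u x)) <= M * rnorm x.
Proof.
have [C hC] := der_conv_bound.
have aB x f : rnorm (L0_act (E x) f) <= 2 * (`|C| * rnorm x * rnorm f).
  apply: rnorm_le_pairing => [|phi hphi].
    exact: (mulr_ge0 (mulr_ge0 _ (rnorm_ge0 _)) (rnorm_ge0 _)).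
  rewrite L0_actP//; apply: (le_trans (hC f phi x hphi)); rewrite [leLHS]mulrA.
  apply: (ler_wpM2r (L1norm_ge0 _ _)); apply: (ler_wpM2r (rnorm_ge0 _)).
  by apply: (ler_wpM2r (rnorm_ge0 _)); exact: ler_norm.
have uB x : rnorm (arens u (E x)) <= rnorm u * (2 * `|C|) * rnorm x.
  apply: rnorm_dual_le => [|f].
    by rewrite !mulr_ge0 ?rnorm_ge0.
  rewrite (arensE u (E x) f); apply: (le_trans (normc_dual_le _ _)).
  rewrite -!mulrA; apply: (ler_wpM2l (rnorm_ge0 _)).
  by have := aB x f; rewrite -mulrA.
exists (4 * rnorm (E u) + rnorm u * (2 * `|C|)) => x.
rewrite E_der (le_trans (rnormD _ _))// mulrDl lerD//; exact: rnorm_arens.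
Qed.

End derivation.

Theorem proposition2p3 (R : realType) (w : weight R)
    (theta D : dualL0 w -> dualL0 w)
    (theta_iso : algebra_iso theta) (theta_cont : continuous theta)
    (D_der : theta_derivation theta D) :
  (forall u : dualL0 w, normed_right_ids w u ->
     {within right_ideal u, continuous D}) /\
  (continuous D <-> {within right_annihilator w, continuous D}).
Proof.
case: theta_iso => -[theta_lin theta_mul] [theta' thetaK thetaK'].
case: D_der => D_lin D_mul; pose E x := theta' (D x).
have ED x : theta (E x) = D x by exact: thetaK'.
have E_lin : linear E.
  move=> a x y; apply: (can_inj thetaK); rewrite ED theta_lin !ED; exact: D_lin.
have E_der m n : E (arens m n) = arens (E m) n + arens m (E n).
  apply: (can_inj thetaK); apply: (etrans (ED _)); apply: (etrans (D_mul _ _)).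
  apply/esym; apply: (etrans (linear_mapD theta_lin _ _)).
  have e1 : theta (arens (E m) n) = arens (D m) (theta n).
    by apply: (etrans (theta_mul _ _)); rewrite ED.
  have e2 : theta (arens m (E n)) = arens (theta m) (D n).
    exact: (etrans (theta_mul m (E n)) (congr1 (arens (theta m)) (ED n))).
  exact: (congr2 +%R e1 e2).
have Du_cont u : (forall m, arens m u = m) -> continuous (fun x => D (arens u x)).
  move=> u_id; have [M hM] := der_left_mul_bound E_lin E_der u_id.
  have lin : linear (fun x => E (arens u x)).
    by move=> a x y; rewrite arens_combr E_lin.
  have Ec := bounded_continuous lin hM.
  rewrite (_ : (fun x => _) = theta \o (fun x => E (arens u x))).
    by move=> x; apply: continuous_comp; [exact: Ec|exact: theta_cont].
  by apply/funext => x /=; rewrite ED.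
split=> [u [u_id _]|].
  have uD : {in right_ideal u, (fun x => D (arens u x)) =1 D}.
    by move=> x /[!inE] -[m _ <-]; rewrite -arensA u_id.
  apply: (subspace_eq_continuous uD); exact/continuous_subspaceT/Du_cont.
split=> [|D_ran]; first exact: continuous_subspaceT.
have [u u_id] := right_identity_exists w.
pose G (x : dualL0 w) : dualL0 w := x - arens u x.
have arens_lin (m : dualL0 w) : linear (arens m) by move=> a x y; exact: arens_combr.
have G_ran x : right_annihilator w (G x).
  move=> m; have e := linear_mapB (arens_lin m) x (arens u x).
  by rewrite -[LHS]/(arens m (x - arens u x)) e -arensA u_id subrr.
have u_cont : continuous (arens u).
  by apply: (bounded_continuous (arens_lin u)) => x; exact: rnorm_arens.
have G_cont : continuous G by move=> x; exact: (cvgB (@cvg_id _ (nbhs x)) (u_cont x)).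
rewrite (_ : D = fun x => D (arens u x) + D (G x)); last first.
  apply/funext => x; rewrite -(linear_mapD D_lin); congr D.
  by rewrite /G addrC subrK.
have DG := continuous_comp_within G_cont G_ran D_ran.
by move=> x; exact: (cvgD (Du_cont u u_id x) (DG x)).
Qed.
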